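(* Let $\nu_c=1+1/\sqrt7$. Almost surely, the simple random walk on a random infinite triangulation distributed according to $\mathbb P_\infty^{\nu_c}$ (the critical Infinite Ising Planar Triangulation) is recurrent.
   Context: Triangulations are rooted planar maps (loops and multiple edges allowed) all of whose faces have degree 3, endowed with a spin configuration $\sigma:V\to\{\oplus,\ominus\}$; $m(T,\sigma)$ is the number of monochromatic edges (edges whose endpoints have equal spins). For $\nu>0$, $\mathbb P_n^\nu$ is the probability measure on finite spinned triangulations with $3n$ edges proportional to $\nu^{m(T,\sigma)}$. The local topology is that of the distance $d_{loc}((T,\sigma),(T',\sigma'))=(1+\sup\{R: B_R(T,\sigma)=B_R(T',\sigma')\})^{-1}$, where $B_R$ is the submap made of faces with a vertex at distance $<R$ from the root vertex, with spins. The paper proves that $\mathbb P_n^\nu$ converges weakly for the local topology to a probability measure $\mathbb P_\infty^\nu$ supported on one-ended infinite spinned triangulations; a random triangulation with law $\mathbb P_\infty^{\nu}$ is the $\nu$-IIPT. *)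

(* Defs.v *)
From HB Require Import structures.
From mathcomp Require Import all_boot all_order all_algebra.
From mathcomp Require Import finmap.
From mathcomp Require Import all_classical all_reals all_analysis.

Set Implicit Arguments.
Unset Strict Implicit.
Unset Printing Implicit Defensive.
Import Order.TTheory GRing.Theory Num.Theory.
Import numFieldNormedType.Exports.

Local Open Scope classical_set_scope.
Local Open Scope ring_scope.

Definition card_of (T : choiceType) (A : set T) : nat := #|` fset_set A|%fset.

(** Forward orbit; it is the whole orbit of [x] whenever [f] permutes it and
    it is finite. *)
Definition forbit (T : Type) (f : T -> T) (x : T) : set T :=
  range (fun k => iter k f x).

(** Rooted maps with spins, in their combinatorial (rotation system) encoding.
    A dart is an edge together with one of its two orientations; [opp] reverses
    a dart and [nxt] is the next dart, in the cyclic order, around the same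
    origin. The root is a dart and the root vertex is its origin. [spin d] is
    the spin of the origin of [d] ([true] for plus). The dart set is a subset
    of [nat] (a connected locally finite map is countable), and the values of
    [opp], [nxt] and [spin] outside of it are irrelevant: see [map_iso]. *)
Record smap := SMap {
  darts : set nat ;
  root : nat ;
  opp : nat -> nat ;
  nxt : nat -> nat ;
  spin : nat -> bool }.

Section maps.
Implicit Types (m : smap) (d e : nat).

Definition vertex m d : set nat := forbit (nxt m) d.
Definition edge m d : set nat := [set d; opp m d].
Definition face m d : set nat := forbit (nxt m \o opp m) d.

Definition vertices m : set (set nat) := vertex m @` darts m.
Definition edges m : set (set nat) := edge m @` darts m.
Definition faces m : set (set nat) := face m @` darts m.

(** The darts whose origin is at graph distance at most [k] from the root
    vertex. *)
Fixpoint within m (k : nat) : set nat :=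
  if k is k'.+1 then
    within m k' `|` [set d | exists2 e, within m k' e & vertex m (opp m e) d]
  else vertex m (root m).

Definition is_map m : Prop :=
  [/\ darts m (root m),
      set_bij (darts m) (darts m) (nxt m),
      forall d, darts m d ->
        [/\ darts m (opp m d), opp m (opp m d) = d & opp m d <> d],
      forall d, darts m d ->
        finite_set (vertex m d) /\ spin m (nxt m d) = spin m d
    & forall d, darts m d -> exists k, within m k d].

Definition is_triangulation m : Prop :=
  is_map m /\ forall d, darts m d -> card_of (face m d) = 3%N.

(** Planarity of a finite connected map is genus zero in Euler's formula. *)
Definition finite_planar m : Prop :=
  finite_set (darts m) /\
  (card_of (vertices m) + card_of (faces m) = card_of (edges m) + 2)%N.

Definition finite_triangulation m : Prop :=
  is_triangulation m /\ finite_planar m.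

(** Equality of rooted spinned maps, i.e. orientation-preserving isomorphism. *)
Definition map_iso m m' : Prop :=
  exists f : nat -> nat,
    [/\ set_bij (darts m) (darts m') f,
        f (root m) = root m'
      & forall d, darts m d ->
          [/\ f (opp m d) = opp m' (f d),
              f (nxt m d) = nxt m' (f d)
            & spin m' (f d) = spin m d]].

(** The submap spanned by a set [D] of darts closed under [opp]: the rotation
    around a vertex skips the darts that are not in [D]. *)
Definition next_in (D : set nat) (s : nat -> nat) d : nat :=
  xget d [set e | exists k, [/\ (0 < k)%N, e = iter k s d, D e &
                   forall j, (0 < j < k)%N -> ~ D (iter j s d)]].

Definition submap m (D : set nat) : smap :=
  SMap D (root m) (opp m) (next_in D (nxt m)) (spin m).

(** [near_face m r d]: the face of [d] has a vertex at distance [< r] from the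
    root vertex. *)
Definition near_face m (r : nat) d : Prop :=
  exists k e, [/\ (k < r)%N, face m d e & within m k e].

(** Each edge lies on the faces of its two darts. *)
Definition mball m (r : nat) : smap :=
  submap m [set d | darts m d /\ (near_face m r d \/ near_face m r (opp m d))].

(** The infinite elements of the completion of the set of finite
    triangulations for the local distance: every ball is a ball of some finite
    planar triangulation. *)
Definition infinite_triangulation m : Prop :=
  [/\ is_triangulation m, infinite_set (darts m) &
      forall r, exists2 m', finite_triangulation m' &
        map_iso (mball m r) (mball m' r)].

End maps.

Record triangulation := Triangulation {
  tri_map :> smap ;
  triP : finite_triangulation tri_map \/ infinite_triangulation tri_map }.

HB.instance Definition _ := gen_eqMixin triangulation.
HB.instance Definition _ := gen_choiceMixin triangulation.

Section iso_equivalence.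
Implicit Types m : triangulation.

Lemma tri_is_map m : is_map m.
Proof. by case: (triP m) => [[[]]|[[]]]. Qed.

Definition tri_iso : rel triangulation := fun m m' => `[< map_iso m m' >].

Lemma tri_iso_refl : reflexive tri_iso.
Proof.
move=> m; apply/asboolP; exists id; split => //; split => // x mx.
by exists x.
Qed.

Lemma tri_iso_trans : transitive tri_iso.
Proof.
move=> m2 m1 m3 /asboolP[f [bf rf fE]] /asboolP[g [bg rg gE]].
apply/asboolP; exists (g \o f); split; first exact: set_bij_comp bf bg.
  by rewrite /= rf rg.
move=> d dd /=; have [f1 f2 f3] := fE _ dd.
have dfd : darts m2 (f d) by case: bf => h _ _; exact: h.
have [g1 g2 g3] := gE _ dfd.
by rewrite f1 f2 g1 g2 g3 f3.
Qed.

Lemma tri_iso_sym : symmetric tri_iso.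
Proof.
suff h m m' : tri_iso m m' -> tri_iso m' m by move=> m m'; apply/idP/idP; exact: h.
move=> /asboolP[f [[fun_f inj_f surj_f] rf fE]].
have [rm [nm _ _] om _ _] := tri_is_map m.
pose g e := xget 0%N [set d | darts m d /\ f d = e].
have gP e : darts m' e -> darts m (g e) /\ f (g e) = e.
  move=> /surj_f[d dd fd].
  by rewrite /g; case: xgetP => [x _ //|/(_ d)[]].
have fK d : darts m d -> g (f d) = d.
  move=> dd; have [h1 h2] := gP _ (fun_f _ dd).
  by apply: inj_f; rewrite ?inE.
apply/asboolP; exists g; split.
- split.
  + by move=> e /gP[].
  + move=> x y; rewrite !inE => /gP[_ {2}<-] /gP[_ {2}<-] -> //.
  + by move=> d dd; exists (f d); [exact: fun_f|exact: fK].
- by rewrite -rf fK.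
- move=> e /gP[dg fg]; have [h1 h2 h3] := fE _ dg.
  have [h4 _ _] := om _ dg; split.
  + by rewrite -[in LHS]fg -h1 fK.
  + by rewrite -[in LHS]fg -h2 fK//; exact: nm.
  + by rewrite -h3 fg.
Qed.

Canonical tri_iso_equiv : equiv_rel triangulation :=
  EquivRel tri_iso tri_iso_refl tri_iso_sym tri_iso_trans.

End iso_equivalence.

(** The set of all (finite or infinite) rooted spinned triangulations: maps
    are considered up to isomorphism. *)
Definition ising_tri : Type := {eq_quot tri_iso_equiv}%qT.
HB.instance Definition _ := Choice.on ising_tri.

Definition tri_class (m : triangulation) : ising_tri :=
  (\pi_({eq_quot tri_iso_equiv}) m)%qT.

Definition rep (t : ising_tri) : smap :=
  tri_map (repr (t : {eq_quot tri_iso_equiv}%qT)).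

(** The space is inhabited: a triangle on the sphere, with darts
    [0 : A -> B], [1 : B -> A], [2 : B -> C], [3 : C -> B], [4 : C -> A] and
    [5 : A -> C]. *)
Section triangle.

Definition triangle : smap :=
  SMap `I_6 0
    (fun d => nth 0 [:: 1; 0; 3; 2; 5; 4] d)%N
    (fun d => nth 0 [:: 5; 2; 1; 4; 3; 0] d)%N
    (fun=> true).

Let forbitE (f : nat -> nat) x (l : seq nat) : x \in l ->
  all (fun y => f y \in l) l -> all (mem (traject f x 6)) l ->
  forbit f x = [set` l].
Proof.
move=> xl /allP fl /allP lt; apply/seteqP; split => [_ [k _ <-]|y] /=.
  by elim: k => //= k; exact: fl.
by move=> /lt /trajectP[k _ ->]; exists k.
Qed.

Let I6P (P : nat -> Prop) :
  P 0%N -> P 1%N -> P 2%N -> P 3%N -> P 4%N -> P 5%N -> forall d, `I_6 d -> P d.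
Proof. by move=> ? ? ? ? ? ?; do 6 (case => //). Qed.

Let vE : [/\ vertex triangle 0 = [set` [:: 0; 5]%N],
  vertex triangle 1 = [set` [:: 1; 2]%N],
  vertex triangle 2 = [set` [:: 1; 2]%N],
  vertex triangle 3 = [set` [:: 3; 4]%N] &
  vertex triangle 4 = [set` [:: 3; 4]%N] /\
  vertex triangle 5 = [set` [:: 0; 5]%N]].
Proof. by split; [..|split]; exact: forbitE. Qed.

Let fE : [/\ face triangle 0 = [set` [:: 0; 2; 4]%N],
  face triangle 1 = [set` [:: 1; 3; 5]%N],
  face triangle 2 = [set` [:: 0; 2; 4]%N],
  face triangle 3 = [set` [:: 1; 3; 5]%N] &
  face triangle 4 = [set` [:: 0; 2; 4]%N] /\
  face triangle 5 = [set` [:: 1; 3; 5]%N]].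
Proof. by split; [..|split]; exact: forbitE. Qed.

Let eE : [/\ edge triangle 0 = [set` [:: 0; 1]%N],
  edge triangle 1 = [set` [:: 0; 1]%N],
  edge triangle 2 = [set` [:: 2; 3]%N],
  edge triangle 3 = [set` [:: 2; 3]%N] &
  edge triangle 4 = [set` [:: 4; 5]%N] /\
  edge triangle 5 = [set` [:: 4; 5]%N]].
Proof.
by split; [..|split]; apply/seteqP; split => x /=; rewrite /edge/= !inE;
  do ?[by move=> [] ->; rewrite ?eqxx ?orbT];
  move=> /orP[] /eqP ->; tauto.
Qed.

Let card_of_seq (T : choiceType) (l : seq T) : uniq l ->
  card_of [set` l] = size l.
Proof.
move=> ul; rewrite /card_of -(_ : seq_fset tt l = fset_set [set` l]).
  by rewrite size_seq_fset undup_id.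
by apply/fsetP => x; rewrite seq_fsetE in_fset_set//= mem_setE.
Qed.

Let neq_seq (l1 l2 : seq nat) x : x \in l1 -> x \notin l2 ->
  [set` l1] != [set` l2] :> set nat.
Proof.
by move=> xl1 /negP xl2; apply/eqP => /seteqP[/(_ x) /= + _]; move=> /(_ xl1).
Qed.

Lemma triangleP : finite_triangulation triangle.
Proof.
case: vE => v0 v1 v2 v3 [v4 v5].
case: fE => f0 f1 f2 f3 [f4 f5].
case: eE => e0 e1 e2 e3 [e4 e5].
split; split.
- split => //.
  + split.
    * by apply: I6P.
    * by move=> x y; rewrite !inE; move: x; apply: I6P; move: y; apply: I6P.
    * by apply: I6P; [exists 5%N|exists 2%N|exists 1%N|exists 4%N|exists 3%N
                     |exists 0%N].
  + by apply: I6P.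
  + by move=> d d6; split => //; move: d d6; apply: I6P;
      rewrite ?(v0, v1, v2, v3, v4, v5).
  + have o d : vertex triangle d d by exists 0%N.
    have w0 : within triangle 0 0 by exact: o.
    have w5 : within triangle 0 5 by rewrite /= v0.
    apply: I6P.
    * by exists 0%N.
    * by exists 1%N; right; exists 0%N.
    * by exists 1%N; right; exists 0%N; rewrite ?v1.
    * by exists 1%N; right; exists 5%N; rewrite ?v4.
    * by exists 1%N; right; exists 5%N; rewrite ?v4.
    * by exists 0%N.
- by apply: I6P; rewrite ?(f0, f1, f2, f3, f4, f5) card_of_seq.
- exact: finite_II.
- rewrite (_ : vertices triangle = [set` [:: vertex triangle 0;
    vertex triangle 1; vertex triangle 3]]); last first.
    apply/seteqP; split => [_ [d + <-]|x].
      by move: d; apply: I6P; rewrite /= !inE ?(v2, v4, v5, v0, v1, v3) ?eqxx ?orbT.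
    by rewrite /= !inE => /or3P[] /eqP ->; [exists 0%N|exists 1%N|exists 3%N].
  rewrite (_ : edges triangle = [set` [:: edge triangle 0;
    edge triangle 2; edge triangle 4]]); last first.
    apply/seteqP; split => [_ [d + <-]|x].
      by move: d; apply: I6P; rewrite /= !inE ?(e1, e3, e5, e0, e2, e4) ?eqxx ?orbT.
    by rewrite /= !inE => /or3P[] /eqP ->; [exists 0%N|exists 2%N|exists 4%N].
  rewrite (_ : faces triangle = [set` [:: face triangle 0; face triangle 1]]);
    last first.
    apply/seteqP; split => [_ [d + <-]|x].
      by move: d; apply: I6P; rewrite /= !inE ?(f2, f3, f4, f5, f0, f1) ?eqxx ?orbT.
    by rewrite /= !inE => /orP[] /eqP ->; [exists 0%N|exists 1%N].
  rewrite v0 v1 v3 e0 e2 e4 f0 f1; have ns := neq_seq.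
  rewrite (card_of_seq (l := [:: [set` [:: 0; 5]%N]; [set` [:: 1; 2]%N]; _])).
    rewrite (card_of_seq (l := [:: _; [set` [:: 1; 3; 5]%N]])).
      rewrite card_of_seq//= !inE negb_or (ns _ _ 0%N)// (ns _ _ 0%N)//.
      by rewrite (ns _ _ 2%N).
    by rewrite /= !inE (ns _ _ 0%N).
  by rewrite /= !inE negb_or (ns _ _ 0%N)// (ns _ _ 0%N)// (ns _ _ 1%N).
Qed.

End triangle.

(** The space of rooted spinned triangulations with the local topology. The
    parameter is the type of the values of the distance. *)
Definition local_space (R : realType) : Type := ising_tri.

Section local_topology.
Variable R : realType.

HB.instance Definition _ := Choice.on (local_space R).
HB.instance Definition _ := isPointed.Build (local_space R)
  (tri_class (Triangulation (or_introl triangleP))).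

Definition d_loc (t t' : ising_tri) : R :=
  fine ((1 + ereal_sup [set (r%:R)%:E | r in
          [set r : nat | map_iso (mball (rep t) r) (mball (rep t') r)]])^-1)%E.

Definition loc_open (U : set (local_space R)) : Prop :=
  forall t, U t -> exists2 e : R, 0 < e & [set t' | d_loc t t' < e] `<=` U.

Let loc_openT : loc_open setT.
Proof. by move=> t _; exists 1. Qed.

Let loc_openI : setI_closed loc_open.
Proof.
move=> A B oA oB t [/oA[e e0 eA] /oB[f f0 fB]].
exists (Num.min e f); first by rewrite lt_min e0.
by move=> t' /=; rewrite lt_min => /andP[te tf]; split; [exact: eA|exact: fB].
Qed.

Let loc_open_bigU (I : Type) (f : I -> set (local_space R)) :
  (forall i, loc_open (f i)) -> loc_open (\bigcup_i f i).
Proof.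
move=> fo t [i _ /fo[e e0 ef]]; exists e => // t' /ef ft'.
by exists i.
Qed.

HB.instance Definition _ := isOpenTopological.Build (local_space R)
  loc_openT loc_openI loc_open_bigU.

(** The same space with its Borel sigma-algebra. *)
Definition borel_space := g_sigma_algebraType (@open (local_space R)).
HB.instance Definition _ := Measurable.on borel_space.

End local_topology.

Section ising.
Variable R : realType.
Implicit Types (nu : {posnum R}) (m : smap).

Definition mono_edges m : set (set nat) :=
  edge m @` [set d | darts m d /\ spin m d = spin m (opp m d)].

(** Finite triangulations with [3 n] edges. *)
Definition size_tri (n : nat) : set ising_tri :=
  [set t | finite_triangulation (rep t) /\ card_of (edges (rep t)) = (3 * n)%N].

(** The measure giving mass [nu ^ m(T, sigma)] to each finite spinned
    triangulation with [3 n] edges. *)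
Definition ising_weight nu (n : nat) (A : set (borel_space R)) : \bar R :=
  \esum_(t in A `&` size_tri n) (nu%:num ^+ card_of (mono_edges (rep t)))%:E.

Section ising_weight_measure.
Variables (nu : {posnum R}) (n : nat).

Let ising_weight0 : ising_weight nu n set0 = 0%E.
Proof. by rewrite /ising_weight set0I esum_set0. Qed.

Let ising_weight_ge0 A : (0 <= ising_weight nu n A)%E.
Proof. by apply: esum_ge0 => t _; rewrite lee_fin. Qed.

Let ising_weight_sigma_additive : semi_sigma_additive (ising_weight nu n).
Proof.
move=> F mF tF mUF; rewrite /ising_weight setI_bigcupl.
rewrite nneseries_sum_bigcup.
- by apply: is_cvg_nneseries => k _ _; exact: ising_weight_ge0.
- exact: trivIset_setIr.
- by move=> t; rewrite lee_fin.
Qed.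

HB.instance Definition _ := isMeasure.Build _ _ _ (ising_weight nu n)
  ising_weight0 ising_weight_ge0 ising_weight_sigma_additive.

End ising_weight_measure.

(** [P_n^nu]; the default value [dirac point] is only used for [n = 0], where
    there is no triangulation. *)
Definition ising_law nu (n : nat) : probability (borel_space R) R :=
  mnormalize (ising_weight nu n) (dirac point).

(** Weak convergence for the local topology. *)
Definition loc_cvg (Pn : nat -> probability (borel_space R) R)
    (P : probability (borel_space R) R) : Prop :=
  forall f : local_space R -> R, continuous f ->
    (exists M : R, forall t, `|f t| <= M) ->
    (fun n => \int[Pn n]_t (f t)%:E)%E @ \oo --> (\int[P]_t (f t)%:E)%E.

(** [P] is [P_infty^nu], the law of the nu-IIPT. *)
Definition IIPT_law nu (P : probability (borel_space R) R) : Prop :=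
  loc_cvg (ising_law nu) P.

Definition nu_c : {posnum R} := (1 + (Num.sqrt 7)^-1)%:pos.

End ising.

Section random_walk.
Variable R : realType.
Implicit Types (m : smap) (u v : set nat).

(** Transition probability of the simple random walk on the multigraph
    underlying [m]: a dart is chosen uniformly among those issued from [u] (so
    that loops count twice), and the walk moves to the origin of its
    reverse. *)
Definition srw_step m u v : R :=
  (card_of (u `&` [set d | vertex m (opp m d) = v]))%:R / (card_of u)%:R.

(** [X] is a simple random walk on the vertices of [m] started at [v]. *)
Definition is_srw m v (d : measure_display) (Omega : measurableType d)
    (Pr : probability Omega R) (X : nat -> Omega -> set nat) : Prop :=
  (forall n u, measurable [set w | X n w = u]) /\
  (forall n (x : nat -> set nat),
    Pr [set w | forall i, (i <= n)%N -> X i w = x i] =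
    (`[< x 0%N = v >]%:R * \prod_(i < n) srw_step m (x i) (x i.+1))%:E).

Definition srw_recurrent m : Prop :=
  forall v, vertices m v ->
  forall (d : measure_display) (Omega : measurableType d)
    (Pr : probability Omega R) (X : nat -> Omega -> set nat),
  is_srw m v Pr X ->
  {ae Pr, forall w, forall N, exists2 n, (N <= n)%N & X n w = v}.

End random_walk.

(* Main.v *)
(** Only [nu_c >= 1] matters. Call a rooted map flat at scale [r] and precision
    [eps] if some function equal to [1] at the root vertex and to [0] outside the
    ball of radius [r] has Dirichlet energy at most [eps]; a Caccioppoli
    inequality for the probability of avoiding a vertex shows that a map flat at
    every precision is recurrent. Flatness is a clopen local event, so it is
    enough to bound its failure under [P_n] for infinitely many [n], and by
    invariance under rerooting this is a count of bad vertices in a finite planar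
    map. Planarity enters through sparse minors: a crossing inequality yields, at
    every scale [64 ^ k], vertex weights of small square sum for which few pairs
    of vertices are at distance less than one, and summing the corresponding
    cut-off functions over the scales with harmonic coefficients makes the energy
    of most vertices small, provided that degrees have an exponential tail.
    The tail holds at the sizes [n] where [Z_n] is a record: planar maps being
    exponentially few, [Z_(n + m) <= C ^ m Z_n] for all [m] along infinitely many
    [n], while splitting the root vertex injectively in [L] ways compares
    [Z_(n + m)] with [L ^ m] times the weight of root degrees above [m (L + 1)]. *)

Require Import Defs.
From HB Require Import structures.
From mathcomp Require Import all_boot all_order all_algebra zify ring lra.
From mathcomp Require Import boolp reals.

Set Implicit Arguments.
Unset Strict Implicit.
Unset Printing Implicit Defensive.
Import GRing.Theory.
Local Open Scope ring_scope.

(** * Planar rotation systems *)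

(** Planarity is given only as Euler's formula, so the planar arguments are linear algebra over F_2:
    equality in Euler's formula says that an edge set meeting all faces evenly is a cut, and this
    yields both the edge bound for minors and the encoding of maps by words. The obstacle that
    shapes the estimates is that degrees are unbounded. A weight controls sums over vertices,
    whereas an energy is a sum over darts, which costs a factor equal to the degree. Thanks to the
    exponential tail, darts of degree above a multiple of [k] can be set aside at scale [64 ^ k], so
    this scale with coefficient [a_k] costs about [k a_k ^ 2]. With [a_k] of order [1 / k], dividing
    by the square of the sum [S] of the [a_k] leaves an energy of order [1 / S], and [S] is
    unbounded because the harmonic series diverges. The condition [nu >= 1] matters because
    splitting a vertex destroys no monochromatic edge, so that it does not lower the weight. Bounds
    along infinitely many sizes suffice because the convergence of the laws is part of the
    hypothesis. *)

Section orbit_invariants.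
Variables (D : finType) (f : D -> D).

Lemma fconnect_invariant (T : Type) (X : D -> T) d e :
  (forall d, X (f d) = X d) -> fconnect f d e -> X e = X d.
Proof. by move=> fX /iter_findex <-; elim: (findex _ _ _) => //= k <-. Qed.

Lemma froot_invariant (T : Type) (X : D -> T) d :
  (forall d, X (f d) = X d) -> X (froot f d) = X d.
Proof. by move=> fX; apply: fconnect_invariant => //; exact: connect_root. Qed.

Hypothesis f_inj : injective f.

Lemma froot_step d : froot f (f d) = froot f d.
Proof.
by apply/eqP; rewrite (root_connect (fconnect_sym f_inj)) fconnect_sym// fconnect1.
Qed.

Lemma froot_eq d e : (froot f d == froot f e) = fconnect f d e.
Proof. by rewrite (root_connect (fconnect_sym f_inj)). Qed.

Lemma fcard_card : fcard f D = #|froots f|.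
Proof. by apply: eq_card => d; rewrite !inE andbT. Qed.

(** Each value of an invariant needs its own orbit. This is how vertices and faces are bounded from
    below after a surgery, the opposite bound being Euler's inequality. *)
Lemma codom_le_fcard (T : finType) (X : D -> T) :
  (forall d, X (f d) = X d) -> (#|codom X| <= fcard f D)%N.
Proof.
move=> fX; rewrite fcard_card.
apply: (@leq_trans #|[seq X d | d in froots f]|); last exact: leq_image_card.
apply/subset_leq_card/fintype.subsetP => _ /codomP[d ->].
apply/imageP; exists (froot f d); last by rewrite froot_invariant.
exact: roots_root (fconnect_sym f_inj) _.
Qed.

End orbit_invariants.

(* A finite connected map is given by its dart set [D], the rotation [phi]
   along faces and the dart reversal [al]; the rotation around vertices is then
   [phi \o al], so that duality exchanges [phi] and [phi \o al]. *)
Definition cmap (D : finType) (phi al : D -> D) : Prop :=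
  [/\ injective phi, involutive al, forall d, al d != d &
      forall X : D -> bool, (forall d, X (phi d) = X d) ->
        (forall d, X (al d) = X d) -> forall d e, X d = X e].

Definition planar (D : finType) (phi al : D -> D) : Prop :=
  cmap phi al /\ (fcard (phi \o al) D + fcard phi D = fcard al D + 2)%N.

Section duality.
Variables (D : finType) (phi al : D -> D).

Lemma cmap_dual : cmap phi al -> cmap (phi \o al) al.
Proof.
move=> [ip ia na co]; split => //.
- by apply: inj_comp => //; exact: inv_inj.
- move=> X hs ha; apply: co => // d.
  by rewrite -[in LHS](ia d) (hs (al d)) ha.
Qed.

Lemma fcard_dual : involutive al -> fcard ((phi \o al) \o al) D = fcard phi D.
Proof. by move=> ia; apply: eq_n_comp; apply: eq_fconnect => d /=; rewrite ia. Qed.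

Lemma planar_dual : planar phi al -> planar (phi \o al) al.
Proof.
move=> [c e]; split; first exact: cmap_dual.
by case: c => _ ia _ _; rewrite fcard_dual// addnC.
Qed.

End duality.

Section incidence.
Variables (D : finType) (al : D -> D).
Hypotheses (alK : involutive al) (al_neq : forall d, al d != d).

Lemma al_orbit d e : fconnect al d e = (e == d) || (e == al d).
Proof.
apply/idP/idP => [/iter_findex <-|/orP[] /eqP->]; last 2 first.
- exact: connect0.
- exact: fconnect1.
elim: (findex _ _ _) => [|k] /=; first by rewrite eqxx.
by move=> /orP[] /eqP ->; rewrite ?alK eqxx ?orbT.
Qed.

Lemma fcard_al : (fcard al D * 2 = #|D|)%N.
Proof.
rewrite (@fcard_order_set _ al (inv_inj alK) 2)//.
apply/fintype.subsetP => d _; rewrite inE /order.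
rewrite (eq_card (B := pred2 d (al d))); last first.
  by move=> e; rewrite !inE -al_orbit.
by rewrite card2 (eq_sym d) al_neq.
Qed.

Lemma sum_edges (V : zmodType) (g : D -> V) :
  \sum_d g d = \sum_(e in froots al) (g e + g (al e)).
Proof.
have ia := inv_inj alK.
rewrite (partition_big (fun d => froot al d) (fun e => e \in froots al)) /=; last first.
  by move=> d _; exact: roots_root (fconnect_sym ia) _.
apply: eq_bigr => e /eqP re.
rewrite (eq_bigl (pred2 e (al e))); last first.
  move=> d /=; rewrite -[in LHS]re eq_sym froot_eq//.
  by rewrite al_orbit.
rewrite (bigD1 e) /= ?eqxx//; congr (_ + _).
rewrite (big_pred1 (al e))// => d /=.
have := al_neq e; case: (d =P e) => [->|] /=; last by rewrite andbT.
by rewrite eq_sym => /negbTE ->.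
Qed.

(** Boundary matrix mod 2 between edges and orbits of [f]: vertices for [f = phi \o al], faces for
    [f = phi]. An edge with both sides in one orbit gets a zero column, because its two indicators
    cancel. *)
Definition incidence (f : D -> D) : 'M['F_2]_(#|froots f|, #|froots al|) :=
  \matrix_(i, j) ((froot f (enum_val j) == enum_val i)%:R +
                  (froot f (al (enum_val j)) == enum_val i)%:R).

Lemma incidenceE (f : D -> D) (x : 'rV['F_2]_(#|froots f|)) (X : D -> 'F_2)
    (j : 'I_(#|froots al|)) : injective f ->
  (forall i, x 0 i = X (enum_val i)) -> (forall d, X (f d) = X d) ->
  (x *m incidence f) 0 j = X (enum_val j) + X (al (enum_val j)).
Proof.
move=> fi xX fX; rewrite mxE.
have sub d : \sum_i x 0 i * (froot f d == enum_val i)%:R = X d.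
  have rd : froot f d \in froots f by exact: roots_root (fconnect_sym fi) _.
  rewrite (bigD1 (enum_rank_in rd (froot f d)))//= enum_rankK_in// eqxx mulr1.
  rewrite xX enum_rankK_in// froot_invariant// big1 ?addr0// => i ni.
  case: eqP => [e|]; last by rewrite mulr0.
  by case/negP: ni; apply/eqP/enum_val_inj; rewrite enum_rankK_in.
under eq_bigr => i _ do rewrite mxE mulrDr.
by rewrite big_split /= !sub.
Qed.

Lemma addF2_eq0 (x y : 'F_2) : (x + y == 0) = (x == y).
Proof. by move: x y; do 2![case=> [[|[|//]] ?]]. Qed.

Lemma addF2K (x : 'F_2) : x + x = 0.
Proof. by apply/eqP; rewrite addF2_eq0. Qed.

(** A row vector killed by the matrix is a function on orbits that agrees across every edge; by
    connectedness it is constant, so the kernel has dimension at most one. *)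
Lemma incidence_rank (f : D -> D) : injective f ->
  (forall X : D -> bool, (forall d, X (f d) = X d) ->
        (forall d, X (al d) = X d) -> forall d e, X d = X e) ->
  (#|froots f| <= (\rank (incidence f)).+1)%N.
Proof.
move=> fi co.
suff /mxrankS : (kermx (incidence f) <= (const_mx 1 : 'rV_#|froots f|))%MS.
  move=> /leq_trans/(_ (rank_leq_row _)).
  by rewrite mxrank_ker leq_subLR addn1.
apply/rV_subP => x /sub_kermxP x0.
pose X d : 'F_2 := if insub (froot f d) is Some u then
  x 0 (enum_rank_in (valP (u : {d | froots f d})) (val u)) else 0.
have xX i : x 0 i = X (enum_val i).
  have ri : froots f (enum_val i) := enum_valP i.
  rewrite /X; have -> : froot f (enum_val i) = enum_val i by apply/eqP.
  by rewrite insubT /= enum_valK_in.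
have fX d : X (f d) = X d by rewrite /X froot_step.
have aX d : X (al d) = X d.
  have ia := inv_inj alK.
  have rd : froot al d \in froots al by exact: roots_root (fconnect_sym ia) _.
  have := incidenceE (enum_rank_in rd (froot al d)) fi xX fX.
  rewrite x0 mxE enum_rankK_in// => /esym/eqP; rewrite addF2_eq0.
  have : fconnect al (froot al d) d by rewrite fconnect_sym ?connect_root.
  move: (froot al d) => e; rewrite al_orbit.
  by case/orP => /eqP ->; rewrite ?alK => /eqP.
have cX d e : X d = X e.
  apply/eqP; rewrite eq_sym -(co (fun e => X e == X d) _ _ d e)// => ?.
    by rewrite fX.
  by rewrite aX.
case: (pickP (mem (froots f))) => [d0 rd0|n0].
  apply/sub_rVP; exists (X d0); apply/rowP => i.
  by rewrite !mxE mulr1 xX; exact: cX.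
by apply/sub_rVP; exists 0; apply/rowP => i; have := enum_valP i; rewrite /= [_ \in _]n0.
Qed.

End incidence.

(** * Euler's formula as exactness mod 2 *)

Section exactness.
Variables (D : finType) (phi al : D -> D).

(** A face enters a vertex as often as it leaves it: reindexing by [phi \o al] turns the sum of
    [A d * B d] into that of [A d * B (al d)], and the two cancel mod 2. *)
Lemma incidence_complex : cmap phi al ->
  incidence al (phi \o al) *m (incidence al phi)^T = 0.
Proof.
move=> cm; have [ip ia na _] := cm; have [is_ _ _ _] := cmap_dual cm.
apply/matrixP => i j; rewrite !mxE.
pose A d := (froot (phi \o al) d == enum_val i)%:R : 'F_2.
pose B d := (froot phi d == enum_val j)%:R : 'F_2.
transitivity (\sum_d A d * (B d + B (al d))).
  rewrite (sum_edges ia na) [RHS]big_enum_val; apply: eq_bigr => k _.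
  by rewrite !mxE ia -/(A _) -/(A _) -/(B _) -/(B _) (addrC (B (al _))) mulrDl.
under eq_bigr do rewrite mulrDr.
rewrite big_split /=; apply/eqP; rewrite addF2_eq0; apply/eqP.
rewrite (reindex_inj is_) /=; apply: eq_bigr => d _.
by rewrite /A /B (froot_step is_) froot_step.
Qed.

(* Euler's bound: rank inequality for the complex faces -> edges -> vertices. *)
Lemma euler_le : cmap phi al ->
  (fcard (phi \o al) D + fcard phi D <= fcard al D + 2)%N.
Proof.
move=> cm; have [ip ia na cop] := cm; have [is_ _ _ cos] := cmap_dual cm.
have aux (a b x y z : nat) : (x <= a.+1 -> y <= b.+1 -> a <= z - b -> b <= z ->
  x + y <= z + 2)%N by lia.
rewrite !fcard_card; apply: aux (incidence_rank ia is_ cos)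
  (incidence_rank ia ip cop) _ (rank_leq_col _).
have /sub_kermxP/mxrankS := incidence_complex cm.
by rewrite mxrank_ker mxrank_tr.
Qed.

(** Cuts are even on faces by [incidence_complex]; the two rank bounds and equality in Euler's
    formula force the dimensions to agree, so an edge set meeting every face evenly is a cut. In
    this form genus zero enters the bound on minors and the encoding. *)
Lemma face_even_coboundary (c : D -> 'F_2) : planar phi al ->
  (forall d, c (al d) = c d) ->
  (forall d, \sum_(e | fconnect phi d e) c e = 0) ->
  exists2 X : D -> 'F_2, (forall d, X (phi (al d)) = X d) &
    forall d, c d = X d + X (al d).
Proof.
move=> [cm eu] ca cf; have [ip ia na cop] := cm; have [is_ _ _ cos] := cmap_dual cm.
pose r : 'rV['F_2]_(#|froots al|) := \row_j c (enum_val j).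
have /submxP[x rx] : (r <= incidence al (phi \o al))%MS.
  have /sub_kermxP PQ := incidence_complex cm.
  have rK : (r <= kermx (incidence al phi)^T)%MS.
    apply/sub_kermxP/matrixP => i j; rewrite !mxE.
    pose B d := (froot phi d == enum_val j)%:R : 'F_2.
    transitivity (\sum_d c d * B d).
      rewrite (sum_edges ia na) [RHS]big_enum_val; apply: eq_bigr => k _.
      by rewrite !mxE ca mulrDr.
    apply: etrans (cf (enum_val j)); rewrite [RHS]big_mkcond /=; apply: eq_bigr => d _.
    have /eqP rj : froots phi (enum_val j) := enum_valP j.
    rewrite /B -[in X in _ == X]rj eq_sym froot_eq//.
    by case: ifP; rewrite ?mulr1 ?mulr0.
  apply: (submx_trans rK); have [_ <-] := mxrank_leqif_sup PQ.
  rewrite eqn_leq mxrankS//= mxrank_ker mxrank_tr.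
  have aux (a b x y z : nat) : (x <= a.+1 -> y <= b.+1 -> x + y = z + 2 ->
    z - b <= a)%N by lia.
  move: eu; rewrite !fcard_card.
  exact: aux (incidence_rank ia is_ cos) (incidence_rank ia ip cop).
have frS d : froot (phi \o al) d \in froots (phi \o al).
  exact: roots_root (fconnect_sym is_) _.
pose X d : 'F_2 := x 0 (enum_rank_in (frS d) (froot (phi \o al) d)).
have xX i : x 0 i = X (enum_val i).
  rewrite /X; have /eqP ri : froots (phi \o al) (enum_val i) := enum_valP i.
  by congr (x 0 _); apply: enum_val_inj; rewrite enum_rankK_in// ri.
have XX d : X (phi (al d)) = X d.
  rewrite /X; congr (x 0 _); apply: enum_val_inj; rewrite !enum_rankK_in//.
  exact: froot_step is_ _.
exists X => // d.
have rd : froot al d \in froots al by exact: roots_root (fconnect_sym (inv_inj ia)) _.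
have := incidenceE (enum_rank_in rd (froot al d)) is_ xX XX.
rewrite -rx mxE enum_rankK_in//.
have : fconnect al (froot al d) d.
  by rewrite fconnect_sym ?connect_root//; exact: inv_inj.
move: (froot al d) => e; rewrite al_orbit//.
by case/orP => /eqP ->; rewrite ?ia ?ca// addrC.
Qed.

End exactness.

(** * Minors *)

(* A set of vertices is connected when every function that is constant along
   its inner edges is constant. *)
Definition connected_in (V : finType) (adj : rel V) (S : {set V}) : Prop :=
  forall X : V -> bool,
    (forall x y, x \in S -> y \in S -> adj x y -> X x = X y) ->
    {in S &, forall x y, X x = X y}.

Section minors.
Variables (D : finType) (phi al : D -> D).
Hypothesis pl : planar phi al.
Notation sg := (phi \o al).
Notation vtx := (froot sg).

(** Vertices are the canonical darts [vtx d] of the rotation orbits; the other darts are isolated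
    points of this graph. Keeping [D] as the vertex type avoids a quotient, at the price of counting
    [#|D|] points instead of vertices. *)
Definition dart_adj : rel D := [rel x y | [exists d, (vtx d == x) && (vtx (al d) == y)]].

Variables (I : finType) (U : I -> {set D}).
Hypothesis U_disj : forall i j x, x \in U i -> x \in U j -> i = j.
Hypothesis U_conn : forall i, connected_in dart_adj (U i).
Variables (q : nat) (r : 'I_q -> D) (s t : 'I_q -> I).
Hypothesis r_src : forall e, vtx (r e) \in U (s e).
Hypothesis r_tgt : forall e, vtx (al (r e)) \in U (t e).
Hypothesis st_neq : forall e, s e != t e.
Hypothesis st_simple : forall e f,
  [set s e; t e] = [set s f; t f] -> e = f.

Let ia : involutive al. Proof. by case: pl => [[]]. Qed.
Let ip : injective phi. Proof. by case: pl => [[]]. Qed.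
Let na d : al d != d. Proof. by case: pl => [[]]. Qed.
Let is_ : injective sg. Proof. by apply: inj_comp => //; exact: inv_inj. Qed.

(** The minor is not contracted: it is the submap of the darts that realise its edges ([inR]) or
    have both ends in one branch set ([inS]). All other edges are deleted, which merges faces. *)
Let inR d := [exists e, (d == r e) || (d == al (r e))].
Let inS d := [exists i, (vtx d \in U i) && (vtx (al d) \in U i)].
Let kept d := inR d || inS d.

Let inR_al d : inR (al d) = inR d.
Proof.
apply/existsP/existsP => -[e /orP[]/eqP h]; exists e.
- by rewrite -h ia eqxx orbT.
- by rewrite -(ia d) h ia eqxx.
- by rewrite h eqxx orbT.
- by rewrite h ia eqxx.
Qed.

Let inS_al d : inS (al d) = inS d.
Proof. by apply: eq_existsb => i; rewrite ia andbC. Qed.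

Let inRS d : inR d -> ~~ inS d.
Proof.
move=> /existsP[e he]; apply/negP => /existsP[i /andP[h1 h2]].
have [a1 a2] : s e = i /\ t e = i.
  case/orP: he => /eqP dE; move: h1 h2; rewrite dE ?ia => h1 h2.
    by split; [exact: U_disj (r_src e) h1|exact: U_disj (r_tgt e) h2].
  by split; [exact: U_disj (r_src e) h2|exact: U_disj (r_tgt e) h1].
by have := st_neq e; rewrite a1 a2 eqxx.
Qed.

Let r_uniq e f : r f = r e \/ r f = al (r e) -> f = e.
Proof.
case=> h; apply: st_simple.
  have := r_src f; have := r_tgt f; rewrite h => h2 h1.
  by rewrite (U_disj h1 (r_src e)) (U_disj h2 (r_tgt e)).
have := r_src f; have := r_tgt f; rewrite h ia => h2 h1.
by rewrite (U_disj h1 (r_tgt e)) (U_disj h2 (r_src e)) setUC.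
Qed.

(* Faces are merged across the deleted edges. *)
Let mrel : rel D :=
  fun d e => [|| e == phi d, d == phi e | (e == al d) && ~~ kept d].
Let cls d := fingraph.root mrel d.

Let kept_al d : kept (al d) = kept d.
Proof. by rewrite /kept inR_al inS_al. Qed.

Let mrel_sym : connect_sym mrel.
Proof.
apply: sym_connect_sym => d e; rewrite /mrel.
rewrite orbCA; congr [|| _, _ | _].
by apply/andP/andP => -[/eqP-> h]; rewrite ia eqxx kept_al.
Qed.

Let cls_phi d : cls (phi d) = cls d.
Proof.
by apply/eqP; rewrite (root_connect mrel_sym) mrel_sym; apply: connect1; rewrite /mrel eqxx.
Qed.

Let cls_al d : ~~ kept d -> cls (al d) = cls d.
Proof.
by move=> k; apply/eqP; rewrite (root_connect mrel_sym) mrel_sym;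
  apply: connect1; rewrite /mrel eqxx k !orbT.
Qed.

Let mrel_inv (Y : D -> 'F_2) : (forall d, Y (phi d) = Y d) ->
  (forall d, ~~ kept d -> Y (al d) = Y d) -> forall d, Y (cls d) = Y d.
Proof.
move=> h1 h2 d; rewrite /cls; have /connectP[p pp ->] := connect_root mrel d.
elim: p d pp => //= e p IH d /andP[/or3P[/eqP->|/eqP->|/andP[/eqP-> k]] /IH ->].
- exact: h1.
- by rewrite h1.
- exact: h2.
Qed.

(** [g k] is the boundary mod 2 of the merged face [k], restricted to the edges of the minor: an
    edge with both sides on [k] does not count. *)
Let g k e : 'F_2 := (cls (r e) == k)%:R + (cls (al (r e)) == k)%:R.
Let Ks : {set D} := [set k | [exists e, g k e != 0]].

Let sum_al (P : pred D) (z : D -> 'F_2) : (forall d, P (al d) = P d) ->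
  (forall d, z (al d) = z d) -> \sum_(d | P d) z d = 0.
Proof.
move=> aP az; rewrite big_mkcond (sum_edges ia na) big1// => d _.
by rewrite aP az addF2K.
Qed.

Let sum_inR (P : pred D) (z : D -> 'F_2) :
  \sum_(d | inR d && P d) z d =
  \sum_e (z (r e) * (P (r e))%:R + z (al (r e)) * (P (al (r e)))%:R).
Proof.
transitivity (\sum_d \sum_(e : 'I_q) (z d * (P d)%:R * ((d == r e)%:R + (d == al (r e))%:R))).
  rewrite big_mkcond; apply: eq_bigr => d _; rewrite -mulr_sumr.
  case: (boolP (inR d)) => [/existsP[e he]|nR] /=; last first.
    rewrite big1 ?mulr0// => e _; move: nR; rewrite negb_exists => /forallP/(_ e).
    by rewrite negb_or => /andP[/negbTE-> /negbTE->]; rewrite addr0.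
  rewrite (bigD1 e)//= [X in _ + X]big1 ?addr0; last first.
    move=> f fe; case: eqP => [h|_].
      case/negP: fe; apply/eqP/r_uniq; rewrite -h.
      by case/orP: he => /eqP; auto.
    case: eqP => [h|_]; last by rewrite addr0.
    case/negP: fe; apply/eqP/r_uniq; rewrite -(ia (r f)) -h.
    by case/orP: he => /eqP ->; rewrite ?ia; auto.
  case/orP: he => /eqP ->.
    rewrite eqxx (negbTE (_ : r e != al (r e))) 1?eq_sym// addr0 mulr1.
    by case: (P _); rewrite ?mulr1 ?mulr0.
  rewrite eqxx (negbTE (na _)) add0r mulr1.
  by case: (P _); rewrite ?mulr1 ?mulr0.
rewrite exchange_big /=; apply: eq_bigr => e _.
under eq_bigr do rewrite mulrDr.
rewrite big_split /= (bigD1 (r e))//= eqxx mulr1 big1 ?addr0; last first.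
  by move=> d /negbTE->; rewrite mulr0.
congr (_ + _); rewrite (bigD1 (al (r e)))//= eqxx mulr1 big1 ?addr0//.
by move=> d /negbTE->; rewrite mulr0.
Qed.

(** The boundary vector [z] of a face sums to zero around each vertex, hence over a branch set.
    Deleted edges have [z = 0] and edges inside the branch set are counted twice, so only the edges
    of the minor at [i] remain. *)
Let g_even k i : \sum_e g k e * ((s e == i)%:R + (t e == i)%:R) = 0.
Proof.
pose Y d : 'F_2 := (cls d == k)%:R.
pose z d := Y d + Y (al d).
have zal d : z (al d) = z d by rewrite /z ia addrC.
have zk d : ~~ kept d -> z d = 0 by move=> h; rewrite /z /Y cls_al// addF2K.
pose P d := vtx d \in U i.
have Psg d : P (sg d) = P d by rewrite /P froot_step.
have h0 : \sum_(d | P d) z d = 0.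
  rewrite /z big_split /= (reindex_inj is_) /=.
  rewrite -[RHS](addF2K (\sum_(d | P d) Y (al d))); congr (_ + _).
  by apply: eq_big => [d|d _]; [exact: Psg|rewrite /Y /= cls_phi].
rewrite -[RHS]h0 (bigID inR) /=.
have -> : \sum_(d | P d && ~~ inR d) z d = 0.
  rewrite (bigID inS) /= [X in _ + X]big1 ?addr0; last first.
    by move=> d /andP[/andP[_ h1] h2]; apply: zk; rewrite /kept negb_or h1.
  rewrite (eq_bigl (fun d => (P d && P (al d)) && (~~ inR d))) => [|d].
    by apply: sum_al => d //; rewrite ia inR_al; congr (_ && _); rewrite andbC.
  rewrite andbAC; congr (_ && _); apply/andP/andP => -[h1 h2]; split => //.
    by case/existsP: h2 => j /andP[h3 h4]; move: h1; rewrite /P => /U_disj/(_ h3) ->.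
  by apply/existsP; exists i; apply/andP.
rewrite addr0; under [RHS]eq_bigl do rewrite andbC.
rewrite sum_inR; apply: eq_bigr => e _; rewrite zal -mulrDr; congr (_ * (_ + _)).
  congr (nat_of_bool _)%:R; rewrite /P; apply/eqP/idP => [<-//|h].
  exact: U_disj (r_src e) h.
congr (nat_of_bool _)%:R; rewrite /P; apply/eqP/idP => [<-//|h].
exact: U_disj (r_tgt e) h.
Qed.

(** A nonzero even edge set continues past both ends of [e]; since there are no loops or multiple
    edges, the two continuing edges differ from [e] and from each other. *)
Let g_ge3 k : k \in Ks -> (3 <= #|[set e | g k e != 0%R]|)%N.
Proof.
rewrite inE => /existsP[e ge].
have other i : (s e == i) || (t e == i) ->
    [exists f, [&& f != e, g k f != 0 & (s f == i) || (t f == i)]].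
  move=> ei; apply: contraT; rewrite negb_exists => /forallP h.
  have := g_even k i; rewrite (bigD1 e)//= big1 ?addr0 => [|f fe].
    move=> /eqP; rewrite mulf_eq0 (negbTE ge) /=.
    case/orP: ei => /eqP <-; rewrite eqxx.
      by rewrite (eq_sym (t e)) (negbTE (st_neq e)) addr0 oner_eq0.
    by rewrite (negbTE (st_neq e)) add0r oner_eq0.
  have := h f; rewrite fe /=; case: eqP => [->|_] /=; first by rewrite mul0r.
  by rewrite negb_or => /andP[/negbTE-> /negbTE->]; rewrite addr0 mulr0.
have /other/existsP[f /and3P[fe gf fi]] : (s e == s e) || (t e == s e) by rewrite eqxx.
have /other/existsP[f' /and3P[fe' gf' fi']] : (s e == t e) || (t e == t e).
  by rewrite eqxx orbT.
have ff' : f != f'.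
  apply/eqP => E; case/negP: fe; apply/eqP; apply: st_simple; rewrite -E in fi'.
  have nst := st_neq e.
  case/orP: fi => /eqP h1; case/orP: fi' => /eqP h2.
  - by move: nst; rewrite -h1 -h2 eqxx.
  - by rewrite h1 h2.
  - by rewrite h1 h2 setUC.
  - by move: nst; rewrite -h1 -h2 eqxx.
rewrite (_ : 3 = #|e |: [set f; f']|)%N.
  by apply/subset_leq_card/subsetP => x; rewrite !inE => /or3P[]/eqP->.
by rewrite cardsU1 !inE negb_or ![e == _]eq_sym fe fe' cards2 ff'.
Qed.

Let Ks_le : (3 * #|Ks| <= 2 * q)%N.
Proof.
apply: (@leq_trans (\sum_(k in Ks) #|[set e | g k e != 0%R]|)).
  by rewrite mulnC -sum_nat_const leq_sum.
apply: (@leq_trans (\sum_(k in Ks) \sum_(e < q) (g k e != 0%R))).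
  by rewrite leq_sum// => k _; rewrite cardsE -sum1_card big_mkcond.
rewrite exchange_big /= mulnC -[q in X in (_ <= X * 2)%N]card_ord -sum_nat_const leq_sum// => e _.
rewrite big_mkcond /=.
apply: (@leq_trans (\sum_k ((k == cls (r e)) + (k == cls (al (r e)))))).
  apply: leq_sum => k _; case: ifP => // _; rewrite /g ![_ == k]eq_sym.
  by case: (k == cls (r e)); case: (k == cls _).
have one (a : D) : (\sum_k (k == a) = 1)%N.
  by rewrite (bigD1 a)//= eqxx big1// => k /negbTE ->.
by rewrite big_split /= !one.
Qed.

Let Gm : 'M['F_2]_(q, #|Ks|) := \matrix_(e, k) g (enum_val k) e.
Let Xm : 'M['F_2]_(#|I|, q) :=
  \matrix_(i, e) ((s e == enum_val i)%:R + (t e == enum_val i)%:R).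

Let N1 : 'M['F_2]_(#|D|, q) := \matrix_(i, e)
  ((vtx (r e) == enum_val i)%:R + (vtx (al (r e)) == enum_val i)%:R).
Let N2 : 'M['F_2]_(#|D|, #|D|) := \matrix_(i, j)
  ((inS (enum_val j))%:R * ((vtx (enum_val j) == enum_val i)%:R +
    (vtx (al (enum_val j)) == enum_val i)%:R)).

(** The pair [(z1, z2)] is a cycle mod 2 of the kept submap. By planarity of the dual it is the
    boundary of a union of merged faces, described by [Y], so a vector orthogonal to all [g k] is
    orthogonal to it. *)
Let cycle_orth (c : 'rV['F_2]_q) (z1 : 'cV['F_2]_q) (z2 : 'cV['F_2]_(#|D|)) :
  c *m Gm = 0 -> N1 *m z1 + N2 *m z2 = 0 -> c *m z1 = 0.
Proof.
move=> cG Nz.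
pose w d : 'F_2 := z2 (enum_rank d) 0.
pose Z d := \sum_e z1 e 0 * ((d == r e)%:R + (d == al (r e))%:R) +
  (inS d)%:R * (w d + w (al d)).
have Zal d : Z (al d) = Z d.
  rewrite /Z inS_al ia [w (al d) + _]addrC; congr (_ + _); apply: eq_bigr => e _.
  by rewrite (inj_eq (inv_inj ia)) (inv_eq ia) addrC.
have Zr e : Z (r e) = z1 e 0.
  have rR : inR (r e) by apply/existsP; exists e; rewrite eqxx.
  rewrite /Z (negbTE (inRS rR)) mul0r addr0 (bigD1 e)//= eqxx.
  rewrite (negbTE (_ : r e != al (r e))) 1?eq_sym// addr0 mulr1 big1 ?addr0// => f fe.
  case: eqP => [h|_]; first by case/negP: fe; apply/eqP/r_uniq; left.
  case: eqP => [h|_]; last by rewrite addr0 mulr0.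
  by case/negP: fe; apply/eqP/r_uniq; right; rewrite h ia.
have Z0 d : ~~ kept d -> Z d = 0.
  rewrite /kept negb_or => /andP[nR nS]; rewrite /Z (negbTE nS) mul0r addr0 big1// => e _.
  move: nR; rewrite negb_exists => /forallP/(_ e); rewrite negb_or => /andP[/negbTE-> /negbTE->].
  by rewrite addr0 mulr0.
have Zv d0 : \sum_(e | fconnect sg d0 e) Z e = 0.
  have := congr1 (fun M : 'cV_ _ => M (enum_rank (vtx d0)) 0) Nz.
  rewrite !mxE => Nz0; apply: etrans Nz0.
  rewrite (eq_bigl (fun e => vtx e == vtx d0)) => [|e]; last first.
    by rewrite eq_sym froot_eq.
  rewrite /Z big_split /=; congr (_ + _).
    rewrite exchange_big /=; apply: eq_bigr => e _; rewrite mxE enum_rankK mulrC -mulr_sumr.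
    congr (_ * _); rewrite big_split /= !(big_mkcond (fun e => vtx e == _)) /=.
    congr (_ + _).
      rewrite (bigD1 (r e))//= eqxx big1 ?addr0; last by move=> x /negbTE->; case: ifP.
      by case: ifP.
    rewrite (bigD1 (al (r e)))//= eqxx big1 ?addr0; last by move=> x /negbTE->; case: ifP.
    by case: ifP.
  under eq_bigr do rewrite mulrDr.
  rewrite big_split /= !(big_mkcond (fun e => vtx e == _)) /=.
  rewrite [X in _ + X](reindex_inj (inv_inj ia)) /= -big_split /=.
  rewrite [RHS](reindex enum_rank) /=; last first.
    by exists enum_val => x _; rewrite ?enum_valK ?enum_rankK.
  apply: eq_bigr => j _; rewrite mxE !enum_rankK inS_al ia -/(w j).
  by do 2!case: eqP => _; rewrite ?(addr0, mulr0, mul0r, add0r, mulr1)//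
    mulrDr mulr1 mulrDl.
have [|Y Yp YZ] := face_even_coboundary (planar_dual pl) Zal; first by move=> d0; exact: Zv.
have {}Yp d : Y (phi d) = Y d by have := Yp d; rewrite /= ia.
have Ycls := mrel_inv Yp _.
have {}Ycls d : Y (cls d) = Y d.
  by apply: Ycls => e /Z0; rewrite YZ => /eqP; rewrite addF2_eq0 eq_sym => /eqP.
apply/matrixP => i j; rewrite !ord1 !mxE.
transitivity (\sum_e c 0 e * \sum_k Y k * g k e).
  apply: eq_bigr => e _; congr (_ * _); rewrite -Zr YZ -Ycls -[in X in _ + X]Ycls.
  under [RHS]eq_bigr do rewrite mulrDr.
  rewrite big_split /=; congr (_ + _).
    rewrite (bigD1 (cls (r e)))//= eqxx mulr1 big1 ?addr0// => k; rewrite eq_sym.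
    by move=> /negbTE->; rewrite mulr0.
  rewrite (bigD1 (cls (al (r e))))//= eqxx mulr1 big1 ?addr0// => k; rewrite eq_sym.
  by move=> /negbTE->; rewrite mulr0.
under eq_bigr do rewrite mulr_sumr.
rewrite exchange_big /= big1// => k _.
under eq_bigr do rewrite mulrCA.
rewrite -mulr_sumr; case: (boolP (k \in Ks)) => [kK|nK].
  have := congr1 (fun M : 'rV_ _ => M 0 (enum_rank_in kK k)) cG; rewrite !mxE => cG0.
  apply/eqP; rewrite mulf_eq0; apply/orP; right; apply/eqP; apply: etrans cG0.
  by apply: eq_bigr => e _; rewrite mxE enum_rankK_in.
rewrite big1 ?mulr0// => e _.
by move: nK; rewrite inE negb_exists => /forallP/(_ e); rewrite negbK => /eqP ->; rewrite mulr0.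
Qed.

(** Orthogonality to cycles makes [c], extended by zero inside branch sets, the coboundary of a
    potential [X] on vertices. The zero part and connectedness make [X] constant on each branch set,
    so it descends to a potential on [I]. *)
Let ker_sub : (kermx Gm <= Xm)%MS.
Proof.
apply/rV_subP => c /sub_kermxP cG.
have /submxP[x xE] : (row_mx c 0 <= row_mx N1 N2)%MS.
  rewrite submxE; apply/eqP/matrixP => i j.
  have := mulmx_coker (row_mx N1 N2).
  rewrite -[cokermx _]vsubmxK mul_row_col => /(congr1 (col j)).
  rewrite col0 linearD /= !colE -!mulmxA => h.
  have := cycle_orth cG h => h2.
  rewrite mul_row_col mul0mx addr0.
  have := congr1 (fun M : 'M_1 => M i 0) h2.
  by rewrite mulmxA -colE !mxE.
pose X v : 'F_2 := x 0 (enum_rank v).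
have XN1 e : c 0 e = X (vtx (r e)) + X (vtx (al (r e))).
  have := congr1 (fun M => lsubmx M 0 e) xE; rewrite row_mxKl mul_mx_row row_mxKl => ->.
  rewrite mxE (reindex enum_rank) /=; last first.
    by exists enum_val => v _; rewrite ?enum_valK ?enum_rankK.
  under eq_bigr do rewrite mxE enum_rankK mulrDr.
  rewrite big_split /= (bigD1 (vtx (r e)))//= eqxx mulr1 big1 ?addr0; last first.
    by move=> v; rewrite eq_sym => /negbTE->; rewrite mulr0.
  rewrite (bigD1 (vtx (al (r e))))//= eqxx mulr1 big1 ?addr0//.
  by move=> v; rewrite eq_sym => /negbTE->; rewrite mulr0.
have XN2 d : inS d -> X (vtx d) = X (vtx (al d)).
  move=> Sd; apply/eqP; rewrite -addF2_eq0; apply/eqP.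
  have := congr1 (fun M => rsubmx M 0 (enum_rank d)) xE.
  rewrite row_mxKr mul_mx_row row_mxKr mxE => xE0; apply: etrans (esym xE0).
  rewrite mxE (reindex enum_rank) /=; last first.
    by exists enum_val => v _; rewrite ?enum_valK ?enum_rankK.
  under [RHS]eq_bigr do rewrite mxE !enum_rankK Sd mul1r mulrDr.
  rewrite big_split /= (bigD1 (vtx d))//= eqxx mulr1 big1 ?addr0; last first.
    by move=> v; rewrite eq_sym => /negbTE->; rewrite mulr0.
  rewrite (bigD1 (vtx (al d)))//= eqxx mulr1 big1 ?addr0//.
  by move=> v; rewrite eq_sym => /negbTE->; rewrite mulr0.
have XU i : {in U i &, forall v v', X v = X v'}.
  move=> v v' vU vU'.
  apply/eqP; rewrite eq_sym.
  rewrite (@U_conn i (fun y => X y == X v) _ v' v vU' vU)//= => y y' yU yU'.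
  move=> /existsP[d /andP[/eqP dy /eqP dy']]; congr (_ == _); rewrite -dy -dy'.
  by apply: XN2; apply/existsP; exists i; rewrite dy dy' yU.
pose xi i : 'F_2 := if [pick v in U i] is Some v then X v else 0.
have xiE i v : v \in U i -> X v = xi i.
  by move=> vU; rewrite /xi; case: pickP => [v' v'U|/(_ v)]; [exact: XU v'U|rewrite vU].
apply/submxP; exists (\row_i xi (enum_val i)); apply/rowP => e.
rewrite XN1 (xiE (s e))// (xiE (t e))// mxE (reindex enum_rank) /=; last first.
  by exists enum_val => v _; rewrite ?enum_valK ?enum_rankK.
under eq_bigr do rewrite !mxE !enum_rankK mulrDr.
rewrite big_split /= (bigD1 (s e))//= eqxx mulr1 big1 ?addr0; last first.
  by move=> v; rewrite eq_sym => /negbTE->; rewrite mulr0.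
rewrite (bigD1 (t e))//= eqxx mulr1 big1 ?addr0//.
by move=> v; rewrite eq_sym => /negbTE->; rewrite mulr0.
Qed.

(** [ker_sub] gives [q - #|Ks| <= #|I|], and each face of [Ks] uses at least three of the [2 * q]
    sides of edges. *)
Lemma planar_minor_edges : (q <= 3 * #|I|)%N.
Proof.
have aux (a b c d : nat) : (q - a <= b -> b <= c -> a <= d -> 3 * d <= 2 * q ->
  q <= 3 * c)%N by lia.
apply: aux (rank_leq_row Xm) (rank_leq_col Gm) Ks_le.
by rewrite -mxrank_ker mxrankS// ker_sub.
Qed.

End minors.

(** * Counting planar maps *)

Section acyclic_sets.
Variables (D : finType) (al : D -> D).

Definition even_on (f : D -> D) (c : D -> 'F_2) : Prop :=
  forall d, \sum_(e | fconnect f d e) c e = 0.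

(** Forests: no nonzero cycle mod 2 is supported in [T]. For [f = phi] the condition concerns the
    dual map. *)
Definition acyclic (f : D -> D) (T : {set D}) : Prop :=
  forall c : D -> 'F_2, (forall d, c (al d) = c d) ->
    (forall d, d \notin T -> c d = 0) -> even_on f c -> forall d, c d = 0.

Lemma even_on_orth (f : D -> D) (c X : D -> 'F_2) : injective f -> even_on f c ->
  (forall d, X (f d) = X d) -> \sum_d c d * X d = 0.
Proof.
move=> fi ev fX.
rewrite (partition_big (fun d => froot f d) (mem (froots f))) /=; last first.
  by move=> d _; exact: roots_root (fconnect_sym fi) _.
rewrite big1// => e /eqP re; rewrite (eq_bigr (fun d => c d * X e)).
  rewrite -mulr_suml (eq_bigl (fconnect f e)) ?ev ?mul0r// => d.
  by rewrite -[in LHS]re eq_sym froot_eq.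
by move=> d /eqP <-; rewrite froot_invariant.
Qed.

End acyclic_sets.

(** [T] is a maximal acyclic set. A dual cycle [c] in its complement is a cut, and a cycle meets a
    cut evenly, so a cycle inside [T] plus one edge [d0] of [c] avoids [d0]; hence [d0] could have
    been added to [T]. *)
Lemma spanning_tree (D : finType) (phi al : D -> D) : planar phi al ->
  exists T : {set D}, [/\ forall d, (al d \in T) = (d \in T),
    acyclic al (phi \o al) T & acyclic al phi (~: T)].
Proof.
move=> pl; have [[ip ia na _] _] := pl.
have is_ : injective (phi \o al) by apply: inj_comp => //; exact: inv_inj.
pose P (T : {set D}) := `[< (forall d, (al d \in T) = (d \in T)) /\
  acyclic al (phi \o al) T >].
have P0 : P set0.
  by apply/asboolP; split => [d|c _ c0 _ d]; rewrite ?inE// c0 ?inE.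
have [T /maxsetP[/asboolP[Tal Tac] Tmax] _] := maxset_exists P0.
exists T; split => // c cal c0 ev.
have {}c0 d : d \in T -> c d = 0 by move=> dT; apply: c0; rewrite inE dT.
have [X Xs cX] := face_even_coboundary pl cal ev.
move=> d0; apply/eqP; apply: contraT => cd0.
have d0T : d0 \notin T by apply: contra cd0 => /c0 ->.
suff PT : P (d0 |: (al d0 |: T)).
  have := Tmax _ PT; rewrite setUA => /(_ (subsetUr _ _))/setP/(_ d0).
  by rewrite !inE eqxx (negbTE d0T).
apply/asboolP; split.
  by move=> d; rewrite !inE (inj_eq (inv_inj ia)) (inv_eq ia) Tal orbCA.
move=> z zal z0 zev; apply: Tac => // d dT.
suff zd0 : z d0 = 0.
  have [->//|n1] := eqVneq d d0.
  have [->|n2] := eqVneq d (al d0); first by rewrite zal.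
  by apply: z0; rewrite !inE (negbTE n1) (negbTE n2).
have := even_on_orth is_ zev Xs; rewrite (sum_edges ia na).
have e0R : froot al d0 \in froots al by exact: roots_root (fconnect_sym (inv_inj ia)) _.
have e0E : (froot al d0 == d0) || (froot al d0 == al d0).
  by rewrite -(al_orbit ia); exact: connect_root.
rewrite (bigD1 (froot al d0))//= big1 ?addr0 => [|e /andP[eR ne]].
  rewrite zal -mulrDr -cX; have -> : z (froot al d0) = z d0.
    by case/orP: e0E => /eqP->; rewrite ?zal.
  have -> : c (froot al d0) = c d0 by case/orP: e0E => /eqP->; rewrite ?cal.
  by move=> /eqP; rewrite mulf_eq0 (negbTE cd0) orbF => /eqP.
rewrite zal -mulrDr -cX.
have [eT|eT] := boolP (e \in T); first by rewrite c0// mulr0.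
rewrite z0 ?mul0r//; rewrite !inE (negbTE eT) orbF negb_or.
have re : froot al e = e by apply/eqP.
apply/andP; split; apply: contra ne => /eqP E; apply/eqP; rewrite -re E//.
by rewrite froot_step//; exact: inv_inj.
Qed.

(** * Contour walks of forests *)

Section contour.
Variables (D : finType) (al : D -> D) (f psi : D -> D) (T : {set D}) (r : D).
Hypotheses (ia : involutive al) (na : forall d, al d != d) (fi : injective f).
Hypothesis pi_ : injective psi.
Hypothesis Tal : forall d, (al d \in T) = (d \in T).
Hypothesis Tac : acyclic al f T.
Hypothesis psiT : forall d, d \in T -> fconnect f (al d) (psi d).
Hypothesis psiN : forall d, d \notin T -> fconnect f d (psi d).

Let x t := iter t psi r.
(** Parity of the crossings of each edge of [T] between times [s] and [n]. The section is abstract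
    in [f] and [psi] because it serves twice: for [T] around vertices, and for its complement around
    faces. *)
Let c s n d : 'F_2 :=
  \sum_(s <= u < n | x u \in T) ((d == x u)%:R + (d == al (x u))%:R).

Let c_al s n d : c s n (al d) = c s n d.
Proof.
by apply: eq_bigr => u _; rewrite (inj_eq (inv_inj ia)) (inv_eq ia) addrC.
Qed.

Let c_supp s n d : d \notin T -> c s n d = 0.
Proof.
move=> dT; apply: big1 => u uT; case: eqP => [E|_]; first by rewrite E uT in dT.
by case: eqP => [E|_]; [rewrite E Tal uT in dT|rewrite addr0].
Qed.

Let c_boundary s n d : (s <= n)%N -> \sum_(e | fconnect f d e) c s n e =
  (fconnect f d (x s))%:R + (fconnect f d (x n))%:R.
Proof.
have ind (a : D) : \sum_(e | fconnect f d e) (e == a)%:R = (fconnect f d a)%:R :> 'F_2.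
  have [h|h] := boolP (fconnect f d a).
    by rewrite (bigD1 a)//= eqxx big1 ?addr0// => e /andP[_ /negbTE->].
  by rewrite big1// => e he; case: eqP => // E; rewrite E (negbTE h) in he.
move=> /subnKC <-; elim: (n - s)%N => [|k IH].
  by rewrite addn0 addF2K big1// => e _; rewrite /c big_geq.
rewrite addnS; set m := (s + k)%N in IH *.
have sm : (s <= m)%N by rewrite leq_addr.
rewrite (eq_bigr (fun e => c s m e + (if x m \in T then (e == x m)%:R +
  (e == al (x m))%:R else 0))) => [|e _]; last first.
  by rewrite /c [LHS]big_mkcond [in RHS]big_mkcond big_nat_recr.
rewrite big_split /= IH -addrA; congr (_ + _).
case: (boolP (x m \in T)) => mT.
  rewrite big_split /= !ind addrA addF2K add0r; congr (nat_of_bool _)%:R.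
  rewrite !(fconnect_sym fi d).
  exact: (same_connect (fconnect_sym fi) (psiT mT)).
rewrite big1 ?addr0//; congr (nat_of_bool _)%:R.
rewrite !(fconnect_sym fi d); apply: (same_connect (fconnect_sym fi)).
exact: psiN.
Qed.

(** In a forest a closed walk crosses every edge an even number of times. *)
Let closed_walk s n d : (s <= n)%N -> fconnect f (x s) (x n) -> c s n d = 0.
Proof.
move=> sn sc; apply: Tac => //; [exact: c_supp|] => e.
rewrite c_boundary// !(fconnect_sym fi e) (same_connect (fconnect_sym fi) sc).
exact: addF2K.
Qed.

Let N := order psi r.
Let x_inj s t : (s < N)%N -> (t < N)%N -> x s = x t -> s = t.
Proof.
move=> sN tN E; have := @findex_iter _ psi r s sN; have := @findex_iter _ psi r t tN.
by rewrite -/(x s) -/(x t) E => -> ->.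
Qed.

(** Before time [N] each dart is visited at most once, so an edge crossed evenly is crossed once in
    each direction. *)
Let partner s n u : (n <= N)%N -> (s <= n)%N -> fconnect f (x s) (x n) ->
  (s <= u < n)%N -> x u \in T -> exists2 v, (s <= v < n)%N & x v = al (x u).
Proof.
move=> nN sn sc un uT.
have [/hasP[v + /eqP vE]|nv] := boolP (has (fun v => x v == al (x u)) (index_iota s n)).
  by rewrite mem_index_iota => vn; exists v.
have := closed_walk (x u) sn sc.
rewrite /c big_mkcond (bigD1_seq u) /= ?mem_index_iota ?iota_uniq// uT eqxx.
rewrite eq_sym (negbTE (na _)) addr0 big_seq_cond big1 ?addr0.
  by move=> /eqP; rewrite oner_eq0.
move=> v; rewrite mem_index_iota => /andP[vn vu]; case: ifP => // _.
case: eqP => [E|_].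
  case/eqP: vu; apply: x_inj => //.
    by apply: leq_trans nN; case/andP: vn.
  by apply: leq_trans nN; case/andP: un.
case: eqP => [E|_]; last by rewrite addr0.
case/negP: nv; apply/hasP; exists v; first by rewrite mem_index_iota.
by rewrite E ia.
Qed.

Lemma contour_al_closed u : (u < N)%N -> x u \in T -> exists2 v, (v < N)%N & x v = al (x u).
Proof.
move=> uN uT; have xN : x N = x 0%N by rewrite /x iter_order.
by apply: (@partner 0%N N u) => //; rewrite xN connect0.
Qed.

(** Between crossing an edge and crossing it back the walk makes a closed excursion from the far
    end, so every edge crossed meanwhile is also crossed back meanwhile. *)
Lemma contour_noncrossing s t u : (s < t < N)%N -> x t = al (x s) -> x s \in T ->
  (s < u < t)%N -> x u \in T -> exists2 v, (s < v < t)%N & x v = al (x u).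
Proof.
move=> /andP[st tN] ts sT su uT; apply: (@partner s.+1 t u) => //; first exact: ltnW.
by rewrite fconnect_sym// ts; exact: psiT.
Qed.

End contour.

(** A word in two kinds of brackets has at most one matching that is nested within each kind. At the
    first closing position [t] where two matchings differ, say with [q t < q' t], the bracket at
    [q' t] is opening and [q] closes it before [t], where both matchings already agree. *)
Lemma noncrossing_unique (N : nat) (tau : nat -> bool) (p p' : nat -> nat) :
  let ok p := forall t, (t < N)%N -> [/\ (p t < N)%N, p (p t) = t, p t <> t,
    tau (p t) = tau t & forall u, (t < u < p t)%N -> tau u = tau t -> (t < p u < p t)%N] in
  ok p -> ok p' -> (forall t, (t < N)%N -> (p t < t)%N = (p' t < t)%N) ->
  forall t, (t < N)%N -> p t = p' t.
Proof.
move=> ok; suff wl q q' t : ok q -> ok q' ->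
    (forall t, (t < N)%N -> (q t < t)%N = (q' t < t)%N) ->
    (forall v, (v < t)%N -> (q v < v)%N -> q v = q' v) ->
    (t < N)%N -> (q t < t)%N -> (q t < q' t)%N -> False.
  move=> okp okp' fl.
  have cl t : (t < N)%N -> (p t < t)%N -> p t = p' t.
    elim/ltn_ind: t => t IH tN pt.
    have pt' : (p' t < t)%N by rewrite -fl.
    case: (ltngtP (p t) (p' t)) => // h; exfalso.
      by apply: (wl p p' t) => // v vt; apply: IH => //; exact: ltn_trans tN.
    apply: (wl p' p t) => // [v vN|v vt pv]; first by rewrite fl.
    by apply/esym/IH; rewrite ?fl//; exact: ltn_trans tN.
  move=> t tN; case: (ltngtP (p t) t) => h; first exact: cl.
    have [h1 h2 _ _ _] := okp t tN.
    have := cl (p t) h1; rewrite h2 => /(_ h) E.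
    by have [_ + _ _ _] := okp' _ h1; rewrite -E => ->.
  by have [_ _ + _ _] := okp t tN.
move=> okq okq' fl IH tN qt qq'.
have qt' : (q' t < t)%N by rewrite -fl.
have [a1 a2 a3 a4 a5] := okq t tN; have [b1 b2 b3 b4 b5] := okq' t tN.
have [c1 c2 c3 c4 c5] := okq (q t) a1.
have nf : (q (q' t) < q' t)%N = false.
  by rewrite fl// b2; apply/negbTE; rewrite -leqNgt ltnW.
have := c5 (q' t); rewrite a2 qq' qt' b4 a4 => /(_ isT erefl) /andP[d1 d2].
have [e1 e2 e3 e4 e5] := okq (q' t) b1.
have d3 : (q' t < q (q' t))%N.
  by move/negbT: nf; rewrite -leqNgt leq_eqVlt => /orP[/eqP/esym/e3//|].
have := IH _ d2; rewrite e2 => /(_ d3) E.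
have [_ g2 _ _ _] := okq' _ e1; move: d2.
by rewrite -g2 -E b2 ltnn.
Qed.

Section codes.
Variables (D : finType) (phi al : D -> D) (r : D) (sp : D -> bool).

(** Cross the edge if it is in [T], otherwise skip it: as [al] is an involution, this is [phi d] on
    [T] and [phi (al d)] off [T]. *)
Definition contour_step (T : {set D}) d := phi (al (if d \in T then al d else d)).

(** Mullin's encoding by two shuffled bracket words: the first bit separates tree from dual tree,
    the second marks closing brackets, whose reverse dart was visited before. *)
Definition letter (T : {set D}) t : bool * bool * bool :=
  let x u := iter u (contour_step T) r in
  (x t \in T, has (fun u => x u == al (x t)) (iota 0 t), sp (x t)).

Definition codes (w : seq (bool * bool * bool)) : Prop :=
  exists T : {set D}, [/\ forall d, (al d \in T) = (d \in T),
    acyclic al (phi \o al) T, acyclic al phi (~: T) & w = mkseq (letter T) #|D|].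

Hypothesis pl : planar phi al.

Lemma codes_exist : exists w, codes w.
Proof.
have [T [h1 h2 h3]] := spanning_tree pl.
by exists (mkseq (letter T) #|D|), T.
Qed.

Let ia : involutive al. Proof. by case: pl => [[]]. Qed.
Let ip : injective phi. Proof. by case: pl => [[]]. Qed.
Let na d : al d != d. Proof. by case: pl => [[]]. Qed.
Let is_ : injective (phi \o al). Proof. by apply: inj_comp => //; exact: inv_inj. Qed.

Variable T : {set D}.
Hypothesis Tal : forall d, (al d \in T) = (d \in T).
Hypothesis Tac : acyclic al (phi \o al) T.
Hypothesis Tcc : acyclic al phi (~: T).

Let psi := contour_step T.

Lemma contour_step_inj : injective psi.
Proof.
move=> d e /ip/(inv_inj ia); case: ifP => h1; case: ifP => h2.
- exact: inv_inj.
- by move=> E; move: h2; rewrite -E Tal h1.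
- by move=> E; move: h1; rewrite E Tal h2.
- by [].
Qed.

Let psiT d : d \in T -> fconnect (phi \o al) (al d) (psi d).
Proof. by rewrite /psi /contour_step => ->; exact: (fconnect1 (phi \o al)). Qed.
Let psiN d : d \notin T -> fconnect (phi \o al) d (psi d).
Proof. by rewrite /psi /contour_step => /negbTE->; exact: (fconnect1 (phi \o al)). Qed.
Let psiT' d : d \in ~: T -> fconnect phi (al d) (psi d).
Proof. by rewrite inE /psi /contour_step => /negbTE->; exact: fconnect1. Qed.
Let psiN' d : d \notin ~: T -> fconnect phi d (psi d).
Proof. by rewrite inE negbK /psi /contour_step => ->; rewrite ia; exact: fconnect1. Qed.
Let TalC d : (al d \in ~: T) = (d \in ~: T). Proof. by rewrite !inE Tal. Qed.

(** The orbit of [r] is closed under [al], by the forest [T] for its darts and by the dual forest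
    for the others; being closed under the contour step, it is then closed under [phi], and
    connectedness concludes. *)
Lemma contour_full d : fconnect psi r d.
Proof.
have [_ _ _ co] := (pl.1).
pose X d := fconnect psi r d.
have Xpsi d' : X (psi d') = X d'.
  by rewrite /X !(fconnect_sym contour_step_inj r) -(same_fconnect1 contour_step_inj).
have Xal d' : X d' -> X (al d').
  move=> /iter_findex; set u := findex _ _ _ => xu.
  have [uN|] := ltnP u (order psi r); last first.
    move=> h; exfalso; move: (h); rewrite leqNgt; apply/negP; rewrite negbK.
    have : X d' by rewrite -xu /X fconnect_iter.
    by move=> /findex_max.
  have [dT|dT] := boolP (d' \in T).
    have [|v _ vE] := contour_al_closed ia na is_ contour_step_inj Tal Tac psiT psiN uN.
      by rewrite xu.
    by rewrite -xu -vE; exact: fconnect_iter.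
  have [|v _ vE] := contour_al_closed ia na ip contour_step_inj TalC Tcc psiT' psiN' uN.
    by rewrite xu inE.
  by rewrite -xu -vE; exact: fconnect_iter.
have Xal' d' : X (al d') = X d'.
  by apply/idP/idP => [/Xal|/Xal//]; rewrite ia.
have Xphi d' : X (phi d') = X d'.
  have [dT|dT] := boolP (d' \in T).
    by rewrite -[RHS]Xpsi /psi /contour_step dT ia.
  rewrite -[RHS]Xal' -[RHS]Xpsi /psi /contour_step Tal (negbTE dT) ia//.
have := co X Xphi Xal' r d; rewrite /X connect0 => <-//.
Qed.

Lemma contour_order : order psi r = #|D|.
Proof. by apply: eq_card => d; rewrite !inE contour_full. Qed.

Lemma contour_matching : let x u := iter u psi r in
  exists p : nat -> nat, forall t, (t < #|D|)%N -> [/\ (p t < #|D|)%N, p (p t) = t, p t <> t,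
    (x (p t) \in T) = (x t \in T) &
    x (p t) = al (x t) /\
    forall u, (t < u < p t)%N -> (x u \in T) = (x t \in T) -> (t < p u < p t)%N].
Proof.
move=> x; exists (fun t => findex psi r (al (x t))).
have pN t : (findex psi r (al (x t)) < #|D|)%N.
  by rewrite -contour_order; apply: findex_max; exact: contour_full.
have xp t : x (findex psi r (al (x t))) = al (x t).
  by rewrite /x iter_findex ?contour_full.
have fx t : (t < #|D|)%N -> findex psi r (x t) = t.
  by rewrite -contour_order => tN; exact: findex_iter.
move=> t tN; split => //.
- by rewrite xp ia fx.
- by move=> E; have := xp t; rewrite E => /eqP; rewrite eq_sym (negbTE (na _)).
- by rewrite xp Tal.
split; first exact: xp.
move=> u up uT; set q := findex _ _ _ in up *.
have qN : (q < order psi r)%N by rewrite contour_order; exact: pN.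
have tq : (t < q < order psi r)%N by rewrite qN andbT; case/andP: up; exact: ltn_trans.
have find v : (t < v < q)%N -> x v = al (x u) -> (t < findex psi r (al (x u)) < q)%N.
  move=> vq <-; rewrite fx//; case/andP: vq => _ /ltn_trans; apply; exact: pN.
have [dT|dT] := boolP (x t \in T).
  have [|v vq vE] := contour_noncrossing ia na is_ Tal Tac psiT psiN
    tq (xp t) dT up; [by rewrite uT|exact: find vq vE].
have dT' : x t \in ~: T by rewrite inE.
have [|v vq vE] := contour_noncrossing ia na ip TalC Tcc psiT' psiN'
    tq (xp t) dT' up; [by rewrite inE uT|exact: find vq vE].
Qed.

End codes.

(** By [noncrossing_unique] the word determines the matching of times, hence [al]; the contour step
    is the cyclic successor of times, and [phi] is recovered from both. *)
Lemma codes_iso (D D' : finType) (phi al : D -> D) (phi' al' : D' -> D') r r' sp sp' w :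
  planar phi al -> planar phi' al' -> codes phi al r sp w -> codes phi' al' r' sp' w ->
  exists f : D -> D', [/\ bijective f, f r = r',
    forall d, f (phi d) = phi' (f d), forall d, f (al d) = al' (f d) &
    forall d, sp' (f d) = sp d].
Proof.
move=> pl pl' [T [T1 T2 T3 ->]] [T' [T1' T2' T3' wE]].
have [[ip ia na _] _] := pl; have [[ip' ia' na' _] _] := pl'.
have DD : #|D| = #|D'| by have := congr1 size wE; rewrite !size_mkseq.
pose psi := contour_step phi al T; pose psi' := contour_step phi' al' T'.
pose x u := iter u psi r; pose x' u := iter u psi' r'.
have psi_inj : injective psi by exact: contour_step_inj.
have psi_inj' : injective psi' by exact: contour_step_inj.
have full d : fconnect psi r d by exact: contour_full.
have full' d : fconnect psi' r' d by exact: contour_full.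
have ord : order psi r = #|D| by exact: contour_order.
have ord' : order psi' r' = #|D'| by exact: contour_order.
have wt t : (t < #|D|)%N -> letter phi al r sp T t = letter phi' al' r' sp' T' t.
  move=> tD; have := congr1 (fun s => nth (false, false, false) s t) wE.
  by rewrite !nth_mkseq// -DD.
have [p hp] := @contour_matching D phi al r pl T T1 T2 T3.
have [p' hp'] := @contour_matching D' phi' al' r' pl' T' T1' T2' T3'.
have xinj s t : (s < #|D|)%N -> (t < #|D|)%N -> x s = x t -> s = t.
  rewrite -ord => sN tN E; have := @findex_iter _ psi r s sN.
  by have := @findex_iter _ psi r t tN; rewrite -/(x s) -/(x t) E => -> ->.
have xinj' s t : (s < #|D|)%N -> (t < #|D|)%N -> x' s = x' t -> s = t.
  rewrite DD -ord' => sN tN E; have := @findex_iter _ psi' r' s sN.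
  by have := @findex_iter _ psi' r' t tN; rewrite -/(x' s) -/(x' t) E => -> ->.
have pp' t : (t < #|D|)%N -> p t = p' t.
  apply: (@noncrossing_unique #|D| (fun t => x t \in T)).
  - by move=> u uN; have [h1 h2 h3 h4 [h5 h6]] := hp u uN; split.
  - move=> u uN; rewrite DD in uN; have [h1 h2 h3 h4 [h5 h6]] := hp' u uN.
    have tt v : (v < #|D|)%N -> (x v \in T) = (x' v \in T') by move=> /wt[].
    rewrite -DD in uN h1; split => //; first by rewrite !tt.
    move=> v vN; rewrite !tt//; first exact: h6.
    by case/andP: vN => _ /ltn_trans; apply.
  move=> u uN; have [h1 _ _ _ [h5 _]] := hp u uN.
  have uN' := uN; rewrite DD in uN'; have [h1' _ _ _ [h5' _]] := hp' u uN'.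
  have [_ + _] := wt u uN; rewrite -!/(x _) -!/(x' _).
  rewrite (eq_in_has (a2 := fun v => v == p u)) => [|v]; last first.
    rewrite mem_iota /= add0n => vu; rewrite -h5; apply/eqP/eqP => [/xinj->//|->//].
    exact: ltn_trans uN.
  rewrite [in X in _ = X](eq_in_has (a2 := fun v => v == p' u)) => [|v]; last first.
    rewrite mem_iota /= add0n => vu; rewrite -h5'; apply/eqP/eqP => [/xinj'->//|->//].
      exact: ltn_trans uN.
    by rewrite DD.
  by rewrite !has_pred1 !mem_iota /= !add0n.
pose f d := x' (findex psi r d); pose g d := x (findex psi' r' d).
have fN d : (findex psi r d < #|D|)%N by rewrite -ord; exact: findex_max.
have fx t : (t < #|D|)%N -> f (x t) = x' t.
  by move=> tN; rewrite /f findex_iter ?ord.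
have xP d : exists2 t, (t < #|D|)%N & d = x t.
  by exists (findex psi r d) => //; rewrite /x iter_findex.
have fal d : f (al d) = al' (f d).
  have [t tN ->] := xP d; have [h1 _ _ _ [h5 _]] := hp t tN.
  have tN' := tN; rewrite DD in tN'; have [h1' _ _ _ [h5' _]] := hp' t tN'.
  by rewrite (fx t)// -[al' _]h5' -pp'// -[al _]h5 fx.
have fpsi d : f (psi d) = psi' (f d).
  have [t tN ->] := xP d; rewrite (fx t)//.
  have [tN1|] := ltnP t.+1 #|D|; first exact: (fx t.+1).
  move=> h; have tE : t.+1 = #|D| by apply/eqP; rewrite eqn_leq tN h.
  have -> : psi (x t) = r by rewrite -[psi _]/(x t.+1) tE -ord /x iter_order.
  have -> : psi' (x' t) = r' by rewrite -[psi' _]/(x' t.+1) tE DD -ord' /x' iter_order.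
  exact: (fx 0%N (leq_trans (ltn0Sn t) tN)).
have fT d : (f d \in T') = (d \in T).
  by have [t tN ->] := xP d; rewrite fx//; have [] := wt t tN.
exists f; split.
- exists g => d; rewrite /f /g.
    by rewrite findex_iter ?ord' -?DD// /x iter_findex.
  have gN : (findex psi' r' d < #|D|)%N by rewrite DD -ord'; exact: findex_max.
  by rewrite findex_iter ?ord// /x' iter_findex.
- have r0 : (0 < #|D|)%N by rewrite -ord order_gt0.
  exact: (fx 0%N r0).
- move=> d; have [dT|dT] := boolP (d \in T).
    have -> : phi d = psi d by rewrite /psi /contour_step dT ia.
    by rewrite fpsi /psi' /contour_step fT dT ia'.
  have -> : phi d = psi (al d) by rewrite /psi /contour_step T1 (negbTE dT) ia.
  by rewrite fpsi /psi' /contour_step fT T1 (negbTE dT) fal ia'.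
- exact: fal.
- by move=> d; have [t tN ->] := xP d; rewrite fx//; have [] := wt t tN.
Qed.

Local Close Scope ring_scope.

(** * Sparse minors and crossings *)

Section connected_sets.
Variables (V : finType) (adj : rel V).

Lemma connected_in1 a : connected_in adj [set a].
Proof. by move=> X _ x y; rewrite !inE => /eqP-> /eqP->. Qed.

Lemma connected_in_star (I : finType) (p : pred I) (F : I -> {set V}) a :
  (forall i, p i -> a \in F i) -> (forall i, p i -> connected_in adj (F i)) ->
  connected_in adj (a |: \bigcup_(i | p i) F i).
Proof.
move=> aF cF X hX.
suff h x : x \in a |: \bigcup_(i | p i) F i -> X x = X a by move=> x y /h-> /h->.
rewrite inE => /orP[|/bigcupP[i pi xi]]; first by rewrite inE => /eqP->.
apply: (cF i pi X) => [y z yi zi|//|]; last exact: aF.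
by apply: hX; rewrite inE; apply/orP; right; apply/bigcupP; exists i.
Qed.

Lemma connected_inU (S S' : {set V}) a : a \in S -> a \in S' -> connected_in adj S ->
  connected_in adj S' -> connected_in adj (S :|: S').
Proof.
move=> aS aS' cS cS' X hX.
suff h x : x \in S :|: S' -> X x = X a by move=> x y /h-> /h->.
rewrite inE => /orP[] xS; [apply: (cS X) => // | apply: (cS' X) => //] => y z yS zS;
  by apply: hX; rewrite inE ?yS ?zS ?orbT.
Qed.

Definition component (S : {set V}) (a : V) : {set V} :=
  [set z in S | connect (fun x y => [&& x \in S, y \in S & adj x y]) a z].

Lemma component_sub S a : component S a \subset S.
Proof. by apply/subsetP => z; rewrite inE => /andP[]. Qed.

Lemma mem_component (S : {set V}) a : a \in S -> a \in component S a.
Proof. by move=> aS; rewrite inE aS connect0. Qed.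

Lemma component_step S a x y : x \in component S a -> y \in S -> adj x y ->
  y \in component S a.
Proof.
rewrite !inE => /andP[xS ax] yS xy; rewrite yS /=.
by apply: (connect_trans ax); apply: connect1; rewrite xS yS.
Qed.

Lemma component_connected (S : {set V}) a : a \in S -> connected_in adj (component S a).
Proof.
move=> aS X hX.
suff h x : x \in component S a -> X x = X a by move=> x y /h-> /h->.
rewrite inE => /andP[xS /connectP[p]]; elim/last_ind: p x xS => [x _ _ ->//|p y IH x xS].
rewrite rcons_path last_rcons => /andP[pp /and3P[lS yS ly]] ->.
have lc : last a p \in component S a by rewrite inE lS; apply/connectP; exists p.
rewrite -(IH _ lS pp erefl); apply/esym/hX => //.
exact: component_step lc yS ly.
Qed.

Lemma connected_cut (S W : {set V}) a b : connected_in adj S -> symmetric adj ->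
  a \in S -> b \in S -> a \in W -> b \notin W ->
  exists x y, [/\ x \in S, y \in S, x \in W, y \notin W & adj x y].
Proof.
move=> cS sa aS bS aW bW.
have [/existsP[x /existsP[y /and5P[]]]|] :=
  boolP [exists x, exists y, [&& x \in S, y \in S, x \in W, y \notin W & adj x y]].
  by exists x, y.
rewrite negb_exists => /forallP h; exfalso.
have h' x y : x \in S -> y \in S -> x \in W -> adj x y -> y \in W.
  move=> xS yS xW xy; have := h x; rewrite negb_exists => /forallP/(_ y).
  by rewrite xS yS xW xy andbT /= negbK.
have E : (a \in W) = (b \in W).
  apply: (cS (fun x => x \in W)) => // x y xS yS xy.
  by apply/idP/idP => ?; [exact: (h' x y)|apply: (h' y x) => //; rewrite sa].
by rewrite -E aW in bW.
Qed.

End connected_sets.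

(** The consequence of planarity on which the crossing argument rests; [s] and [t] list the edges of
    a simple minor with branch sets [U]. *)
Definition minor_sparse (V : finType) (adj : rel V) : Prop :=
  forall (I : finType) (U : I -> {set V}) (q : nat) (s t : 'I_q -> I),
    (forall i j x, x \in U i -> x \in U j -> i = j) ->
    (forall i, connected_in adj (U i)) ->
    (forall e, exists2 x, x \in U (s e) & exists2 y, y \in U (t e) & adj x y) ->
    (forall e, s e != t e) ->
    (forall e f, [set s e; t e] = [set s f; t f] -> e = f) ->
  q <= 3 * #|I|.

Lemma planar_minor_sparse (D : finType) (phi al : D -> D) :
  planar phi al -> minor_sparse (dart_adj phi al).
Proof.
move=> pl I U q s t dU cU adjU nst sst.
have ex e : exists d, (froot (phi \o al) d \in U (s e)) &&
                      (froot (phi \o al) (al d) \in U (t e)).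
  have [x xU [y yU /existsP[d /andP[/eqP dx /eqP dy]]]] := adjU e.
  by exists d; rewrite dx dy xU.
apply: (@planar_minor_edges _ _ _ pl I U dU cU q (fun e => xchoose (ex e)) s t) => // e.
  by have /andP[] := xchooseP (ex e).
by have /andP[] := xchooseP (ex e).
Qed.

Lemma dart_adj_sym (D : finType) (phi al : D -> D) : involutive al ->
  symmetric (dart_adj phi al).
Proof.
move=> ia x y; apply/existsP/existsP => -[d /andP[h1 h2]]; exists (al d);
by rewrite ia h1 h2.
Qed.

(** * Minors from connected sets that are disjoint only for independent pairs *)

Section subdivided.
Variables (V : finType) (adj : rel V).
Hypotheses (sadj : symmetric adj) (sp : minor_sparse adj).
Variables (h : rel V) (Q : V -> V -> {set V}).
Variables (A B : {set V}).
Hypothesis AB : [disjoint A & B].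
Hypothesis Q_conn : forall a b, a \in A -> b \in B -> h a b -> connected_in adj (Q a b).
Hypothesis Q_l : forall a b, a \in A -> b \in B -> h a b -> a \in Q a b.
Hypothesis Q_r : forall a b, a \in A -> b \in B -> h a b -> b \in Q a b.
Hypothesis Q_disj : forall a b a' b', a \in A -> b \in B -> h a b ->
  a' \in A -> b' \in B -> h a' b' -> a != a' -> b != b' ->
  forall x, x \in Q a b -> x \in Q a' b' -> False.

(* A triple [(b, a, a')] is an edge [a a'] subdivided by [b]; in the minor, [b]
   is merged into the branch set of [a']. *)
Definition subdivision (E : {set V * V * V}) : bool :=
  [&& [forall e in E, [&& e.1.1 \in B, e.1.2 \in A, e.2 \in A, e.1.2 != e.2,
         h e.1.2 e.1.1 & h e.2 e.1.1]],
      [forall e in E, forall f in E, (e.1.1 == f.1.1) ==> (e == f)] &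
      [forall e in E, forall f in E,
         ([set e.1.2; e.2] == [set f.1.2; f.2]) ==> (e == f)]].

Lemma subdivisionP (E : {set V * V * V}) : reflect
  [/\ (forall e, e \in E -> [/\ e.1.1 \in B, e.1.2 \in A, e.2 \in A, e.1.2 != e.2 &
        h e.1.2 e.1.1 /\ h e.2 e.1.1]),
      (forall e f, e \in E -> f \in E -> e.1.1 = f.1.1 -> e = f) &
      (forall e f, e \in E -> f \in E -> [set e.1.2; e.2] = [set f.1.2; f.2] -> e = f)]
  (subdivision E).
Proof.
apply: (iffP and3P) => -[h1 h2 h3]; split.
- by move=> e /(forall_inP h1)/and5P[? ? ? ? /andP[]].
- by move=> e f eE fE /eqP ef; have /forall_inP/(_ f fE)/implyP/(_ ef)/eqP := forall_inP h2 e eE.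
- by move=> e f eE fE /eqP ef; have /forall_inP/(_ f fE)/implyP/(_ ef)/eqP := forall_inP h3 e eE.
- by apply/forall_inP => e /h1[-> -> -> -> [-> ->]].
- by apply/forall_inP => e eE; apply/forall_inP => f fE; apply/implyP => /eqP/h2->.
- by apply/forall_inP => e eE; apply/forall_inP => f fE; apply/implyP => /eqP/h3->.
Qed.

Variables (E : {set V * V * V}) (A' : {set V}).
Hypotheses (sE : subdivision E) (sA : A' \subset A).
Hypothesis EA : forall e, e \in E -> (e.1.2 \in A') && (e.2 \in A').
Hypothesis E_deg : forall a, a \in A' ->
  1 < #|[set e in E | (e.1.2 == a) || (e.2 == a)]|.

Let inc (e : V * V * V) a := (e.1.2 == a) || (e.2 == a).

Let EP e : e \in E -> [/\ e.1.1 \in B, e.1.2 \in A, e.2 \in A, e.1.2 != e.2 &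
    h e.1.2 e.1.1 /\ h e.2 e.1.1].
Proof. by case/subdivisionP: sE => + _ _; apply. Qed.

Let incA e a : e \in E -> inc e a -> [/\ a \in A, e.1.1 \in B & h a e.1.1].
Proof. by move=> /EP[h1 h2 h3 _ [h4 h5]] /orP[]/eqP <-. Qed.

Let F1 e f a a' x : e \in E -> f \in E -> e != f -> inc e a -> inc f a' -> a != a' ->
  x \in Q a e.1.1 -> x \in Q a' f.1.1 -> False.
Proof.
move=> eE fE ef ea fa aa'.
have [h1 h2 h3] := incA eE ea; have [h4 h5 h6] := incA fE fa.
apply: Q_disj => //; apply: contra ef => /eqP; case/subdivisionP: sE => _ + _.
by move=> /(_ e f eE fE) + E1 => /(_ E1)/eqP.
Qed.

(** The purpose of the degree condition: [a] lies on the set of a second triple, which uses another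
    [b], and this set is therefore disjoint from [Q a' f.1.1]. *)
Let F2 f a a' : a \in A' -> f \in E -> inc f a' -> a != a' -> a \notin Q a' f.1.1.
Proof.
move=> aA fE fa aa'; apply/negP => aQ.
have : exists2 e, e \in [set e in E | inc e a] & e != f.
  have /card_gt1P[e [e' [he he' ee']]] := E_deg aA.
  have [ef|] := eqVneq e f; last by exists e.
  by exists e'; rewrite // -ef eq_sym.
move=> [e]; rewrite inE => /andP[eE ea] ef.
have [h1 h2 h3] := incA eE ea.
exact: F1 eE fE ef ea fa aa' (Q_l h1 h2 h3) aQ.
Qed.

(** Sets of pairs sharing an end may meet, so they cannot all be kept whole. The branch set [Up a]
    takes [Q a b] entirely for the triples arriving at [a], and for a triple leaving [a] only the
    component [W e] of [a] outside the part [U] of the other end. *)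
Let U a := a |: \bigcup_(e in E | e.2 == a) Q a e.1.1.
Let W (e : V * V * V) := component adj (Q e.1.2 e.1.1 :\: U e.2) e.1.2.
Let Up a := a |: \bigcup_(i in [set: bool] | true) 
  (if i then U a else a |: \bigcup_(e in E | e.1.2 == a) W e).

Let U_disj a a' x : a \in A' -> a' \in A' -> a != a' -> x \in U a -> x \in U a' -> False.
Proof.
move=> aA aA' aa'; rewrite !inE.
move=> /orP[/eqP->|/bigcupP[e /andP[eE ea] xe]] /orP[/eqP xa|/bigcupP[f /andP[fE fa] xf]].
- by rewrite xa eqxx in aa'.
- have := F2 aA fE (a' := a') _ aa'; rewrite /inc fa orbT => /(_ isT); by rewrite xf.
- have := F2 aA' eE (a' := a) _; rewrite /inc ea orbT eq_sym => /(_ isT aa').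
  by rewrite -xa xe.
- apply: (F1 eE fE _ _ _ aa' xe xf); rewrite /inc ?ea ?fa ?orbT//.
  by apply: contra aa' => /eqP ef; rewrite -(eqP ea) ef (eqP fa).
Qed.

Let W_sub e x : x \in W e -> x \in Q e.1.2 e.1.1 /\ x \notin U e.2.
Proof. by move=> /(subsetP (component_sub _ _ _)); rewrite inE => /andP[]. Qed.

Let W_root e : e \in E -> e.1.2 \in Q e.1.2 e.1.1 :\: U e.2.
Proof.
move=> eE; have [h1 h2 h3 h4 [h5 h6]] := EP eE; have /andP[h7 h8] := EA eE.
rewrite inE Q_l// andbT; apply/negP; apply: U_disj h4 _ => //.
by rewrite !inE eqxx.
Qed.

Let mem_Up a x : a \in A' -> x \in Up a ->
  x \in U a \/ exists e, [/\ e \in E, e.1.2 = a & x \in W e].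
Proof.
move=> aA; rewrite inE => /orP[|/bigcupP[[] _]].
- by rewrite inE => /eqP->; left; rewrite !inE eqxx.
- by left.
- rewrite inE => /orP[|/bigcupP[e /andP[eE /eqP ea] xe]]; last by right; exists e.
  by rewrite inE => /eqP->; left; rewrite !inE eqxx.
Qed.

Let UW a e x : a \in A' -> e \in E -> e.1.2 != a -> x \in U a -> x \in W e -> False.
Proof.
move=> aA eE ea xU /W_sub[xQ xN].
have [ea2|ea2] := eqVneq e.2 a; first by rewrite ea2 xU in xN.
move: xU; rewrite !inE => /orP[/eqP xa|/bigcupP[f /andP[fE fa] xf]].
  have ne : a != e.1.2 by rewrite eq_sym.
  have := F2 aA eE (a' := e.1.2) _ ne; rewrite /inc eqxx => /(_ isT).
  by rewrite -xa xQ.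
apply: (F1 eE fE _ _ _ ea xQ xf); rewrite /inc ?eqxx ?fa ?orbT//.
by apply: contra ea2 => /eqP->.
Qed.

(** For each triple the connected set [Q e.1.2 e.1.1] leads from [W e] to the middle vertex, which
    lies in [U e.2]. The step that leaves the component [W e] has to enter [U e.2], and it realises
    the edge of the minor. *)
Lemma subdivision_sparse : #|E| <= 3 * #|A'|.
Proof.
pose I : finType := {a | a \in A'}.
have sub_in (e : V * V * V) (eE : e \in E) : (e.1.2 \in A') /\ (e.2 \in A').
  by apply/andP; exact: EA.
pose s (i : 'I_#|E|) : I := exist (fun a => a \in A') _ (sub_in _ (enum_valP i)).1.
pose t (i : 'I_#|E|) : I := exist (fun a => a \in A') _ (sub_in _ (enum_valP i)).2.
have -> : #|A'| = #|I| by rewrite card_sig.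
apply: (sp (U := fun a : I => Up (val a)) (s := s) (t := t)).
- move=> i j x /(mem_Up (valP i)) xi /(mem_Up (valP j)) xj; apply/val_inj/eqP.
  apply: contraT => ij; exfalso.
  case: xi => [xi|[e [eE ei xi]]]; case: xj => [xj|[f [fE fj xj]]].
  + exact: U_disj (valP i) (valP j) ij xi xj.
  + by apply: (UW (valP i) fE _ xi xj); rewrite fj eq_sym.
  + by apply: (UW (valP j) eE _ xj xi); rewrite ei.
  + have [xe _] := W_sub xi; have [xf _] := W_sub xj.
    rewrite ei in xe; rewrite fj in xf.
    apply: (F1 eE fE _ _ _ ij xe xf); rewrite /inc ?ei ?fj ?eqxx//.
    by apply: contra ij => /eqP ef; rewrite -ei ef fj.
- move=> i; apply: connected_in_star => [[] _|[] _]; rewrite ?inE ?eqxx//.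
  + apply: connected_in_star => e /andP[eE /eqP ea]; have [h1 h2 h3 h4 [h5 h6]] := EP eE.
      by rewrite -ea Q_l.
    by rewrite -ea; exact: Q_conn.
  + apply: connected_in_star => e /andP[eE /eqP ea].
      by rewrite -ea; apply: mem_component; exact: W_root.
    by apply: component_connected; exact: W_root.
- move=> i; have eE := enum_valP i; set e := enum_val i in eE *.
  have [h1 h2 h3 h4 [h5 h6]] := EP eE.
  have aW : e.1.2 \in W e by apply: mem_component; exact: W_root.
  have bU : e.1.1 \in U e.2.
    by rewrite !inE; apply/orP; right; apply/bigcupP; exists e; rewrite ?eE ?eqxx ?Q_r.
  have bW : e.1.1 \notin W e by apply/negP => /W_sub[_]; rewrite bU.
  have [x [y [xQ yQ xW yW xy]]] := connected_cut (Q_conn h2 h1 h5) sadj (Q_l h2 h1 h5)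
    (Q_r h2 h1 h5) aW bW.
  exists x => /=.
    rewrite inE; apply/orP; right; apply/bigcupP; exists false; rewrite ?in_setT// inE.
    by apply/orP; right; apply/bigcupP; exists e => //; rewrite eE eqxx.
  exists y => //=; rewrite inE; apply/orP; right; apply/bigcupP; exists true; rewrite ?in_setT//.
  have [//|yU] := boolP (y \in U e.2).
  by case/negP: yW; apply: component_step xW _ xy; rewrite inE yU.
- move=> i; have [_ _ _ + _] := EP (enum_valP i).
  by apply: contra => /eqP/(congr1 val)/= ->.
- move=> i j ij; apply: enum_val_inj; case/subdivisionP: sE => _ _; apply; [exact: enum_valP..|].
  have := congr1 (fun S : {set I} => val @: S) ij.
  by rewrite !imsetU1 !imset_set1.
Qed.

End subdivided.

(** * Random sampling as a count of colourings *)

Section coloring_averages.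
Variables (V : finType) (t : nat).

(** Colourings with [t] colours replace independent sampling: the points of one colour form a random
    set of density [1 / t], and averages become counts. *)
Lemma sum_ffun_prod (G : {set V}) (w : 'I_t -> nat) :
  \sum_(f : {ffun V -> 'I_t}) \prod_(y in G) w (f y) =
  (\sum_c w c) ^ #|G| * t ^ (#|V| - #|G|).
Proof.
transitivity (\sum_(f : {ffun V -> 'I_t}) \prod_y (if y \in G then w (f y) else 1)).
  by apply: eq_bigr => f _; rewrite big_mkcond.
rewrite -(bigA_distr_bigA (fun y c => if y \in G then w c else 1)) (bigID (mem G)) /=.
congr (_ * _).
  rewrite -prod_nat_const; apply: eq_bigr => y yG.
  by apply: eq_bigr => c _; rewrite yG.
rewrite -(cardsC G) addKn -prod_nat_const; apply: eq_big => [y|y yG].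
  by rewrite !inE.
by rewrite (negbTE yG) sum1_card card_ord.
Qed.

Lemma count_zero_colored (o : 'I_t) (G : {set V}) :
  #|[set f : {ffun V -> 'I_t} | [forall y in G, f y == o]]| = t ^ (#|V| - #|G|).
Proof.
have := sum_ffun_prod G (fun c => c == o).
have -> : \sum_c (c == o) = 1 by rewrite (bigD1 o)//= eqxx big1// => c /negbTE->.
rewrite exp1n mul1n => <-; rewrite -sum1_card big_mkcond; apply: eq_bigr => f _.
rewrite inE; case: (boolP [forall y in G, f y == o]) => [/forall_inP h|].
  by rewrite big1// => y /h ->.
rewrite negb_forall => /existsP[y]; rewrite negb_imply => /andP[yG /negbTE fy].
by rewrite (bigD1 y)//= fy mul0n.
Qed.

End coloring_averages.

Section few_hits.
Variables (V : finType) (G : {set V}).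

Let hits (f : {ffun V -> 'I_8}) := [set y in G | f y == ord0].

(** Exponential Markov inequality. With weight 1 on the sampled colour and 2 on the seven others, a
    colouring with fewer than 8 hits has weight at least [2 ^ (#|G| - 7)], against a mean of
    [(15 / 8) ^ #|G|]. *)
Lemma few_hits (d : nat) : 2 ^ 9 * 15 ^ d <= 16 ^ d -> d <= #|G| ->
  #|[set f : {ffun V -> 'I_8} | #|[set y in G | f y == ord0]| < 8]| * 4 <= 8 ^ #|V|.
Proof.
move=> hd dG.
have hG : 2 ^ 9 * 15 ^ #|G| <= 16 ^ #|G|.
  have [k ->] : exists k, #|G| = d + k by exists (#|G| - d); rewrite subnKC.
  by rewrite !expnD mulnA leq_mul//; case: k => // k; rewrite leq_exp2r.
set bad := [set f | _].
have : #|bad| * 2 ^ #|G| <= 2 ^ 7 * (15 ^ #|G| * 8 ^ (#|V| - #|G|)).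
  have -> : 15 = \sum_(c < 8) (if c == ord0 then 1 else 2).
    by rewrite !big_ord_recl big_ord0.
  rewrite -sum_ffun_prod -sum_nat_const big_distrr /= [X in _ <= X](bigID (mem bad)) /=.
  apply: leq_trans (leq_addr _ _); apply: leq_sum => f; rewrite inE => fb.
  have -> : \prod_(y in G) (if f y == ord0 then 1 else 2) = 2 ^ #|G :\: hits f|.
    rewrite -prod_nat_const big_mkcond [RHS]big_mkcond; apply: eq_bigr => y _ /=.
    by rewrite !inE; case: (y \in G); case: eqP.
  have hs : hits f \subset G by apply/subsetP => y; rewrite inE => /andP[].
  by rewrite -expnD leq_exp2l// -(cardsID (hits f) G) (setIidPr hs) leq_add2r.
have GV : #|G| <= #|V| by exact: max_card.
have -> : 8 ^ #|V| = 8 ^ #|G| * 8 ^ (#|V| - #|G|) by rewrite -expnD subnKC.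
move: hG; have -> : 16 ^ #|G| = 2 ^ #|G| * 8 ^ #|G| by rewrite -expnMn.
have g0 : 0 < 2 ^ #|G| by rewrite expn_gt0.
move: (8 ^ (#|V| - #|G|)) (8 ^ #|G|) (15 ^ #|G|) g0 (#|bad|) => x y z.
move: (2 ^ #|G|) => g g0 b h1 h2.
rewrite -(leq_pmul2l g0); have := leq_mul h1 (leqnn x).
rewrite (_ : 2 ^ 9 = 4 * 2 ^ 7)// in h1 *; move: h2; move: (2 ^ 7) => u; nia.
Qed.

End few_hits.

Section dense_bipartite.
Variables (V : finType) (h : rel V) (S : {set V}) (d : nat).
Hypothesis hd : 2 ^ 9 * 15 ^ d <= 16 ^ d.
Hypothesis S0 : S != set0.
Hypothesis degS : forall x, x \in S -> d <= #|[set y in S | h x y]|.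

(** [A] is sampled with density 1/8 and [B] is made of the unsampled points with at least 8 sampled
    neighbours. On average [A] has [#|S| / 8] points and [B] at least [(1 - 1/8 - 1/4) #|S|], more
    than three times as many. The threshold 8 is the least order of a complete graph with more than
    three edges per vertex. *)
Lemma dense_bipartite : exists A B : {set V},
  [/\ A \subset S, B \subset S, [disjoint A & B], 3 * #|A| < #|B| &
      forall b, b \in B -> 8 <= #|[set a in A | h b a]|].
Proof.
pose A (f : {ffun V -> 'I_8}) := [set x in S | f x == ord0].
pose B (f : {ffun V -> 'I_8}) := [set x in S | (f x != ord0) && (8 <= #|[set a in A f | h x a]|)].
suff [f hf] : exists f, 3 * #|A f| < #|B f|.
  exists (A f), (B f); split => //.
  - by apply/subsetP => x; rewrite inE => /andP[].
  - by apply/subsetP => x; rewrite inE => /andP[].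
  - by apply/pred0P => x /=; rewrite !inE; case: (x \in S); case: eqP.
  - by move=> b; rewrite inE => /and3P[].
apply/existsP; apply: contraT; rewrite negb_exists => /forallP hf.
have sA : \sum_f #|A f| * 8 = #|S| * 8 ^ #|V|.
  rewrite -big_distrl /=.
  under eq_bigr => f _ do rewrite -sum1_card big_mkcond /=.
  rewrite exchange_big /= -sum_nat_const [RHS]big_mkcond big_distrl /=.
  apply: eq_bigr => x _; have := count_zero_colored (ord0 : 'I_8) [set x].
  case: (boolP (x \in S)) => xS; last by rewrite big1// => f _; rewrite inE (negbTE xS).
  rewrite cards1 => E; rewrite (_ : \sum_f _ = 8 ^ (#|V| - 1)).
    by rewrite -expnSr subn1 prednK// (cardD1 x) inE.
  rewrite -E -sum1_card [RHS]big_mkcond; apply: eq_bigr => f _; rewrite !inE xS /=.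
  congr (if _ then _ else _); apply/idP/forall_inP => [fx y|]; last by apply; rewrite inE.
  by rewrite inE => /eqP ->.
have sB : #|S| * 8 ^ #|V| * 5 <= \sum_f #|B f| * 8.
  have pt f : #|S| <= #|B f| + #|A f| +
      \sum_(x in S) (#|[set y in [set y in S | h x y] | f y == ord0]| < 8).
    rewrite -!sum1_card ![\sum_(i in finset _) _]big_mkcond /= [X in X <= _]big_mkcond /=.
    rewrite [X in _ <= _ + X]big_mkcond -!big_split /=; apply: leq_sum => x _.
    rewrite !inE; case: (x \in S) => //=; case: (f x == ord0) => //=.
    rewrite addn0 (_ : [set a in A f | h x a] = [set y in [set y in S | h x y] | f y == ord0]).
      by move: #|_| => n; have [//|] := ltnP 7 n; rewrite -ltnS => ->.
    by apply/setP => y; rewrite !inE andbAC.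
  have : \sum_(f : {ffun V -> 'I_8}) #|S| * 8 <= \sum_f (#|B f| * 8 + #|A f| * 8 +
      (\sum_(x in S) (#|[set y in [set y in S | h x y] | f y == ord0]| < 8)) * 8).
    by apply: leq_sum => f _; rewrite -!mulnDl leq_mul2r pt orbT.
  rewrite sum_nat_const card_ffun card_ord !big_split /= sA.
  suff : \sum_(f : {ffun V -> 'I_8}) (\sum_(x in S) (#|[set y in [set y in S | h x y] | f y == ord0]| < 8)) * 8
    <= #|S| * 8 ^ #|V| * 2.
    have aux (u v b k : nat) : u * (v * 8) <= b + v * u + k -> k <= v * u * 2 ->
      v * u * 5 <= b by clear; nia.
    by move=> h1 h2; exact: aux h2 h1.
  rewrite -big_distrl /= exchange_big /= -sum_nat_const !big_distrl /=.
  apply: leq_sum => x xS; have := few_hits hd (degS xS).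
  rewrite -sum1_card [\sum_(_ in finset _) _]big_mkcond /=.
  rewrite (eq_bigr (fun f : {ffun V -> 'I_8} => nat_of_bool
     (#|[set y in [set y in S | h x y] | f y == ord0]| < 8))); last first.
    by move=> f _; rewrite inE; case: ltnP.
  by move: (8 ^ #|V|) (\sum_i _) => u v; lia.
have : \sum_f #|B f| * 8 <= \sum_f 3 * (#|A f| * 8).
  by apply: leq_sum => f _; rewrite mulnA leq_mul2r leqNgt hf orbT.
rewrite -big_distrr /= sA.
have : 0 < #|S| * 8 ^ #|V| by rewrite muln_gt0 card_gt0 S0 expn_gt0.
by move: sB; move: (_ * 8 ^ _) (\sum_f _) => u v; lia.
Qed.

End dense_bipartite.
Lemma dense_constant : exists d, 2 ^ 9 * 15 ^ d <= 16 ^ d.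
Proof.
have bern k : 15 ^ k * (15 + k) <= 15 * 16 ^ k.
  by elim: k => [|k IH]; rewrite ?expn0// !expnS; nia.
have [k ->] : exists k, 2 ^ 9 = k.+1 by exists (2 ^ 9).-1; rewrite prednK.
exists (15 * k); have := bern (15 * k); move: (15 ^ _) (16 ^ _) => a b; nia.
Qed.

Definition independent (V : eqType) (j j' : V * V) : bool :=
  [&& j.1 != j'.1, j.1 != j'.2, j.2 != j'.1 & j.2 != j'.2].

Section independent_sparse.
Variables (V : finType) (adj : rel V).
Hypotheses (sadj : symmetric adj) (sp : minor_sparse adj).
Variable d : nat.
Hypothesis hd : 2 ^ 9 * 15 ^ d <= 16 ^ d.
Variables (S : {set V}) (J : {set V * V}) (P : V * V -> {set V}).
Hypothesis JP : forall j, j \in J -> [/\ j.1 \in S, j.2 \in S, j.1 != j.2,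
  connected_in adj (P j) & j.1 \in P j /\ j.2 \in P j].
Hypothesis P_disj : forall j j', j \in J -> j' \in J -> independent j j' ->
  forall x, x \in P j -> x \in P j' -> False.

Let h : rel V := fun x y => ((x, y) \in J) || ((y, x) \in J).
Let hC x y : h x y = h y x. Proof. by rewrite /h orbC. Qed.
Let Q x y := if (x, y) \in J then P (x, y) else P (y, x).
Let ind (S' : {set V}) := [set j in J | (j.1 \in S') && (j.2 \in S')].

Let min_degree : 2 * d * #|S| < #|J| -> exists S' : {set V},
  S' != set0 /\ forall x, x \in S' -> d <= #|[set y in S' | h x y]|.
Proof.
move=> big; pose bad (S' : {set V}) := 2 * d * #|S'| < #|ind S'|.
have badS : bad S.
  rewrite /bad (_ : ind S = J)//; apply/setP => j; rewrite inE.
  by case: (boolP (j \in J)) => //= /JP[-> ->].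
have [S' /minsetP[bS' mS'] _] := minset_exists badS.
exists S'; split.
  apply: contraTneq bS' => ->; rewrite /bad cards0 muln0 lt0n negbK cards_eq0.
  by apply/eqP/setP => j; rewrite !inE; case: (j \in J).
move=> x xS'.
have nb : ~~ bad (S' :\ x).
  apply/negP => b; have := mS' _ b (subD1set _ _) => /setP/(_ x).
  by rewrite xS' !inE eqxx.
have E : ind S' \subset ind (S' :\ x) :|: ([set (x, y) | y in [set y in S' | h x y]] :|:
    [set (y, x) | y in [set y in S' | h x y]]).
  apply/subsetP => -[a b]; rewrite !inE /= => /and3P[abJ aS bS]; rewrite abJ aS bS /= !andbT.
  have [ax|_] := eqVneq a x.
    rewrite ax in abJ *; apply/orP; right; apply/orP; left; apply/imsetP.
    by exists b => //; rewrite inE bS /h abJ.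
  have [bx|//] := eqVneq b x.
  rewrite bx in abJ *; apply/orP; right; apply/orP; right; apply/imsetP.
  by exists a => //; rewrite inE aS /h abJ orbT.
have := subset_leq_card E; rewrite !cardsU.
move: bS' nb; rewrite /bad -leqNgt (cardsD1 x S') xS'.
have := leq_imset_card (fun y => (x, y)) [set y in S' | h x y].
have := leq_imset_card (fun y => (y, x)) [set y in S' | h x y].
have aux (n a b c e f i u : nat) : a <= n -> b <= n -> 2 * d + u < f -> i <= u ->
  f <= i + (b + a - c) - e -> d <= n by clear; lia.
by rewrite /= add1n mulnS; exact: aux.
Qed.

(** If [J] were denser, it would contain the bipartite graph of [dense_bipartite]. A maximal family
    [E] of pairs of [A] subdivided through distinct points of [B] then has a part with more than
    three edges per vertex, against [subdivision_sparse]. *)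
Lemma independent_sparse : #|J| <= 2 * d * #|S|.
Proof.
rewrite leqNgt; apply/negP => /min_degree[S' [S0 dS']].
have [A [B [AS BS AB AB3 B8]]] := @dense_bipartite V h S' d hd S0 dS'.
have hJ a b : h a b -> exists2 j, j \in J & Q a b = P j /\
    ((j.1 = a /\ j.2 = b) \/ (j.1 = b /\ j.2 = a)).
  rewrite /Q; case: ifP => abJ; first by exists (a, b) => //; split => //; left.
  by rewrite /h abJ /= => baJ; exists (b, a) => //; split => //; right.
have nAB a b : a \in A -> b \in B -> a != b.
  move=> aA bB; apply/eqP => ab; have := disjointFr AB aA.
  by rewrite ab bB.
have Qc a b : a \in A -> b \in B -> h a b -> connected_in adj (Q a b).
  by move=> _ _ /hJ[j /JP[_ _ _ cP _] [-> _]].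
have Ql a b : a \in A -> b \in B -> h a b -> a \in Q a b.
  by move=> _ _ /hJ[j /JP[_ _ _ _ [h1 h2]] [-> [[<- _]|[_ <-]]]].
have Qr a b : a \in A -> b \in B -> h a b -> b \in Q a b.
  by move=> _ _ /hJ[j /JP[_ _ _ _ [h1 h2]] [-> [[_ <-]|[<- _]]]].
have Qd a b a' b' : a \in A -> b \in B -> h a b -> a' \in A -> b' \in B -> h a' b' ->
    a != a' -> b != b' -> forall x, x \in Q a b -> x \in Q a' b' -> False.
  move=> aA bB /hJ[j jJ [-> jE]] aA' bB' /hJ[j' jJ' [-> jE']] aa' bb' x xj xj'.
  apply: (P_disj jJ jJ' _ xj xj').
  have n1 := nAB _ _ aA bB'; have n2 := nAB _ _ aA' bB.
  by rewrite /independent; case: jE => -[-> ->]; case: jE' => -[-> ->];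
    rewrite ?aa' ?bb' ?n1 ?n2 ![b == _]eq_sym ?n2 ?bb'// eq_sym bb'.
pose sub := subdivision h A B.
have sub0 : sub set0 by apply/subdivisionP; split => e; rewrite inE.
case: (arg_maxnP (fun E : {set V * V * V} => #|E|) sub0) => E sE maxE.
pose EI (X : {set V}) := [set e in E | (e.1.2 \in X) && (e.2 \in X)].
have /subdivisionP[sE1 sE2 sE3] := sE.
have [X XA hX] : exists2 X : {set V}, X \subset A & 3 * #|X| < #|EI X|.
  have [h3|h3] := ltnP (3 * #|A|) #|E|.
    exists A => //; rewrite (_ : EI A = E)//; apply/setP => e; rewrite inE.
    by case: (boolP (e \in E)) => //= /sE1[_ -> ->].
  (* As [#|E| <= 3 * #|A| < #|B|], some [b] is in no triple. By maximality of [E] its neighbours in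
     [A], at least 8 of them, are already joined pairwise. *)
  have [b bB bE] : exists2 b, b \in B & b \notin [set e.1.1 | e in E].
    apply/exists_inP; rewrite -negb_forall_in; apply/negP => /forall_inP BE.
    have /subset_leq_card : B \subset [set e.1.1 | e in E] by apply/subsetP.
    move=> /leq_trans/(_ (leq_imset_card _ _))/leq_trans/(_ h3).
    by rewrite leqNgt AB3.
  pose N := [set a in A | h b a].
  exists N; first by apply/subsetP => a; rewrite inE => /andP[].
  have pairs a a' : a \in N -> a' \in N -> a != a' ->
      exists2 e, e \in E & [set e.1.2; e.2] = [set a; a'].
    move=> aN aN' aa'.
    pose has := [exists (e | e \in E), [set e.1.2; e.2] == [set a; a']].
    suff /existsP[e /andP[eE /eqP eS]] : has by exists e.
    apply: contraT; rewrite negb_exists => /forallP nE.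
    have nn : (b, a, a') \notin E.
      by apply: contra bE => hE; apply/imsetP; exists (b, a, a').
    have : sub ((b, a, a') |: E).
      move: aN aN'; rewrite !inE => /andP[aA ha] /andP[aA' ha'].
      apply/subdivisionP; split.
      - by move=> e; rewrite !inE => /orP[/eqP->|/sE1//]; rewrite /= bB aA aA' aa' ![h _ b]hC.
      - move=> e f; rewrite !inE => /orP[/eqP->|eE] /orP[/eqP->|fE]//=.
        + by move=> bf; case/negP: bE; apply/imsetP; exists f.
        + by move=> bf; case/negP: bE; apply/imsetP; exists e.
        + exact: sE2.
      - move=> e f; rewrite !inE => /orP[/eqP->|eE] /orP[/eqP->|fE]//=.
        + by move=> bf; have := nE f; rewrite fE bf eqxx.
        + by move=> bf; have := nE e; rewrite eE bf eqxx.
        + exact: sE3.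
    by move=> /maxE /=; rewrite cardsU1 nn add1n ltnn.
  have sO : setX N N \subset [set (a, a) | a in N] :|:
      ([set (e.1.2, e.2) | e in EI N] :|: [set (e.2, e.1.2) | e in EI N]).
    apply/subsetP => -[a a']; rewrite inE /= => /andP[aN aN'].
    have [->|aa'] := eqVneq a a'; first by rewrite inE; apply/orP; left; apply/imsetP; exists a'.
    have [e eE eS] := pairs _ _ aN aN' aa'.
    have ea : a \in [set e.1.2; e.2] by rewrite eS !inE eqxx.
    have ea' : a' \in [set e.1.2; e.2] by rewrite eS !inE eqxx orbT.
    have eN : e \in EI N.
      have : (e.1.2 \in [set a; a']) && (e.2 \in [set a; a']) by rewrite -eS !inE !eqxx orbT.
      by rewrite !inE eE => /andP[/orP[]/eqP-> /orP[]/eqP->]; move: aN aN';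
        rewrite !inE => /andP[k1 k2] /andP[k3 k4]; rewrite ?k1 ?k2 ?k3 ?k4.
    rewrite !inE; apply/orP; right; move: ea ea'; rewrite !inE.
    move=> /orP[]/eqP aE /orP[]/eqP aE'; rewrite ?aE ?aE' in aa' *.
    - by rewrite eqxx in aa'.
    - by apply/orP; left; apply/imsetP; exists e.
    - by apply/orP; right; apply/imsetP; exists e.
    - by rewrite eqxx in aa'.
  have := subset_leq_card sO; rewrite cardsX !cardsU.
  have := leq_imset_card (fun a => (a, a)) N.
  have := leq_imset_card (fun e : V * V * V => (e.1.2, e.2)) (EI N).
  have := leq_imset_card (fun e : V * V * V => (e.2, e.1.2)) (EI N).
  have : 8 <= #|N| by exact: B8.
  have aux (n a b' c e i k : nat) : 8 <= n -> b' <= e -> a <= e -> k <= n ->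
    n * n <= k + (a + b' - c) - i -> 3 * n < e.
    by clear; move=> n8; have := leq_mul n8 (leqnn n); move: (n * n) => u; lia.
  exact: aux.
(* In a minimal set with more than three edges per vertex all degrees exceed three, which gives the
   degree condition of [subdivision_sparse]. *)
pose bad (X' : {set V}) := 3 * #|X'| < #|EI X'|.
have [A' /minsetP[bA' mA'] A'X] := minset_exists (hX : bad X).
have A'A := subset_trans A'X XA.
have sE' : subdivision h A B (EI A').
  apply/subdivisionP; split => [e|e f|e f]; rewrite !inE.
  - by move=> /andP[/sE1].
  - by move=> /andP[eE _] /andP[fE _]; exact: sE2.
  - by move=> /andP[eE _] /andP[fE _]; exact: sE3.
have := @subdivision_sparse V adj sadj sp h Q A B Qc Ql Qr Qd (EI A') A' sE' _ _.
have EA e : e \in EI A' -> (e.1.2 \in A') && (e.2 \in A') by rewrite inE => /andP[].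
move=> /(_ EA) hh; have := bA'; rewrite {1}/bad ltnNge hh// => a aA'.
have nb : ~~ bad (A' :\ a).
  apply/negP => b; have := mA' _ b (subD1set _ _) => /setP/(_ a).
  by rewrite aA' !inE eqxx.
have sI : EI A' \subset EI (A' :\ a) :|: [set e in EI A' | (e.1.2 == a) || (e.2 == a)].
  apply/subsetP => e; rewrite !inE => /and3P[-> -> ->] /=; rewrite !andbT.
  by do 2!case: eqP.
have := subset_leq_card sI; rewrite cardsU.
have aux (f i k c n : nat) : i <= 3 * n -> 3 * (1 + n) < f -> f <= i + k - c -> 1 < k by clear; lia.
by move: nb bA'; rewrite /bad -leqNgt (cardsD1 a A') aA'; exact: aux.
Qed.

End independent_sparse.

(** * Splitting the root vertex *)

Definition tri_map_axioms (D : finType) (phi al : D -> D) (sp : D -> bool) : Prop :=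
  [/\ planar phi al, forall d, phi (phi (phi d)) = d, forall d, phi d != d &
      forall d, sp (phi (al d)) = sp d].

Section splitting.
Variables (D : finType) (phi al : D -> D) (sp : D -> bool) (r : D) (i : nat).
Hypothesis ax : tri_map_axioms phi al sp.
Notation sg := (phi \o al).
Hypotheses (i_gt0 : 0 < i) (i_lt : i < order sg r).
Let e := iter i sg r.
Hypothesis e_al : e != al r.

(* The edges of [r] and [e] are opened, and the two triangles [(false, _)] and
   [(true, _)], glued along their middle sides, are inserted: this splits the
   origin of [r] into two vertices. *)
Definition split_dart : finType := (D + bool * option bool)%type.

Definition split_phi (z : split_dart) : split_dart :=
  match z with
  | inl d => inl (phi d)
  | inr (b, None) => inr (b, Some false)
  | inr (b, Some false) => inr (b, Some true)
  | inr (b, Some true) => inr (b, None)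
  end.

Definition split_al (z : split_dart) : split_dart :=
  match z with
  | inl d => if d == r then inr (false, None) else if d == al r then inr (false, Some true)
             else if d == e then inr (true, None)
             else if d == al e then inr (true, Some true) else inl (al d)
  | inr (false, None) => inl r
  | inr (false, Some true) => inl (al r)
  | inr (true, None) => inl e
  | inr (true, Some true) => inl (al e)
  | inr (b, Some false) => inr (~~ b, Some false)
  end.

Definition split_sp (z : split_dart) : bool :=
  match z with
  | inl d => sp d
  | inr (b, None) => sp (al (if b then e else r))
  | inr (_, Some _) => sp r
  end.

Definition split_root : split_dart := inr (false, Some false).

Let pl : planar phi al. Proof. by case: ax. Qed.
Let ia : involutive al. Proof. by case: pl => [[]]. Qed.
Let ip : injective phi. Proof. by case: pl => [[]]. Qed.
Let na d : al d != d. Proof. by case: pl => [[]]. Qed.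
Let is_ : injective sg. Proof. by apply: inj_comp => //; exact: inv_inj. Qed.

Let iter_inj j k : j < order sg r -> k < order sg r -> iter j sg r = iter k sg r -> j = k.
Proof.
by move=> jN kN E; rewrite -(findex_iter jN) -(findex_iter kN) E.
Qed.

Let er : e != r.
Proof.
apply/eqP => E; have := @iter_inj i 0 i_lt (order_gt0 _ _) E => i0.
by have := i_gt0; rewrite i0.
Qed.
Let ale_r : al e != r. Proof. by apply: contra e_al => /eqP <-; rewrite ia. Qed.
Let ale_alr : al e != al r. Proof. by rewrite (inj_eq (inv_inj ia)). Qed.

Lemma split_alK : involutive split_al.
Proof.
case=> [d|[[] [[]|]]] //=.
- case: (eqVneq d r) => [->//|n1]; case: (eqVneq d (al r)) => [->//|n2].
  case: (eqVneq d e) => [->//|n3]; case: (eqVneq d (al e)) => [->//|n4] /=.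
  by rewrite !(inv_eq ia) !ia (negbTE n1) (negbTE n2) (negbTE n3) (negbTE n4).
- by rewrite (negbTE ale_r) (negbTE ale_alr) (negbTE (na e)) eqxx.
- by rewrite (negbTE er) (negbTE e_al) eqxx.
- by rewrite (negbTE (na r)) eqxx.
- by rewrite eqxx.
Qed.

Lemma split_phiK : cancel split_phi (split_phi \o split_phi).
Proof. by case: ax => _ p3 _ _; case=> [d|[b [[]|]]] //=; rewrite p3. Qed.

Lemma split_phi_inj : injective split_phi.
Proof. exact: can_inj split_phiK. Qed.

Lemma split_cmap : cmap split_phi split_al.
Proof.
split; [exact: split_phi_inj|exact: split_alK| |].
- case=> [d|[[] [[]|]]] //=.
  by do 4![case: ifP => // _]; apply: contra (na d) => /eqP[->].
- have [_ _ _ co] := pl.1; move=> X Xp Xa.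
  have hx b : [/\ X (inr (b, Some false)) = X (inr (b, None)),
      X (inr (b, Some true)) = X (inr (b, None)) & X (inr (b, None)) = X (inr (b, None))].
    have h1 := Xp (inr (b, None)); have h2 := Xp (inr (b, Some false)).
    by rewrite /= in h1 h2; rewrite h2 h1.
  have [x1 x2 _] := hx false; have [y1 y2 _] := hx true.
  have a0 := Xa (inr (false, None)); have a1 := Xa (inr (false, Some true)).
  have a2 := Xa (inr (true, None)); have a3 := Xa (inr (true, Some true)).
  rewrite /= in a0 a1 a2 a3.
  have cD : forall d d', X (inl d) = X (inl d').
    apply: (co (fun d => X (inl d))) => d; first exact: (Xp (inl d)).
    have := Xa (inl d) => /=; case: (eqVneq d r) => [->|n1]; first by rewrite a0 a1 x2.
    case: (eqVneq d (al r)) => [->|n2]; first by rewrite ia a0 a1 x2.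
    case: (eqVneq d e) => [->|n3]; first by rewrite a2 a3 y2.
    by case: (eqVneq d (al e)) => [->|n4] //; rewrite ia a2 a3 y2.
  have all_r z : X z = X (inl r).
    case: z => [d|[[] [[]|]]]; [exact: cD|..].
    - by rewrite -a3; exact: cD.
    - by rewrite y1 -a2; exact: cD.
    - by rewrite -a2; exact: cD.
    - by rewrite -a1; exact: cD.
    - by rewrite x1 -a0.
    - by rewrite -a0.
  by move=> z z'; rewrite !all_r.
Qed.

Let traj := traject sg (sg r) i.
Let trajP d : reflect (exists2 j, 0 < j <= i & d = iter j sg r) (d \in traj).
Proof.
apply: (iffP trajectP) => [[j ji ->]|[[//|j] /andP[_ ji] ->]].
  by exists j.+1; rewrite ?ji//= -iterSr.
by exists j => //; rewrite -iterSr.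
Qed.

Let e_traj : e \in traj. Proof. by apply/trajP; exists i; rewrite ?i_gt0/=. Qed.
Let r_traj : r \notin traj.
Proof.
apply/trajP => -[j /andP[j0 ji] E].
have := @iter_inj 0 j (order_gt0 _ _) (leq_ltn_trans ji i_lt) E => j0E.
by rewrite -j0E in j0.
Qed.

Let traj_step d : d != r -> d != e -> (sg d \in traj) = (d \in traj).
Proof.
move=> dr de; apply/trajP/trajP => -[j /andP[j0 ji] E].
  case: j j0 ji E => // j _ ji /is_ E; exists j => //.
  by rewrite (ltnW ji) andbT lt0n; apply: contra dr => /eqP j0; rewrite E j0.
exists j.+1; last by rewrite E.
by rewrite /= ltn_neqAle ji andbT; apply: contra de => /eqP jE; rewrite E jE.
Qed.

Let Tv := ({x | froots sg x} + unit)%type.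
Let vr d : {x | froots sg x} := exist _ (froot sg d) (roots_root (fconnect_sym is_) d).
Let vr_sg d : vr (sg d) = vr d.
Proof. by apply: val_inj; exact: froot_step. Qed.

(** The vertex of a dart after the splitting: the darts from [sg r] to [e] move to the new vertex
    [inr tt], the others keep theirs. *)
Let gv d : Tv := if d \in traj then inr tt else inl (vr d).
Let g (z : split_dart) : Tv :=
  match z with
  | inl d => gv d
  | inr (b, None) => gv (al (if b then e else r))
  | inr (b, Some c) => if b (+) c then inr tt else inl (vr r)
  end.

Let gv_step d : d != r -> d != e -> gv (sg d) = gv d.
Proof. by move=> dr de; rewrite /gv traj_step// vr_sg. Qed.

Let g_inv z : g (split_phi (split_al z)) = g z.
Proof.
case: z => [d|[[] [[]|]]] //=.
- case: (eqVneq d r) => [->|n1] /=; first by rewrite /gv (negbTE r_traj).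
  case: (eqVneq d (al r)) => [->|n2] //=.
  case: (eqVneq d e) => [->|n3] /=; first by rewrite /gv e_traj.
  by case: (eqVneq d (al e)) => [->|n4] //=; exact: gv_step.
- rewrite -[phi (al e)]/(sg e) /gv vr_sg; have -> : vr e = vr r.
    apply: val_inj => /=; apply/eqP; rewrite froot_eq// fconnect_sym//; exact: fconnect_iter.
  case: ifP => // /trajP[j /andP[j0 ji] E].
  have := E; rewrite /e -[sg _]/(iter i.+1 sg r) => E'.
  have [iN|] := ltnP i.+1 (order sg r).
    by have := iter_inj iN (leq_ltn_trans ji i_lt) E' => ij; rewrite -ij ltnn in ji.
  move=> h; have iE : i.+1 = order sg r by apply/eqP; rewrite eqn_leq h i_lt.
  move: E'; rewrite iE iter_order// => E'.
  by have := @iter_inj 0 j (order_gt0 _ _) (leq_ltn_trans ji i_lt) E' => j0E; rewrite -j0E in j0.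
- rewrite -{1}(ia e) -[phi (al (al e))]/(sg (al e)); apply: gv_step => //.
- rewrite -[phi (al r)]/(sg r) /gv ifT//; apply/trajP; exists 1 => //.
- by rewrite -{1}(ia r) -[phi (al (al r))]/(sg (al r)); apply: gv_step => //; rewrite eq_sym.
Qed.

Let split_vertices : fcard sg D + 1 <= fcard (split_phi \o split_al) split_dart.
Proof.
have si : injective (split_phi \o split_al).
  by apply: inj_comp; [exact: split_phi_inj|exact: inv_inj split_alK].
apply: leq_trans (codom_le_fcard si (X := g) g_inv).
have -> : fcard sg D + 1 = #|{: Tv}|.
  by rewrite card_sum card_unit card_sig fcard_card; congr (_ + _); apply: eq_card.
apply/subset_leq_card/subsetP => -[[v rv]|[]] _; apply/codomP; last first.
  by exists (inr (false, Some true)).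
have [vE|vE] := eqVneq v (froot sg r).
  by exists split_root => /=; congr inl; apply: val_inj.
exists (inl v) => /=; rewrite /gv ifF; last first.
  apply/negP => /trajP[j _ E]; case/eqP: vE; have /eqP <- := rv.
  by apply/eqP; rewrite froot_eq// fconnect_sym// E fconnect_iter.
by congr inl; apply: val_inj => /=; apply/esym/eqP.
Qed.

Let split_faces : fcard phi D + 2 <= fcard split_phi split_dart.
Proof.
pose Tf := ({x | froots phi x} + bool)%type.
pose fr d : {x | froots phi x} := exist _ (froot phi d) (roots_root (fconnect_sym ip) d).
pose h (z : split_dart) : Tf := match z with inl d => inl (fr d) | inr (b, _) => inr b end.
apply: leq_trans (codom_le_fcard split_phi_inj (X := h) _); last first.
  case=> [d|[b [[]|]]] //=; congr inl; apply: val_inj; exact: froot_step.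
have -> : fcard phi D + 2 = #|{: Tf}|.
  by rewrite card_sum card_bool card_sig fcard_card; congr (_ + _); apply: eq_card.
apply/subset_leq_card/subsetP => -[[v rv]|b] _; apply/codomP; last by exists (inr (b, None)).
by exists (inl v) => /=; congr inl; apply: val_inj => /=; apply/esym/eqP.
Qed.

Lemma split_card : #|{: split_dart}| = #|D| + 6.
Proof. by rewrite card_sum card_prod card_bool card_option card_bool. Qed.

(** Invariants guarantee one more vertex and two more faces, and there are exactly three more edges;
    [euler_le] gives the opposite inequality, so genus zero is preserved. *)
Lemma split_tri : tri_map_axioms split_phi split_al split_sp.
Proof.
have [_ p3 pn ps] := ax; have spe : sp e = sp r.
  by rewrite /e; elim: (i) => //= j <-; exact: ps.
split.
- split; first exact: split_cmap.
  apply/eqP; rewrite eqn_leq euler_le /=; last exact: split_cmap.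
  have [_ _ sna _] := split_cmap.
  have aE := fcard_al split_alK sna; have aE0 := fcard_al ia na; have [_ eu] := pl.
  rewrite split_card in aE; have := leq_add split_vertices split_faces.
  have aux (a b c a' b' c' n : nat) : b' * 2 = n + 6 -> b * 2 = n -> a + c = b + 2 ->
    a + 1 + (c + 2) <= a' + c' -> b' + 2 <= a' + c' by clear; lia.
  exact: aux aE aE0 eu.
- by case=> [d|[b [[]|]]] //=; rewrite p3.
- by case=> [d|[[] [[]|]]] //=; apply: contra (pn d) => /eqP[->].
- case=> [d|[[] [[]|]]] //=.
  + case: (eqVneq d r) => [->//|n1]; case: (eqVneq d (al r)) => [->//|n2].
    by case: (eqVneq d e) => [->//|n3]; case: (eqVneq d (al e)) => [->//|n4] /=.
  + by rewrite ps.
  + by rewrite -{1}(ia e) ps.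
  + by rewrite -{1}(ia r) ps.
Qed.

(** The darts that follow [e] in the rotation starting from [r] stay at the new root vertex,
    together with [split_root] itself. *)
Lemma split_degree : order sg r <= order (split_phi \o split_al) split_root + i.
Proof.
set sg' := split_phi \o split_al.
have step d : d != r -> d != e -> fconnect sg' (inl d) (inl (sg d)).
  move=> dr de; have [->|dr'] := eqVneq d (al r).
    have E1 : sg' (inl (al r)) = inr (false, None) by rewrite /sg' /= (negbTE (na r)) eqxx.
    have E2 : sg' (inr (false, None)) = inl (sg (al r)) by rewrite /sg' /= ia.
    by rewrite -E2 -E1; apply: (connect_trans (fconnect1 sg' _)); exact: fconnect1.
  have [->|de'] := eqVneq d (al e).
    have E1 : sg' (inl (al e)) = inr (true, None).
      by rewrite /sg' /= (negbTE ale_r) (negbTE ale_alr) (negbTE (na e)) eqxx.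
    have E2 : sg' (inr (true, None)) = inl (sg (al e)) by rewrite /sg' /= ia.
    by rewrite -E2 -E1; apply: (connect_trans (fconnect1 sg' _)); exact: fconnect1.
  have E1 : sg' (inl d) = inl (sg d).
    by rewrite /sg' /= (negbTE dr) (negbTE dr') (negbTE de) (negbTE de').
  by rewrite -E1; exact: fconnect1.
have orb j : i < j < order sg r -> fconnect sg' split_root (inl (iter j sg r)).
  elim: j => // j IH /andP[]; rewrite ltnS leq_eqVlt => /orP[/eqP ij|ij] jN.
    apply: (connect_trans (y := inr (true, Some true))); first exact: (fconnect1 sg').
    have -> : inl (iter j.+1 sg r) = sg' (inr (true, Some true)) by rewrite -ij.
    exact: fconnect1.
  apply: connect_trans (IH _) _; first by rewrite ij ltnW.
  apply: step; apply/eqP => E.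
    have := @iter_inj j 0 (ltnW jN) (order_gt0 _ _) E => j0.
    by rewrite j0 in ij.
  by have := iter_inj (ltnW jN) i_lt E => j0; rewrite j0 ltnn in ij.
pose O := [set z : split_dart | fconnect sg' split_root z].
have OE : order sg' split_root = #|O| by apply: eq_card => z; rewrite !inE.
pose h (j : 'I_(order sg r - i)) : split_dart :=
  if val j == 0 then split_root else inl (iter (i + j) sg r).
have hi : injective h.
  move=> j k; rewrite /h; case: eqP => j0; case: eqP => k0 //.
    by move=> _; apply: val_inj; rewrite /= j0 k0.
  move=> [] /iter_inj E; apply: val_inj; apply/eqP; rewrite -(eqn_add2l i).
  have lt (l : 'I_(order sg r - i)) : i + l < order sg r by rewrite -ltn_subRL.
  by rewrite E.
rewrite OE addnC -leq_subLR -[X in X <= _]card_ord -(card_imset _ hi).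
apply/subset_leq_card/subsetP => _ /imsetP[j _ ->]; rewrite inE /h.
case: eqP => j0; first exact: connect0.
apply: orb; rewrite -ltn_subRL ltn_ord andbT -[X in X < _]addn0 ltn_add2l lt0n.
exact/eqP.
Qed.

(** An opened edge becomes two edges whose end spins are those of the original, so with [nu >= 1]
    the weight does not decrease. *)
Lemma split_mono : #|[set d | sp d == sp (al d)]| <=
  #|[set z | split_sp z == split_sp (split_al z)]|.
Proof.
have [_ _ _ ps] := ax; have spe : sp e = sp r.
  by rewrite /e; elim: (i) => //= j <-; exact: ps.
rewrite -(card_imset _ (@inl_inj D (bool * option bool))).
apply/subset_leq_card/subsetP => _ /imsetP[d + ->]; rewrite !inE /=.
case: (eqVneq d r) => [->//|n1]; case: (eqVneq d (al r)) => [->|n2]; first by rewrite /= ia.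
case: (eqVneq d e) => [->//|n3]; case: (eqVneq d (al e)) => [->|n4] //=.
by rewrite ia spe.
Qed.

End splitting.

Definition rooted_iso (D D' : finType) (phi al : D -> D) (sp : D -> bool) (r : D)
    (phi' al' : D' -> D') (sp' : D' -> bool) (r' : D') : Prop :=
  exists f : D -> D', [/\ bijective f, f r = r',
    forall d, f (phi d) = phi' (f d), forall d, f (al d) = al' (f d) &
    forall d, sp' (f d) = sp d].

(** From the new root the six new darts are reached by [split_phi] and [split_al] alone, so an
    isomorphism matches them. Closing them up restores both maps, and [i] is the rank of [e] in the
    rotation around the root. *)
Lemma split_injective (D D' : finType) (phi al : D -> D) sp r (i : nat)
    (phi' al' : D' -> D') sp' r' (i' : nat) :
  tri_map_axioms phi al sp -> tri_map_axioms phi' al' sp' ->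
  0 < i < order (phi \o al) r -> iter i (phi \o al) r != al r ->
  0 < i' < order (phi' \o al') r' -> iter i' (phi' \o al') r' != al' r' ->
  rooted_iso (@split_phi D phi) (split_al phi al r i) (split_sp phi al sp r i) (split_root D)
    (@split_phi D' phi') (split_al phi' al' r' i') (split_sp phi' al' sp' r' i') (split_root D') ->
  rooted_iso phi al sp r phi' al' sp' r' /\ i = i'.
Proof.
move=> ax ax' /andP[i0 iN] ne /andP[i0' iN'] ne' [f [bf fr fp fa fs]].
have [[[ip ia na _] _] _ _ _] := ax; have [[[ip' ia' na' _] _] _ _ _] := ax'.
have fnew n : f (inr n) = inr n.
  have f1 : f (inr (false, Some false)) = inr (false, Some false) := fr.
  have f2 : f (inr (false, Some true)) = inr (false, Some true).
    by have := fp (inr (false, Some false)); rewrite f1.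
  have f3 : f (inr (false, None)) = inr (false, None).
    by have := fp (inr (false, Some true)); rewrite f2.
  have g1 : f (inr (true, Some false)) = inr (true, Some false).
    by have := fa (inr (false, Some false)); rewrite f1.
  have g2 : f (inr (true, Some true)) = inr (true, Some true).
    by have := fp (inr (true, Some false)); rewrite g1.
  have g3 : f (inr (true, None)) = inr (true, None).
    by have := fp (inr (true, Some true)); rewrite g2.
  by case: n => [[] [[]|]].
have fi := bij_inj bf.
have old d : exists d', f (inl d) = inl d'.
  case E : (f (inl d)) => [d'|n]; first by exists d'.
  by move: E; rewrite -(fnew n) => /fi.
pose f0 d := if f (inl d) is inl d' then d' else r'.
have f0E d : f (inl d) = inl (f0 d) by rewrite /f0; have [d' ->] := old d.
have f0i : injective f0 by move=> d d' E; have /fi[] : f (inl d) = f (inl d') by rewrite !f0E E.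
have f0r : f0 r = r'.
  by have := fa (inr (false, None)); rewrite fnew /= f0E => -[].
have f0ar : f0 (al r) = al' r'.
  by have := fa (inr (false, Some true)); rewrite fnew /= f0E => -[].
pose e := iter i (phi \o al) r; pose e' := iter i' (phi' \o al') r'.
have f0e : f0 e = e'.
  by have := fa (inr (true, None)); rewrite fnew /= f0E => -[].
have f0ae : f0 (al e) = al' e'.
  by have := fa (inr (true, Some true)); rewrite fnew /= f0E => -[].
have f0p d : f0 (phi d) = phi' (f0 d).
  by have := fp (inl d); rewrite /= !f0E => -[].
have f0a d : f0 (al d) = al' (f0 d).
  case: (eqVneq d r) => [->|n1]; first by rewrite f0r.
  case: (eqVneq d (al r)) => [->|n2]; first by rewrite ia f0ar ia'.
  case: (eqVneq d e) => [->|n3]; first by rewrite f0e.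
  case: (eqVneq d (al e)) => [->|n4]; first by rewrite ia f0ae ia'.
  have := fa (inl d); rewrite f0E /= -/e -/e' (negbTE n1) (negbTE n2) (negbTE n3) (negbTE n4) f0E.
  rewrite -f0r (inj_eq f0i) (negbTE n1) f0r -f0ar (inj_eq f0i) (negbTE n2).
  rewrite -f0e (inj_eq f0i) (negbTE n3) f0e -f0ae (inj_eq f0i) (negbTE n4).
  by move=> [].
have f0s j : f0 (iter j (phi \o al) r) = iter j (phi' \o al') r'.
  by elim: j => //= j IH; rewrite f0p f0a IH.
have ii : i = i'.
  have := f0e; rewrite f0s => E; case: (ltngtP i i') => // lt.
    have lt1 := ltn_trans lt iN'.
    by have := findex_iter lt1; rewrite E (findex_iter iN').
  have lt1 := ltn_trans lt iN.
  have := findex_iter lt1; have := findex_iter iN.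
  have -> : iter i (phi \o al) r = iter i' (phi \o al) r by apply: f0i; rewrite !f0s E.
  by move=> -> //.
split => //; exists f0; split => //.
- have [g fg gf] := bf.
  have gold d : exists d', g (inl d) = inl d'.
    case E : (g (inl d)) => [d'|n]; first by exists d'.
    by have := gf (inl d); rewrite E fnew.
  exists (fun d => if g (inl d) is inl d' then d' else r) => d.
    by rewrite -f0E fg.
  by have [d' dE] := gold d; rewrite dE; have := gf (inl d); rewrite dE f0E => -[].
- by move=> d; have := fs (inl d); rewrite f0E.
Qed.

Import Order.TTheory Num.Theory.

(** * Weights at a given scale *)

Section crossings.
Variables (V : finType) (adj : rel V).
Hypotheses (sadj : symmetric adj) (sp : minor_sparse adj).
Variable d : nat.
Hypothesis hd : 2 ^ 9 * 15 ^ d <= 16 ^ d.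
Variables (J : {set V * V}) (P : V * V -> {set V}).
Hypothesis JP : forall j, j \in J -> [/\ j.1 != j.2, connected_in adj (P j) &
  j.1 \in P j /\ j.2 \in P j].

Definition conflicts : {set (V * V) * (V * V)} :=
  [set jj in setX J J | independent jj.1 jj.2 && [exists x in P jj.1, x \in P jj.2]].

(** Deleting one pair from each conflict inside [S] leaves a family to which [independent_sparse]
    applies. *)
Lemma sampled_crossings (S : {set V}) :
  #|[set j in J | (j.1 \in S) && (j.2 \in S)]| <= 2 * d * #|S| +
  #|[set jj in conflicts | [&& jj.1.1 \in S, jj.1.2 \in S, jj.2.1 \in S & jj.2.2 \in S]]|.
Proof.
set JS := [set j in J | _]; set XS := [set jj in conflicts | _].
pose K := [set jj.1 | jj in XS].
have KX : #|K| <= #|XS| by exact: leq_imset_card.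
have := @independent_sparse V adj sadj sp d hd S (JS :\: K) P _ _.
have h1 j : j \in JS :\: K -> [/\ j.1 \in S, j.2 \in S, j.1 != j.2,
    connected_in adj (P j) & j.1 \in P j /\ j.2 \in P j].
  by rewrite !inE => /and4P[_ /JP[? ? ?] -> ->].
have h2 j j' : j \in JS :\: K -> j' \in JS :\: K -> independent j j' ->
    forall x, x \in P j -> x \in P j' -> False.
  rewrite !inE => /and4P[jK jJ j1 j2] /and4P[_ jJ' j1' j2'] jj x xj xj'.
  case/negP: jK; apply/imsetP; exists (j, j') => //.
  rewrite !inE /= jJ jJ' jj j1 j2 j1' j2' /= !andbT.
  by apply/existsP; exists x; rewrite xj.
move=> /(_ h1 h2) h3.
rewrite -(cardsID K JS) addnC leq_add//; apply: leq_trans KX.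
by apply: subset_leq_card; rewrite subsetIr.
Qed.

(** Amplification as in the crossing lemma: [sampled_crossings] is averaged over a random [S] of
    density [1 / t]. A vertex survives with probability [t ^- 1], a pair with [t ^- 2], and a
    conflict, whose four ends are distinct, with [t ^- 4]. *)
Lemma crossing_inequality t : 0 < t ->
  t ^ 2 * #|J| <= 2 * d * t ^ 3 * #|V| + #|conflicts|.
Proof.
case: t => // t _; set T := t.+1.
have avg (G : {set V}) k : #|G| = k ->
    #|[set f : {ffun V -> 'I_T} | [forall y in G, f y == ord0]]| * T ^ k = T ^ #|V|.
  by move=> <-; rewrite count_zero_colored -expnD subnK// max_card.
pose Sf (f : {ffun V -> 'I_T}) := [set x | f x == ord0].
have avgJ : (\sum_f #|[set j in J | (j.1 \in Sf f) && (j.2 \in Sf f)]|) * T ^ 2 =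
    #|J| * T ^ #|V|.
  under eq_bigr do rewrite -sum1_card big_mkcond /=.
  rewrite exchange_big /= -sum_nat_const [RHS]big_mkcond big_distrl /=.
  apply: eq_bigr => j _; case: (boolP (j \in J)) => jJ; last first.
    by rewrite big1 ?mul0n// => f _; rewrite inE (negbTE jJ).
  have [jn _ _] := JP jJ; rewrite -(avg [set j.1; j.2] 2) ?cards2 ?jn//; congr (_ * _).
  rewrite -sum1_card [RHS]big_mkcond; apply: eq_bigr => f _; rewrite !inE jJ /=.
  congr (if _ then _ else _); apply/andP/forall_inP => [[h1 h2] y|h].
    by rewrite !inE => /orP[]/eqP->.
  by split; apply: h; rewrite !inE eqxx ?orbT.
have avgS : (\sum_f #|Sf f|) * T = #|V| * T ^ #|V|.
  under eq_bigr do rewrite -sum1_card big_mkcond /=.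
  rewrite exchange_big /= -sum_nat_const big_distrl /=.
  apply: eq_bigr => x _; rewrite -(avg [set x] 1) ?cards1// expn1; congr (_ * _).
  rewrite -sum1_card [RHS]big_mkcond; apply: eq_bigr => f _; rewrite !inE.
  congr (if _ then _ else _); apply/idP/forall_inP => [h1 y|h].
    by rewrite !inE => /eqP->.
  by apply: h; rewrite !inE eqxx.
have avgQ (Cf : {set (V * V) * (V * V)}) : (forall jj, jj \in Cf ->
    #|jj.1.1 |: (jj.1.2 |: (jj.2.1 |: [set jj.2.2]))| = 4) ->
    (\sum_f #|[set jj in Cf | [&& jj.1.1 \in Sf f, jj.1.2 \in Sf f,
    jj.2.1 \in Sf f & jj.2.2 \in Sf f]]|) * T ^ 4 = #|Cf| * T ^ #|V|.
  move=> c4; under eq_bigr do rewrite -sum1_card big_mkcond /=.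
  rewrite exchange_big /= -sum_nat_const [RHS]big_mkcond big_distrl /=.
  apply: eq_bigr => jj _; case: (boolP (jj \in Cf)) => jJ; last first.
    by rewrite big1 ?mul0n// => f _; rewrite inE (negbTE jJ).
  rewrite -(avg _ 4 (c4 _ jJ)).
  congr (_ * _); rewrite -sum1_card [RHS]big_mkcond; apply: eq_bigr => f _.
  rewrite !inE jJ /=; congr (if _ then _ else _).
  apply/and4P/forall_inP => [[h1 h2 h3 h4] y|h].
    by rewrite !inE => /or4P[]/eqP->.
  by split; apply: h; rewrite !inE eqxx ?orbT.
have /avgQ avgX jj : jj \in conflicts ->
    #|jj.1.1 |: (jj.1.2 |: (jj.2.1 |: [set jj.2.2]))| = 4.
  rewrite !inE => /andP[/andP[j1 j2] /andP[/and4P[n1 n2 n3 n4] _]].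
  have [m1 _ _] := JP j1; have [m2 _ _] := JP j2.
  rewrite !cardsU1 !inE cards1 !negb_or.
  by rewrite m1 m2 n1 n2 n3 n4.
have : \sum_f #|[set j in J | (j.1 \in Sf f) && (j.2 \in Sf f)]| <=
  \sum_f (2 * d * #|Sf f| + #|[set jj in conflicts | [&& jj.1.1 \in Sf f,
    jj.1.2 \in Sf f, jj.2.1 \in Sf f & jj.2.2 \in Sf f]]|).
  by apply: leq_sum => f _; exact: sampled_crossings.
rewrite big_split -big_distrr /=.
move: avgJ avgS avgX.
have T0 : 0 < T ^ #|V| by rewrite expn_gt0.
move: (\sum_f _) (\sum_f _) (\sum_f _) (T ^ #|V|) T0 => a b c u u0 h1 h2 h3 h4.
rewrite -(leq_pmul2r u0).
have := leq_mul h4 (leqnn (T ^ 4)).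
rewrite mulnDl h3 (_ : c * T ^ 4 = c * T ^ 2 * T ^ 2); last by rewrite -mulnA -expnD.
rewrite h1 (_ : 2 * d * b * T ^ 4 = 2 * d * (b * T) * T ^ 3); last by ring.
rewrite h2 mulnDl; move: (#|J|) (#|V|) (#|conflicts|) => x y z.
rewrite (_ : x * u * T ^ 2 = T ^ 2 * x * u); last by ring.
by rewrite (_ : 2 * d * (y * u) * T ^ 3 = 2 * d * T ^ 3 * y * u); last by ring.
Qed.

End crossings.

Local Open Scope ring_scope.

(** * Greedy routing of close pairs *)

Section routing.
Variables (R : realFieldType) (V : finType) (adj : rel V).
Variables (eta lam : R).
Hypotheses (lam0 : 0 < lam) (lam_eta : lam <= eta) (eta1 : eta <= 1).

Implicit Types (J : {set V * V}) (P : V * V -> {set V}).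

Definition load (J : {set V * V}) (P : V * V -> {set V}) (v : V) : nat :=
  #|[set j in J | v \in P j]|.

Definition route_weight J P v : R := eta + lam * (load J P v)%:R.

Definition routed J P : Prop :=
  [/\ forall j, j \in J -> [/\ j.1 != j.2, connected_in adj (P j) &
        j.1 \in P j /\ j.2 \in P j],
      \sum_v route_weight J P v ^+ 2 <= #|V|%:R * eta ^+ 2 + 3 * lam * #|J|%:R &
      forall v, route_weight J P v <= 2].

Let eta0 : 0 < eta. Proof. exact: lt_le_trans lam_eta. Qed.

(** Routing one more pair along a set [S] of weight below one raises the sum of squares by
    [2 * lam * w(S) + lam ^ 2 * #|S|], which is at most [3 * lam] because [eta * #|S| <= w(S) < 1]
    and [lam <= eta]. *)
Lemma route_extend J P x y (S : {set V}) : routed J P -> x != y -> (x, y) \notin J ->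
  connected_in adj S -> x \in S -> y \in S -> \sum_(v in S) route_weight J P v < 1 ->
  exists P', routed ((x, y) |: J) P'.
Proof.
move=> [h1 h2 h3] xy nJ cS xS yS wS.
pose P' j := if j == (x, y) then S else P j; exists P'.
have PP j : j \in J -> P' j = P j.
  by rewrite /P'; case: eqP => // ->; rewrite (negbTE nJ).
have wE v : route_weight ((x, y) |: J) P' v = route_weight J P v + lam * (v \in S)%:R.
  rewrite /route_weight -addrA -mulrDr -natrD; congr (_ + _ * _%:R).
  rewrite /load (cardsD1 (x, y)) addnC; congr (_ + _)%N; last first.
    by rewrite !inE eqxx /P' eqxx.
  apply: eq_card => j; rewrite !inE; case: (eqVneq j (x, y)) => [->|nj] /=.
    by rewrite (negbTE nJ).
  by rewrite /P' (negbTE nj).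
have w0 v : 0 <= route_weight J P v.
  by rewrite /route_weight addr_ge0 ?mulr_ge0// ltW.
have wpos v : eta <= route_weight J P v.
  by rewrite /route_weight lerDl mulr_ge0// ltW.
split.
- move=> j; rewrite !inE => /orP[/eqP->|jJ]; last by rewrite PP//; exact: h1.
  by rewrite /P' eqxx.
- rewrite cardsU1 nJ /= natrD mulrDr mulr1.
  have -> : \sum_v route_weight ((x, y) |: J) P' v ^+ 2 =
      \sum_v route_weight J P v ^+ 2 + 2 * lam * (\sum_(v in S) route_weight J P v) +
      lam ^+ 2 * #|S|%:R.
    rewrite -sum1_card natr_sum !mulr_sumr [X in _ + X + _]big_mkcond.
    rewrite [X in _ + X]big_mkcond -!big_split /=; apply: eq_bigr => v _.
    by rewrite wE; case: (v \in S); rewrite ?mulr1 ?mulr0 ?addr0//; ring.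
  have S1 : eta * #|S|%:R <= 1.
    apply: le_trans (ltW wS); rewrite -sum1_card natr_sum mulr_sumr.
    by apply: ler_sum => v _; rewrite mulr1.
  have S2 : lam ^+ 2 * #|S|%:R <= lam.
    have : lam * #|S|%:R <= 1 by apply: le_trans S1; rewrite ler_wpM2r.
    by move=> h; rewrite expr2 -mulrA ger_pMr.
  have S3 : 2 * lam * (\sum_(v in S) route_weight J P v) <= 2 * lam.
    by rewrite ger_pMr ?mulr_gt0// ltW.
  by lra.
- move=> v; rewrite wE; case: (boolP (v \in S)) => vS; last by rewrite mulr0 addr0.
  have : route_weight J P v < 1.
    by apply: le_lt_trans wS; rewrite (bigD1 v)//= lerDl sumr_ge0.
  by have := lam_eta; have := eta1; rewrite mulr1; lra.
Qed.

(** Greedy procedure: as long as a pair outside [J] is at distance less than one for the current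
    weight, route it. It stops because there are finitely many pairs. *)
Lemma routing_exists : exists J P, routed J P /\
  forall x y, x != y -> (x, y) \notin J -> forall S, connected_in adj S ->
    x \in S -> y \in S -> 1 <= \sum_(v in S) route_weight J P v.
Proof.
suff h n : forall J P, routed J P -> (#|{: V * V}| - #|J| <= n)%N ->
    exists J P, routed J P /\ forall x y, x != y -> (x, y) \notin J ->
    forall S, connected_in adj S -> x \in S -> y \in S ->
      1 <= \sum_(v in S) route_weight J P v.
  apply: (h _ set0 (fun=> set0)) (leqnn _).
  have wE v : route_weight set0 (fun=> set0) v = eta.
    rewrite /route_weight /load (_ : [set _ in _ | _] = set0) ?cards0 ?mulr0 ?addr0//.
    by apply/setP => j; rewrite !inE.
  split => [j||v]; first by rewrite inE.
    under eq_bigr do rewrite wE.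
    by rewrite sumr_const cards0 mulr0 addr0 mulr_natl.
  by rewrite wE; have := eta1; lra.
elim: n => [|n IH] J P rJ nJ.
  exists J, P; split => // x y _ xyJ; exfalso; move: nJ.
  rewrite leqn0 subn_eq0 leqNgt; apply/negP; rewrite negbK.
  by rewrite -cardsT; apply: proper_card; apply/properP; split; [exact: subsetT|exists (x, y)].
have [ext|ext] := EM (exists x y S, [/\ x != y, (x, y) \notin J, connected_in adj S,
    x \in S /\ y \in S & \sum_(v in S) route_weight J P v < 1]).
  have [x [y [S [xy xyJ cS [xS yS] wS]]]] := ext.
  have [P' rP'] := route_extend rJ xy xyJ cS xS yS wS.
  apply: (IH _ _ rP'); rewrite cardsU1 xyJ.
  by move: nJ; move: #|_| #|_| => a b; lia.
exists J, P; split => // x y xy xyJ S cS xS yS; rewrite leNgt; apply/negP => wS.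
by apply: ext; exists x, y, S.
Qed.

End routing.

Section scale_weight.
Variables (R : realFieldType) (V : finType) (adj : rel V).
Hypotheses (sadj : symmetric adj) (sp : minor_sparse adj).
Variable d : nat.
Hypothesis hd : (2 ^ 9 * 15 ^ d <= 16 ^ d)%N.
Variables (delta Lam s : R).
Hypotheses (delta0 : 0 < delta) (delta1 : delta <= 1) (s1 : 1 <= s).
Hypothesis LamE : Lam = 512 * d%:R ^+ 2 / delta ^+ 2 + 1 / delta.
Hypothesis s_Lam : Lam <= s ^+ 3.
Hypothesis s_d : 4 * d%:R <= delta * s ^+ 2.

(* [close w x y]: the [w]-distance of [x] and [y] is less than one. *)
Definition close (w : V -> R) (x y : V) : Prop :=
  exists S, [/\ connected_in adj S, x \in S, y \in S & \sum_(v in S) w v < 1].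

Lemma load_conflicts (J : {set V * V}) (P : V * V -> {set V}) :
  (#|conflicts J P| <= \sum_v load J P v ^ 2)%N.
Proof.
apply: (@leq_trans (\sum_v #|[set jj in setX J J | (v \in P jj.1) && (v \in P jj.2)]|)).
  rewrite -sum1_card; apply: (@leq_trans
    (\sum_(jj in conflicts J P) \sum_v ((v \in P jj.1) && (v \in P jj.2)))).
    apply: leq_sum => jj; rewrite !inE => /and3P[_ _ /existsP[x /andP[x1 x2]]].
    by rewrite (bigD1 x)//= x1 x2.
  rewrite exchange_big /=; apply: leq_sum => v _.
  rewrite -sum1_card big_mkcond [X in (_ <= X)%N]big_mkcond /=; apply: leq_sum => jj _.
  case: ifP => // jc; rewrite inE; move: jc; rewrite inE => /andP[-> _].
  by case: (_ && _).
apply: leq_sum => v _; rewrite /load -mulnn -cardsX; apply: subset_leq_card.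
by apply/subsetP => -[j j']; rewrite !inE /= => /andP[/andP[-> ->] /andP[-> ->]].
Qed.

(** If too many pairs were routed, [crossing_inequality] would force about [#|J| ^ 3 / #|V| ^ 2]
    conflicts, whereas conflicts are bounded by the sum of the squared loads, which the control of
    the weights limits to order [#|J| / lam]. *)
Lemma scale_weight : exists w : V -> R,
  [/\ forall v, 0 < w v <= 2,
      \sum_v w v ^+ 2 <= (1 + 3 * Lam * delta) * #|V|%:R / s ^+ 2 &
      exists2 B : {set V * V}, #|B|%:R <= delta * s ^+ 2 * #|V|%:R &
        forall x y, x != y -> close w x y -> (x, y) \in B].
Proof.
have s0 : 0 < s by exact: lt_le_trans s1.
have d0 : 0 <= d%:R :> R by [].
have Lam0 : 0 < Lam.
  by rewrite LamE ltr_wpDl ?divr_gt0// divr_ge0 ?mulr_ge0 ?exprn_ge0// ltW.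
(* [eta] makes the initial sum of squares [#|V| / s ^ 2]. In [Lam], the term [1 / delta] lets
   [lam * K] absorb [N / M], and [512 = 4 * 128] is the constant that the crossing inequality then
   produces. *)
pose eta := s^-1; pose lam := Lam / s ^+ 4.
have lam0 : 0 < lam by rewrite divr_gt0 ?exprn_gt0.
have eta1 : eta <= 1 by rewrite invf_le1.
have lam_eta : lam <= eta.
  rewrite /lam /eta ler_pdivrMr ?exprn_gt0// (_ : s^-1 * s ^+ 4 = s ^+ 3)//.
  by rewrite exprS mulKf// gt_eqF.
have [J [P [[h1 h2 h3] h4]]] := @routing_exists R V adj eta lam lam0 lam_eta eta1.
set w := route_weight eta lam J P in h2 h3 h4.
have wl v : lam * (load J P v)%:R <= w v by rewrite /w /route_weight lerDr ltW// invr_gt0.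
have w0 v : 0 < w v.
  rewrite /w /route_weight ltr_wpDr ?invr_gt0// mulr_ge0// ltW//.
pose N : R := #|V|%:R; pose K : R := #|J|%:R; pose M := s ^+ 2.
have M0 : 0 < M by rewrite exprn_gt0.
have N0 : 0 <= N by [].
have lamE : lam = Lam / M ^+ 2 by rewrite /lam /M -exprM.
have etaE : eta ^+ 2 = M^-1 by rewrite /eta exprVn.
have KM : K <= delta * M * N.
  rewrite leNgt; apply/negP => big.
  have Kpos : 0 < K by apply: le_lt_trans big; rewrite !mulr_ge0// ltW.
  have N1 : 0 < N.
    rewrite lt0r N0 andbT; apply/eqP => N_0.
    have : (#|V| = 0)%N by apply/eqP; rewrite -(eqr_nat R) -/N N_0.
    move=> /card0_eq V0; move: Kpos; rewrite /K ltr0n => /card_gt0P[[x y] _].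
    by have := V0 x; rewrite inE.
  have X : lam ^+ 2 * #|conflicts J P|%:R <= N / M + 3 * lam * K.
    apply: (@le_trans _ _ (\sum_v w v ^+ 2)); last by rewrite -etaE.
    have : #|conflicts J P|%:R <= \sum_v (load J P v)%:R ^+ 2 :> R.
      by under eq_bigr do rewrite -natrX; rewrite -natr_sum ler_nat; exact: load_conflicts.
    move=> /(ler_wpM2l (sqr_ge0 lam))/le_trans; apply.
    rewrite mulr_sumr; apply: ler_sum => v _; rewrite -exprMn lerXn2r// ?nnegrE//.
      by rewrite mulr_ge0// ltW.
    by rewrite ltW.
  (* optimise the sampling rate: [t] is about [K / (4 d N)] *)
  have dpos : 0 < d%:R :> R.
    rewrite ltr0n lt0n; apply/eqP => dz; move: hd; by rewrite dz.
  pose t := (#|J| %/ (4 * d * #|V|))%N.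
  have dV : (0 < 4 * d * #|V|)%N.
    have d0n : (0 < d)%N by rewrite -(ltr0n R).
    have V0n : (0 < #|V|)%N by rewrite -(ltr0n R).
    by rewrite !muln_gt0 d0n V0n.
  have tle : t%:R * (4 * d%:R * N) <= K.
    by rewrite -!natrM /K ler_nat /t leq_divM.
  have tgt : K < (t%:R + 1) * (4 * d%:R * N).
    by rewrite -[1]/(1%:R) -natrD -!natrM /K ltr_nat addn1 /t ltn_ceil.
  have t1 : 1 <= t%:R :> R.
    rewrite ler1n lt0n; apply/eqP => t0; move: tgt; rewrite t0 add0r mul1r => tgt.
    have : 4 * d%:R * N <= delta * M * N by rewrite ler_wpM2r//; exact: s_d.
    by lra.
  have := crossing_inequality sadj sp hd h1 (t := t).
  rewrite -(ltr0n R) (lt_le_trans ltr01 t1) => /(_ isT).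
  rewrite -(ler_nat R) natrD !(natrX, natrM) -/K -/N => cr.
  have Xlow : K ^+ 3 <= 128 * d%:R ^+ 2 * N ^+ 2 * #|conflicts J P|%:R.
    set X' := #|conflicts J P|%:R in cr *.
    have tN : K <= t%:R * (8 * d%:R * N).
      have : 0 <= (t%:R - 1) * (4 * d%:R * N) by rewrite mulr_ge0 ?mulr_ge0// subr_ge0.
      by lra.
    have c1 : 2 * d%:R * t%:R ^+ 3 * N <= t%:R ^+ 2 * K / 2.
      have := ler_wpM2l (sqr_ge0 t%:R) tle; lra.
    have c2 : t%:R ^+ 2 * K <= 2 * X' by lra.
    have c3 : K ^+ 2 <= (t%:R * (8 * d%:R * N)) ^+ 2 by rewrite lerXn2r ?nnegrE ?(ltW Kpos)// ?mulr_ge0.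
    have c4 : K ^+ 3 <= (t%:R * (8 * d%:R * N)) ^+ 2 * K by rewrite exprSr ler_wpM2r// ltW.
    apply: (le_trans c4).
    have := ler_wpM2l (_ : 0 <= 64 * d%:R ^+ 2 * N ^+ 2) c2.
    rewrite !mulr_ge0 ?exprn_ge0// => /(_ isT); lra.
  have c5 : lam ^+ 2 * K ^+ 3 <= 128 * d%:R ^+ 2 * N ^+ 2 * (N / M + 3 * lam * K).
    have := ler_wpM2l (sqr_ge0 lam) Xlow => /le_trans; apply.
    have := ler_wpM2l (_ : 0 <= 128 * d%:R ^+ 2 * N ^+ 2) X.
    rewrite !mulr_ge0 ?exprn_ge0// => /(_ isT); lra.
  have c6 : N / M <= lam * K.
    rewrite ler_pdivrMr// lamE.
    have -> : Lam / M ^+ 2 * K * M = Lam * K / M by field; rewrite gt_eqF.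
    rewrite ler_pdivlMr//.
    have : N * M <= K / delta by rewrite ler_pdivlMr//; lra.
    move=> /le_trans; apply; rewrite mulrC ler_wpM2r ?(ltW Kpos)//.
    by rewrite LamE mul1r lerDr divr_ge0 ?mulr_ge0 ?exprn_ge0// ltW.
  have c7 : lam ^+ 2 * K ^+ 3 <= 512 * d%:R ^+ 2 * N ^+ 2 * (lam * K).
    apply: (le_trans c5).
    have : N / M + 3 * lam * K <= 4 * (lam * K) by lra.
    move=> /(ler_wpM2l (_ : 0 <= 128 * d%:R ^+ 2 * N ^+ 2)).
    rewrite !mulr_ge0 ?exprn_ge0// => /(_ isT); lra.
  have c8 : lam * K ^+ 2 <= 512 * d%:R ^+ 2 * N ^+ 2.
    have lK : 0 < lam * K by rewrite mulr_gt0.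
    by rewrite -(ler_pM2r lK); lra.
  have c9 : Lam * K ^+ 2 <= 512 * d%:R ^+ 2 * N ^+ 2 * M ^+ 2.
    by move: c8; rewrite lamE mulrAC ler_pdivrMr ?exprn_gt0.
  have c10 : (delta * M * N) ^+ 2 < K ^+ 2.
    by rewrite ltrXn2r// ?nnegrE ?(ltW Kpos)// !mulr_ge0// ltW.
  have c11 : 512 * d%:R ^+ 2 < Lam * delta ^+ 2.
    have -> : Lam * delta ^+ 2 = 512 * d%:R ^+ 2 + delta.
      by rewrite LamE; field; rewrite gt_eqF.
    by rewrite ltrDl.
  have c12 : 0 < N ^+ 2 * M ^+ 2 by rewrite mulr_gt0 ?exprn_gt0.
  have c13 := ltr_pM2l Lam0 ((delta * M * N) ^+ 2) (K ^+ 2).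
  move: c10; rewrite -c13 => c14.
  move: c11; rewrite -(ltr_pM2r c12) => c15.
  by move: c9 c14 c15; rewrite !exprMn; lra.
exists w; split.
- by move=> v; rewrite w0 h3.
- rewrite -/N -/M; apply: (le_trans h2); rewrite -/N -/K etaE.
  have : 3 * lam * K <= 3 * lam * (delta * M * N) by rewrite ler_wpM2l// mulr_ge0// ltW.
  rewrite lamE.
  have -> : 3 * (Lam / M ^+ 2) * (delta * M * N) = 3 * Lam * delta * N / M.
    by field; rewrite gt_eqF.
  by rewrite -mulrA; lra.
- exists J => // x y xy [S [cS xS yS wS]]; apply: contraT => nJ.
  by have := h4 _ _ xy nJ S cS xS yS; rewrite leNgt wS.
Qed.

End scale_weight.

Local Open Scope ring_scope.

(** * Test functions built from all scales *)

Section weighted_distance.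
Variables (R : realFieldType) (V : finType) (adj : rel V).
Implicit Types (w : V -> R) (S : {set V}).

(* Distance with weights on the vertices, both ends included, truncated at 1. *)
Definition wdist w (v x : V) : R :=
  \big[Num.min/1]_(S : {set V} | [&& `[< connected_in adj S >], v \in S & x \in S])
    \sum_(y in S) w y.

Lemma wdist_le1 w v x : wdist w v x <= 1.
Proof. exact: bigmin_le_id. Qed.

Lemma wdist_le w v x S : connected_in adj S -> v \in S -> x \in S ->
  wdist w v x <= \sum_(y in S) w y.
Proof.
move=> cS vS xS; rewrite /wdist.
by apply: bigmin_le_cond; rewrite vS xS !andbT; apply/asboolP.
Qed.

Lemma wdist_attained w v x : wdist w v x < 1 -> exists S,
  [/\ connected_in adj S, v \in S, x \in S & \sum_(y in S) w y = wdist w v x].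
Proof.
move=> h; have : wdist w v x = 1 \/ exists S,
  [/\ connected_in adj S, v \in S, x \in S & \sum_(y in S) w y = wdist w v x].
  rewrite /wdist; apply: (big_ind (fun z => z = 1 \/ exists S,
    [/\ connected_in adj S, v \in S, x \in S & \sum_(y in S) w y = z])) => [|a b ha hb|S]; first by left.
    by rewrite minElt; case: ifP.
  by move=> /and3P[/asboolP cS vS xS]; right; exists S.
by case=> // E; move: h; rewrite E ltxx.
Qed.

Lemma wdist_self w v : wdist w v v <= w v.
Proof.
have := @wdist_le w v v [set v] (@connected_in1 _ adj v); rewrite !inE eqxx => /(_ isT isT).
by rewrite big_set1.
Qed.

Lemma sum_setU_le w (A B : {set V}) : (forall v, 0 <= w v) ->
  \sum_(y in A :|: B) w y <= \sum_(y in A) w y + \sum_(y in B) w y.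
Proof.
move=> w0; rewrite [X in X <= _]big_mkcond [X in _ <= X + _]big_mkcond.
rewrite [X in _ <= _ + X]big_mkcond /= -big_split /=; apply: ler_sum => y _; rewrite !inE.
by case: (y \in A); case: (y \in B); rewrite ?addr0 ?add0r// lerDl.
Qed.

Lemma wdist_triangle w v x y : (forall v, 0 <= w v) ->
  wdist w x y <= wdist w v x + wdist w v y.
Proof.
move=> w0.
have d0 a b : 0 <= wdist w a b.
  by apply: (big_ind (fun z => 0 <= z)) => // [p q p0 q0|S _]; rewrite ?le_min ?p0// sumr_ge0.
have [x1|] := ltP (wdist w v x) 1; last first.
  by move=> h; apply: le_trans (wdist_le1 _ _ _) _; have := d0 v y; lra.
have [y1|] := ltP (wdist w v y) 1; last first.
  by move=> h; apply: le_trans (wdist_le1 _ _ _) _; have := d0 v x; lra.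
have [S [cS vS xS <-]] := wdist_attained x1; have [T [cT vT yT <-]] := wdist_attained y1.
apply: le_trans (sum_setU_le S T w0).
by apply: wdist_le; rewrite ?inE ?xS ?yT ?orbT//; exact: connected_inU vS vT cS cT.
Qed.

Lemma wdist_step w v x y : (forall v, 0 <= w v) -> adj x y ->
  wdist w v y <= wdist w v x + w y.
Proof.
move=> w0 xy; have [x1|] := ltP (wdist w v x) 1; last first.
  by move=> h; apply: le_trans (wdist_le1 _ _ _) _; have := w0 y; lra.
have [S [cS vS xS <-]] := wdist_attained x1.
have cSy : connected_in adj (S :|: [set y]).
  move=> X hX; suff h z : z \in S :|: [set y] -> X z = X x by move=> a b /h-> /h->.
  have hS z' : z' \in S -> X z' = X x.
    move=> z'S; apply: (cS X) => // a b aS bS ab.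
    by apply: hX; rewrite ?inE ?aS ?bS.
  rewrite !inE => /orP[/hS//|/eqP->]; apply/esym/hX => //; rewrite !inE ?xS ?eqxx ?orbT//.
have vSy : v \in S :|: [set y] by rewrite inE vS.
have ySy : y \in S :|: [set y] by rewrite !inE eqxx orbT.
apply: le_trans (wdist_le w cSy vSy ySy) _.
by apply: le_trans (sum_setU_le _ _ w0) _; rewrite big_set1.
Qed.

(** Vanishes up to distance 1/4 and equals one from 1/2 on. Stopping at 1/2 leaves room for a
    triangle inequality inside unit balls in [good_scale_count]. *)
Definition cutoff w v x : R := Num.min 1 (Num.max 0 (4 * wdist w v x - 1)).

Lemma cutoff_lip w v x y : adj x y -> adj y x -> (forall v, 0 <= w v) ->
  `|cutoff w v x - cutoff w v y| <= 4 * (w x + w y).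
Proof.
move=> xy yx w0; have := wdist_step v w0 xy; have := wdist_step v w0 yx.
have := w0 x; have := w0 y; rewrite /cutoff.
move: (wdist w v x) (wdist w v y) (w x) (w y) => a b p q h1 h2 h3 h4.
have clampE (z : R) : Num.min 1 (Num.max 0 z) =
    if z <= 0 then 0 else if 1 <= z then 1 else z.
  have [z0|z0] := leP z 0; first by apply/min_idPr.
  by have [//|z1] := leP 1 z.
rewrite !clampE; case: (leP (4 * a - 1) 0); case: (leP 1 (4 * a - 1));
  case: (leP (4 * b - 1) 0); case: (leP 1 (4 * b - 1)) => *;
  by rewrite ler_norml; apply/andP; split; lra.
Qed.

Lemma cutoff1 w v x : 1 / 2 <= wdist w v x -> cutoff w v x = 1.
Proof.
move=> h; rewrite /cutoff; apply/min_idPl; rewrite le_max; apply/orP; right; lra.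
Qed.

Lemma cutoff0 w v : w v <= 1 / 4 -> cutoff w v v = 0.
Proof.
move=> h; have h2 := wdist_self w v; rewrite /cutoff.
have -> : Num.max 0 (4 * wdist w v v - 1) = 0 by apply/max_idPl; lra.
by apply/min_idPr.
Qed.

End weighted_distance.

Section almost_orthogonality.
Variable R : realFieldType.

Lemma sqr_sum_le (x : nat -> R) K : (forall k, 0 <= x k) ->
  (\sum_(k < K) x k) ^+ 2 <= 2 * \sum_(k < K) x k * \sum_(k <= l < K) x l.
Proof.
move=> x0; elim: K => [|K IH]; first by rewrite !big_ord0 expr2 !mulr0.
rewrite !big_ord_recr /= big_nat1.
have -> : \sum_(i < K) x i * \sum_(i <= l < K.+1) x l =
    \sum_(i < K) x i * \sum_(i <= l < K) x l + (\sum_(i < K) x i) * x K.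
  rewrite mulr_suml -big_split /=; apply: eq_bigr => i _.
  by rewrite big_nat_recr /= ?mulrDr// ltnW.
have := x0 K; have : 0 <= \sum_(i < K) x i by rewrite sumr_ge0.
move: (\sum_(i < K) x i) IH => S IH S0 xK.
by have := sqr_ge0 (x K); rewrite sqrrD mulr2n; lra.
Qed.

Lemma geometric_half k K : \sum_(k <= l < K) (2^-1 : R) ^+ (l - k) <= 2.
Proof.
have [kK|Kk] := leqP k K; last by rewrite big_geq// ltnW.
suff -> : \sum_(k <= l < K) (2^-1 : R) ^+ (l - k) = 2 - 2 * 2^-1 ^+ (K - k).
  by rewrite lerBlDr lerDl mulr_ge0// exprn_ge0// invr_ge0.
rewrite -{1}(subnKC kK); elim: (K - k)%N => [|n IH].
  by rewrite addn0 big_geq// expr0; lra.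
rewrite addnS big_nat_recr /= ?leq_addr// IH addKn exprS; lra.
Qed.

(* Decay of the gradients from one scale to the next makes the cross terms summable. *)
Lemma sqr_sum_geometric (a x y : nat -> R) K :
  (forall k, 0 <= a k) -> (forall k l, (k <= l)%N -> a l <= a k) ->
  (forall k, 0 <= x k) -> (forall k, x k <= y k) ->
  (forall k l, (k <= l < K)%N -> y l <= 2^-1 ^+ (l - k) * y k) ->
  (\sum_(k < K) a k * x k) ^+ 2 <= 4 * \sum_(k < K) a k ^+ 2 * (x k * y k).
Proof.
move=> a0 am x0 xy yy.
have y0 k : 0 <= y k by exact: le_trans (xy k).
have ax0 k : 0 <= a k * x k by rewrite mulr_ge0.
apply: le_trans (sqr_sum_le K ax0) _.
rewrite (_ : 4 = 2 * 2); last by ring.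
rewrite -mulrA ler_wpM2l// mulr_sumr; apply: ler_sum => k _.
have -> : 2 * (a k ^+ 2 * (x k * y k)) = a k * x k * (a k * y k * 2) by ring.
rewrite ler_wpM2l//.
apply: (@le_trans _ _ (\sum_(k <= l < K) a k * y k * 2^-1 ^+ (l - k))).
  rewrite big_seq [leRHS]big_seq; apply: ler_sum => l; rewrite mem_index_iota => kl.
  rewrite -mulrA [y k * _]mulrC ler_pM//.
    by rewrite am//; case/andP: kl.
  by apply: le_trans (xy l) _; exact: yy.
by rewrite -mulr_sumr ler_wpM2l ?mulr_ge0// geometric_half.
Qed.

End almost_orthogonality.

(** * Superposition of the cut-off functions *)

Section multiscale.
Variables (R : realFieldType) (D : finType) (phi al : D -> D).
Notation vtx := (froot (phi \o al)).
Notation adj := (dart_adj phi al).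
Variables (K : nat) (M : nat -> nat) (w : nat -> D -> R) (B : nat -> {set D * D}).
Variables (delta : R) (a : nat -> R).
Hypothesis pl : planar phi al.
Hypothesis w_pos : forall k v, 0 < w k v <= 2.
Hypothesis close_B : forall k x y, x != y -> close adj (w k) x y -> (x, y) \in B k.
Hypothesis M_pos : forall k, (0 < M k)%N.
Hypothesis B_card : forall k, #|B k|%:R <= delta * (M k)%:R * #|D|%:R :> R.
Hypothesis a_pos : forall k, 0 <= a k.
Hypothesis a_mono : forall k l, (k <= l)%N -> a l <= a k.

Let ia : involutive al. Proof. by case: pl => [[]]. Qed.

Let N : R := #|D|%:R.
(** Adding the weights of coarser scales with factors [2 ^ i] forces a decay by one half from each
    scale to the next, as [sqr_sum_geometric] requires. The factors [2 * 8 ^ i] of [wsum_sqr] are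
    affordable because square sums will decay like [64 ^- i]. *)
Definition wsum k v : R := \sum_(i < K - k) 2 ^+ i * w (k + i) v.

Let w0 k v : 0 <= w k v. Proof. by have /andP[/ltW] := w_pos k v. Qed.

Lemma wsum_ge0 k v : 0 <= wsum k v.
Proof. by rewrite sumr_ge0// => i _; rewrite mulr_ge0// exprn_ge0. Qed.

Lemma wsum_ge k v : (k < K)%N -> w k v <= wsum k v.
Proof.
move=> kK; rewrite /wsum; have : (0 < K - k)%N by rewrite subn_gt0.
case: (K - k)%N => // n _; rewrite big_ord_recl expr0 mul1r addn0 lerDl sumr_ge0// => i _.
by rewrite mulr_ge0// exprn_ge0.
Qed.

Lemma wsum_decay k l v : (k <= l < K)%N -> wsum l v <= 2^-1 ^+ (l - k) * wsum k v.
Proof.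
move=> /andP[kl lK].
have e0 : 0 < 2 ^+ (l - k) :> R by rewrite exprn_gt0.
rewrite exprVn ler_pdivlMl// /wsum (_ : (K - k = (l - k) + (K - l))%N); last first.
  by rewrite addnC addnBA// subnK// ltnW.
rewrite big_split_ord /= mulr_sumr ler_wpDl//.
  by rewrite sumr_ge0// => i _; rewrite mulr_ge0// exprn_ge0.
by apply: ler_sum => i _; rewrite mulrA -exprD addnA subnKC.
Qed.

Lemma wsum_sqr k v : wsum k v ^+ 2 <= \sum_(i < K - k) 2 * 8 ^+ i * w (k + i) v ^+ 2.
Proof.
rewrite /wsum; move: (K - k)%N => n; elim: n k => [|n IH] k; first by rewrite !big_ord0 expr2 mulr0.
rewrite !big_ord_recl /= !expr0 mul1r mulr1 addn0.
have := IH k.+1.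
set S := \sum_(i < n) _; set S' := \sum_(i < n) _ => h.
rewrite (_ : \sum_(i < n) _ = 2 * S); last first.
  rewrite mulr_sumr; apply: eq_bigr => i _.
  by rewrite /bump /= add1n exprS addnS addSn mulrA.
rewrite (_ : \sum_(i < n) _ = 8 * S'); last first.
  rewrite mulr_sumr; apply: eq_bigr => i _.
  by rewrite /bump /= add1n exprS addnS addSn; ring.
have := sqr_ge0 (w k v - 2 * S); rewrite sqrrB sqrrD exprMn mulr2n; lra.
Qed.

Let wd k := wdist adj (wsum k).
Definition wball k v : {set D} := [set y | wd k v y < 1].
Definition good_scale k v : bool := (#|wball k v| <= (M k).+1)%N && (wsum k v <= 1 / 4).

(** All such [v] lie in the unit ball of any one of them, which has at most [M k + 1] points since
    the scale is good for it. *)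
Lemma good_scale_count k x : (k < K)%N ->
  (#|[set v | good_scale k v & (wd k v x < 1 / 2)%R]| <= (M k).+1)%N.
Proof.
move=> kK; set A := [set v | _].
have [->|[v0 v0A]] := set_0Vmem A; first by rewrite cards0.
have := v0A; rewrite inE => /andP[/andP[h1 _] h2]; apply: leq_trans h1.
apply: subset_leq_card; apply/subsetP => v; rewrite !inE => /andP[_ h3].
have sym y z : wd k y z = wd k z y.
  by apply: eq_bigl => S; congr (_ && _); rewrite andbC.
have := @wdist_triangle R D adj (wsum k) x v0 v (wsum_ge0 k); rewrite -!/(wd _ _ _) ![wd k x _]sym.
lra.
Qed.

(** Large balls are counted through [B k]: as [w k <= wsum k], points close for [wsum k] are close
    for [w k]. Large values of [wsum k v] are counted by Chebyshev's inequality. *)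
Lemma bad_scale_count k : (k < K)%N ->
  #|[set v | ~~ good_scale k v]|%:R <= delta * N + 16 * \sum_v wsum k v ^+ 2.
Proof.
move=> kK.
have sub : [set v | ~~ good_scale k v] \subset
    [set v | (M k < #|wball k v :\ v|)%N] :|: [set v | 1 / 4 < wsum k v].
  apply/subsetP => v; rewrite !inE negb_and -ltNge -ltnNge => /orP[h|->]; last by rewrite orbT.
  apply/orP; left; move: h; rewrite (cardsD1 v); case: (_ \in _); rewrite ?add1n ?add0n//.
  exact: ltnW.
have /(leq_trans (subset_leq_card sub)) : (#|[set v | (M k < #|wball k v :\ v|)%N] :|:
    [set v | (1 / 4 < wsum k v)%R]| <= #|[set v | (M k < #|wball k v :\ v|)%N]| +
    #|[set v | (1 / 4 < wsum k v)%R]|)%N by rewrite cardsU leq_subr.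
rewrite -(ler_nat R) natrD => /le_trans; apply; apply: lerD.
- have Mk : 0 < (M k)%:R :> R by rewrite ltr0n.
  rewrite -(ler_pM2l Mk); apply: (@le_trans _ _ (#|B k|%:R)); last first.
    by rewrite mulrCA mulrA; exact: B_card.
  rewrite -natrM ler_nat.
  apply: (@leq_trans (\sum_v #|wball k v :\ v|)).
    rewrite mulnC -sum_nat_const [X in (X <= _)%N]big_mkcond; apply: leq_sum => v _.
    by rewrite inE; case: ifP => // /ltnW.
  apply: (@leq_trans (\sum_v #|[set y | (v, y) \in B k]|)).
    apply: leq_sum => v _; apply: subset_leq_card; apply/subsetP => y; rewrite !inE.
    move=> /andP[yv h]; apply: close_B; first by rewrite eq_sym.
    have [S [cS vS yS sS]] := wdist_attained h; exists S; split => //.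
    apply: le_lt_trans h; rewrite -[leRHS]sS; apply: ler_sum => z _; exact: wsum_ge.
  rewrite -sum1_card (eq_bigr (fun v => \sum_(y | (v, y) \in B k) 1)%N); last first.
    by move=> v _; rewrite -sum1_card; apply: eq_bigl => y; rewrite inE.
  rewrite pair_big_dep /=; apply: eq_leq; apply: eq_bigl => -[x y] //=.
- rewrite -sum1_card natr_sum big_mkcond mulr_sumr; apply: ler_sum => v _; rewrite inE.
  have := sqr_ge0 (wsum k v); case: ifP => h h2; last by lra.
  have : (1 / 4) ^+ 2 <= wsum k v ^+ 2 by rewrite lerXn2r ?nnegrE ?wsum_ge0 ?ltW//; lra.
  by rewrite expr2; lra.
Qed.

(** Zero at [v], and far from [v] equal to the sum of the coefficients of the good scales; divided
    by that sum and subtracted from one, it is the function asked for in [flat_vertex]. *)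
Definition potential v x : R :=
  \sum_(k < K) (if good_scale k v then a k else 0) * cutoff adj (wsum k) v x.

Definition energy (f : D -> R) : R := \sum_d (f (vtx d) - f (vtx (al d))) ^+ 2.

Let adj_dart d : adj (vtx d) (vtx (al d)).
Proof. by apply/existsP; exists d; rewrite !eqxx. Qed.
Let adj_dart' d : adj (vtx (al d)) (vtx d).
Proof. by apply/existsP; exists (al d); rewrite ia !eqxx. Qed.

Lemma energy_potential v : energy (potential v) <=
  64 * \sum_(k < K) \sum_d (if good_scale k v &&
      ((wd k v (vtx d) < 1 / 2) || (wd k v (vtx (al d)) < 1 / 2)) then
    a k ^+ 2 * (wsum k (vtx d) + wsum k (vtx (al d))) ^+ 2 else 0).
Proof.
rewrite exchange_big mulr_sumr; apply: ler_sum => d _.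
pose x k := if good_scale k v &&
  ((wd k v (vtx d) < 1 / 2) || (wd k v (vtx (al d)) < 1 / 2)) then
    4 * (wsum k (vtx d) + wsum k (vtx (al d))) else 0.
pose y k := 4 * (wsum k (vtx d) + wsum k (vtx (al d))).
have y0 k : 0 <= y k by rewrite mulr_ge0// addr_ge0// wsum_ge0.
have x0 k : 0 <= x k by rewrite /x; case: ifP => // _; exact: y0.
have le1 : `|potential v (vtx d) - potential v (vtx (al d))| <= \sum_(k < K) a k * x k.
  rewrite /potential -sumrB; apply: le_trans (ler_norm_sum _ _ _) _.
  apply: ler_sum => k _; rewrite -mulrBr normrM.
  rewrite /x; case: ifP => gk; rewrite ?normr0 ?mul0r//=; last by rewrite mulr0.
  rewrite (ger0_norm (a_pos k)); apply: ler_wpM2l => //; case: ifP => h.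
    apply: cutoff_lip; [exact: adj_dart|exact: adj_dart'|exact: wsum_ge0].
  move: h => /negbT; rewrite negb_or -!leNgt => /andP[h1 h2].
  by rewrite !cutoff1// subrr normr0.
have : (potential v (vtx d) - potential v (vtx (al d))) ^+ 2 <= (\sum_(k < K) a k * x k) ^+ 2.
  by rewrite -real_normK ?num_real// lerXn2r ?nnegrE// sumr_ge0// => k _; rewrite mulr_ge0.
move=> /le_trans; apply.
apply: le_trans (@sqr_sum_geometric R a x y K a_pos a_mono x0 _ _) _.
- by move=> k; rewrite /x /y; case: ifP => // _; exact: y0.
- move=> k l kl; rewrite /y; have := wsum_decay (vtx d) kl; have := wsum_decay (vtx (al d)) kl.
  move: (wsum l _) (wsum l _) (wsum k _) (wsum k _) (2^-1 ^+ _) => p q r s t.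
  by rewrite mulrCA mulrDr; lra.
- rewrite !mulr_sumr; apply: ler_sum => k _; rewrite /x /y; case: ifP => _.
    by rewrite le_eqVlt; apply/orP; left; apply/eqP; ring.
  by rewrite mul0r !mulr0.
Qed.

(** The sum over [v] is taken first: a dart contributes at scale [k] only for the good [v] within
    1/2 of one of its ends, at most [2 * (M k + 1)] of them. Square sums of order [#|D| / M k] will
    compensate this factor. *)
Lemma sum_energy : \sum_v energy (potential v) <=
  1024 * \sum_(k < K) a k ^+ 2 * (M k)%:R * \sum_d wsum k (vtx d) ^+ 2.
Proof.
apply: (@le_trans _ _ (64 * \sum_(k < K) \sum_d a k ^+ 2 *
    (wsum k (vtx d) + wsum k (vtx (al d))) ^+ 2 * (2 * (M k).+1%:R))).
  apply: le_trans (ler_sum _ (fun v _ => energy_potential v)) _.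
  rewrite -mulr_sumr ler_wpM2l// exchange_big /=; apply: ler_sum => k _.
  rewrite exchange_big /=; apply: ler_sum => d _.
  set c := a k ^+ 2 * _; have c0 : 0 <= c by rewrite mulr_ge0// sqr_ge0.
  rewrite -big_mkcond /= sumr_const -[c *+ _]mulr_natr ler_wpM2l// -natrM ler_nat.
  rewrite mul2n -addnn; apply: leq_trans (leq_add (good_scale_count (vtx d) (ltn_ord k))
    (good_scale_count (vtx (al d)) (ltn_ord k))).
  rewrite -cardsUI; apply: leq_trans (leq_addr _ _); apply: subset_leq_card.
  by apply/subsetP => v; rewrite !inE unfold_in /= => /andP[-> /orP[]->]; rewrite ?orbT.
rewrite (_ : 1024 = 64 * 16); last by ring.
rewrite -mulrA ler_wpM2l// mulr_sumr; apply: ler_sum => k _.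
have M1 : (M k).+1%:R <= 2 * (M k)%:R :> R.
  by rewrite -natrM ler_nat mul2n -addnn -addn1 leq_add2l M_pos.
have -> : \sum_d wsum k (vtx d) ^+ 2 =
   2^-1 * \sum_d (wsum k (vtx d) ^+ 2 + wsum k (vtx (al d)) ^+ 2).
  rewrite big_split /= -(reindex_inj (inv_inj ia) (P := xpredT)
    (F := fun d => wsum k (vtx d) ^+ 2)) /=; lra.
rewrite !mulr_sumr; apply: ler_sum => d _.
have : (wsum k (vtx d) + wsum k (vtx (al d))) ^+ 2 <=
    2 * (wsum k (vtx d) ^+ 2 + wsum k (vtx (al d)) ^+ 2).
  have := sqr_ge0 (wsum k (vtx d) - wsum k (vtx (al d))).
  by rewrite sqrrB sqrrD; lra.
set p := _ ^+ 2; set q := _ + _ => pq.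
have p0 : 0 <= p by exact: sqr_ge0.
apply: (@le_trans _ _ (a k ^+ 2 * (2 * q) * (2 * (2 * (M k)%:R)))).
  have e1 : a k ^+ 2 * p <= a k ^+ 2 * (2 * q) by rewrite ler_wpM2l// sqr_ge0.
  have e2 : 2 * (M k).+1%:R <= 2 * (2 * (M k)%:R) :> R by rewrite ler_wpM2l.
  by apply: ler_pM e1 e2 => //; rewrite mulr_ge0// sqr_ge0.
by rewrite le_eqVlt; apply/orP; left; apply/eqP; field.
Qed.

Definition flat_vertex (r : nat) (eps : R) (v : D) : Prop :=
  exists g : D -> R, [/\ g v = 1, energy g <= eps &
    forall x, g x != 0 -> exists S : {set D},
      [/\ connected_in adj S, v \in S, x \in S & (#|S| <= r)%N]].

(** If the bad scales carry less than half of the coefficients and the energy is below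
    [eps * s ^ 2 / 4], the normalised potential is a witness of flatness. Both failures are counted
    by Markov's inequality. *)
Lemma flat_count (eps : R) (r : nat) : 0 < eps -> 0 < \sum_(k < K) a k ->
  (forall k, (k < K)%N -> ((M k).+1 <= r)%N) ->
  #|[set v | ~~ `[< flat_vertex r eps v >]]|%:R <=
    2 / (\sum_(k < K) a k) * (\sum_(k < K) a k * (delta * N + 16 * \sum_v wsum k v ^+ 2)) +
    4 / (eps * (\sum_(k < K) a k) ^+ 2) *
      (1024 * \sum_(k < K) a k ^+ 2 * (M k)%:R * \sum_d wsum k (vtx d) ^+ 2).
Proof.
move=> e0; set s := \sum_(k < K) a k => s0 Mr.
pose bad v := \sum_(k < K) (if good_scale k v then 0 else a k).
pose en v := energy (potential v).
have en0 v : 0 <= en v by rewrite sumr_ge0// => d _; exact: sqr_ge0.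
have bad0 v : 0 <= bad v by rewrite sumr_ge0// => k _; case: ifP.
have key v : ~~ `[< flat_vertex r eps v >] ->
    1 <= 2 / s * bad v + 4 / (eps * s ^+ 2) * en v.
  apply: contraNT; rewrite -ltNge => h; apply/asboolP.
  have t0 : 0 <= 4 / (eps * s ^+ 2) * en v.
    by rewrite mulr_ge0// divr_ge0// mulr_ge0 ?ltW ?exprn_gt0.
  have u0 : 0 <= 2 / s * bad v by rewrite mulr_ge0// divr_ge0// ltW.
  have hb : bad v < s / 2.
    have : 2 / s * bad v < 1 by lra.
    by rewrite mulrAC ltr_pdivrMr// mul1r; lra.
  have he : en v < eps * s ^+ 2 / 4.
    have : 4 / (eps * s ^+ 2) * en v < 1 by lra.
    by rewrite mulrAC ltr_pdivrMr ?mulr_gt0 ?exprn_gt0// mul1r; lra.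
  pose sg := \sum_(k < K) (if good_scale k v then a k else 0).
  have sgE : sg + bad v = s.
    by rewrite -big_split /=; apply: eq_bigr => k _; case: ifP; rewrite ?addr0 ?add0r.
  have sg2 : s / 2 < sg by lra.
  have sg0 : 0 < sg by lra.
  exists (fun x => 1 - potential v x / sg); split.
  - rewrite /potential big1 ?mul0r ?subr0// => k _; case: ifP => gk; last by rewrite mul0r.
    by rewrite cutoff0 ?mulr0//; case/andP: gk.
  - have -> : energy (fun x => 1 - potential v x / sg) = en v / sg ^+ 2.
      rewrite /en /energy mulr_suml; apply: eq_bigr => d _.
      by rewrite -exprVn -exprMn -[RHS]sqrrN; congr (_ ^+ 2); ring.
    rewrite ler_pdivrMr ?exprn_gt0//; apply: le_trans (ltW he) _.
    rewrite -mulrA ler_wpM2l ?(ltW e0)//.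
    have : (s / 2) ^+ 2 <= sg ^+ 2 by rewrite lerXn2r ?nnegrE ?ltW// divr_gt0.
    by rewrite expr_div_n; lra.
  - move=> x gx.
    have [/existsP[k /andP[gk kx]]|] := boolP [exists k : 'I_K, good_scale k v && (wd k v x < 1 / 2)].
      have kx1 : wd k v x < 1 by lra.
      have [S [cS vS xS sS]] := wdist_attained kx1; exists S; split => //.
      apply: leq_trans (Mr _ (ltn_ord k)); case/andP: gk => + _; apply: leq_trans.
      apply: subset_leq_card; apply/subsetP => y yS; rewrite inE.
      by apply: le_lt_trans (wdist_le _ cS vS yS) _; rewrite sS.
    rewrite negb_exists => /forallP nk; case/negP: gx; apply/eqP.
    rewrite (_ : potential v x = sg) ?divff ?subrr ?gt_eqF//.
    apply: eq_bigr => k _; have := nk k; case: ifP => gk; last by rewrite mul0r.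
    by rewrite -leNgt => h2; rewrite cutoff1 ?mulr1.
apply: (@le_trans _ _ (\sum_v (2 / s * bad v + 4 / (eps * s ^+ 2) * en v))).
  rewrite -sum1_card natr_sum big_mkcond; apply: ler_sum => v _; rewrite inE.
  case: ifP => [/key//|_]; rewrite addr_ge0// mulr_ge0// divr_ge0// ?ltW//.
  by rewrite mulr_gt0// exprn_gt0.
rewrite big_split /= -!mulr_sumr; apply: lerD; apply: ler_wpM2l.
- by rewrite divr_ge0// ltW.
- rewrite /bad exchange_big /=; apply: ler_sum => k _.
  apply: le_trans (ler_wpM2l (a_pos k) (bad_scale_count (ltn_ord k))).
  rewrite -sum1_card natr_sum mulr_sumr [X in _ <= X]big_mkcond /=; apply: ler_sum => v _.
  by rewrite inE; case: ifP => /=; rewrite ?mulr0 ?mulr1.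
- by rewrite divr_ge0// mulr_ge0 ?ltW ?exprn_gt0.
- exact: sum_energy.
Qed.

End multiscale.

(** * Choice of the scales, and averages over darts *)

Section mean_flatness.
Variable R : realType.

Lemma sum_vertex_le (D : finType) (sg : D -> D) (F : D -> R) (K : nat) : injective sg ->
  (forall v, 0 <= F v) ->
  \sum_(e | (order sg e <= K)%N) F (froot sg e) <= K%:R * \sum_v F v.
Proof.
move=> si F0; rewrite (partition_big (froot sg) xpredT)//= mulr_sumr.
apply: ler_sum => v _; rewrite (eq_bigr (fun=> F v)); last by move=> e /andP[_ /eqP->].
rewrite sumr_const -[F v *+ _]mulr_natl ler_wpM2r// ler_nat.
case: (pickP [pred e | (order sg e <= K)%N && (froot sg e == v)]) => [e0|h]; last first.
  by rewrite eq_card0.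
move=> /= /andP[o /eqP ve]; apply: leq_trans o; rewrite /order; apply: subset_leq_card.
by apply/subsetP => e /andP[_ /eqP h2]; rewrite inE -froot_eq// ve h2.
Qed.

Lemma geometric_quarter n : \sum_(i < n) 2 * (1 / 4) ^+ i <= 3 :> R.
Proof.
suff -> : \sum_(i < n) 2 * (1 / 4 : R) ^+ i = 8 / 3 - 8 / 3 * (1 / 4) ^+ n.
  have h : 0 <= (1 / 4 : R) ^+ n by apply: exprn_ge0; lra.
  lra.
elim: n => [|n IH]; first by rewrite big_ord0 expr0; lra.
by rewrite big_ord_recr /= IH exprS; lra.
Qed.

Lemma harmonic_unbounded (k0 : nat) (x : R) :
  exists T, x <= \sum_(k < T) (k + k0 + 1)%:R^-1.
Proof.
suff h n : exists T, n%:R / 2 <= \sum_(k < T) (k + k0 + 1)%:R^-1 :> R.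
  have [T hT] := h (Num.bound (2 * `|x|)); exists T; apply: le_trans hT.
  have := archi_boundP (mulr_ge0 (ler0n R 2) (normr_ge0 x)); have := ler_norm x; lra.
elim: n => [|n [T IH]]; first by exists 0%N; rewrite big_ord0 mul0r.
exists (T + (T + k0 + 1))%N; rewrite big_split_ord /= -natr1 mulrDl lerD//.
have p0 : 0 < (T + k0 + 1)%:R :> R by rewrite ltr0n addn1.
apply: (@le_trans _ _ (\sum_(i < T + k0 + 1) (2 * (T + k0 + 1)%:R : R)^-1)).
  by rewrite sumr_const card_ord -[X in _ <= X]mulr_natr invfM divfK ?mul1r// gt_eqF.
apply: ler_sum => i _; rewrite lef_pV2 ?posrE ?mulr_gt0//; last by rewrite ltr0n addn1.
by rewrite -natrM ler_nat; have := ltn_ord i; lia.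
Qed.

Section scales.
Variables (Kd d k0 T : nat) (delta eps Lam : R) (a : nat -> R).
Hypotheses (del0 : 0 < delta) (eps0 : 0 < eps) (hd : (2 ^ 9 * 15 ^ d <= 16 ^ d)%N).
Hypothesis LamE : Lam = 512 * d%:R ^+ 2 / delta ^+ 2 + 1 / delta.
Hypothesis scale_Lam : forall k, Lam <= 8 ^+ (k + k0).
Hypothesis scale_d : forall k, 4 * d%:R / delta <= 8 ^+ (k + k0).
Hypotheses (ap : forall k, 0 < a k) (a_mono : forall k l, (k <= l)%N -> a l <= a k).
Let S := \sum_(k < T) a k.
Hypothesis S0 : 0 < S.
Let M k : R := 64 ^+ (k + k0).
Let A := 1 + 3 * Lam * delta.
Let Q := (eps * S ^+ 2)^-1.
Definition scale_coef k i := 4096 * Q * a k ^+ 2 * M k * (2 * 8 ^+ i).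
Let Xk k i := A * Kd%:R * (k + i + k0)%:R / M (k + i)%N.

Definition flat_c0 : R := 2 / S * (\sum_(k < T) a k * (delta + 48 * A / M k)) +
  \sum_(k < T) \sum_(i < T - k) scale_coef k i * Xk k i.

(** At scale [k + i], darts of degree at most [Kd * (k + i + k0)] turn a square sum over darts into
    one over vertices at the cost of that factor. For the others only [w <= 2] is used, and their
    number is left in the bound. *)
Lemma multiscale_bound (D : finType) (phi al : D -> D) : planar phi al ->
  #|[set v | ~~ `[< flat_vertex phi al (64 ^ (T + k0)).+1 eps v >]]|%:R <=
  flat_c0 * #|D|%:R + \sum_(k < T) \sum_(i < T - k) 4 * scale_coef k i *
    #|[set d | (Kd * (k + i + k0) < order (phi \o al) d)%N]|%:R.
Proof.
have Lam0 : 0 < Lam by rewrite LamE ltr_wpDl ?divr_gt0// divr_ge0 ?mulr_ge0 ?exprn_ge0// ltW.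
have A0 : 0 < A by rewrite ltr_pwDl// !mulr_ge0// ltW.
have M0 k : 0 < M k by rewrite exprn_gt0.
have MD k i : M (k + i)%N = M k * 64 ^+ i by rewrite /M addnAC exprD.
have Q0 : 0 < Q by rewrite invr_gt0 mulr_gt0 ?exprn_gt0.
move=> pl; have [[ip ia na _] _] := pl.
have sgi : injective (phi \o al) by apply: inj_comp => //; exact: inv_inj.
pose N : R := #|D|%:R.
have /choice[wB hwB] k : exists wB : (D -> R) * {set D * D},
   [/\ forall v, 0 < wB.1 v <= 2, \sum_v wB.1 v ^+ 2 <= A * N / M k,
       #|wB.2|%:R <= delta * M k * N &
       forall x y, x != y -> close (dart_adj phi al) wB.1 x y -> (x, y) \in wB.2].
  have s1 : 1 <= 8 ^+ (k + k0) :> R by rewrite exprn_ege1//; lra.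
  have sM : (8 ^+ (k + k0)) ^+ 2 = M k.
    by rewrite /M -exprM mulnC exprM; congr (_ ^+ _); rewrite expr2; lra.
  have [||w [w1 w2 [B B1 B2]]] := @scale_weight R D (dart_adj phi al) (dart_adj_sym phi ia)
    (planar_minor_sparse pl) d hd delta Lam (8 ^+ (k + k0)) del0 s1 LamE.
  - apply: (@le_trans _ _ (8 ^+ (k + k0))); last by rewrite ler_eXnr.
    exact: scale_Lam.
  - rewrite [delta * _]mulrC -ler_pdivrMr//; apply: (@le_trans _ _ (8 ^+ (k + k0))).
      exact: scale_d.
    by rewrite ler_eXnr.
  by exists (w, B); split => //=; rewrite -sM.
pose w k := (wB k).1; pose B k := (wB k).2.
have w_pos k v : 0 < w k v <= 2 by have [h _ _ _] := hwB k; exact: h.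
have w_sq k : \sum_v w k v ^+ 2 <= A * N / M k by have [] := hwB k.
have Mn k : (64 ^ (k + k0))%:R = M k :> R by rewrite natrX.
have := @flat_count R D phi al T (fun k => 64 ^ (k + k0))%N w B delta a pl w_pos.
move=> /(_ _ _ _ _ _ eps (64 ^ (T + k0)).+1 eps0 S0) fc.
apply: (le_trans (fc _ _ _ _ _ _)) => {fc}.
+ by move=> k x y xy cl; have [_ _ _] := hwB k; exact.
+ by move=> k; rewrite expn_gt0.
+ by move=> k; rewrite Mn; have [] := hwB k.
+ by move=> k; exact: ltW.
+ exact: a_mono.
+ by move=> k kT; rewrite ltnS leq_exp2l// leq_add2r ltnW.
rewrite -/S -/N [flat_c0 * N]mulrDl -addrA; apply: lerD.
  rewrite -[leRHS]mulrA mulr_suml ler_pM2l ?divr_gt0//; apply: ler_sum => k _.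
  rewrite -[leRHS]mulrA ler_pM2l// [leRHS]mulrDl lerD2l.
  apply: (@le_trans _ _ (16 * (A * N / M k * 3))); last by lra.
  rewrite ler_pM2l//; apply: (@le_trans _ _ (A * N / M k * \sum_(i < T - k) 2 * (1 / 4) ^+ i)).
    apply: (@le_trans _ _ (\sum_v \sum_(i < T - k) 2 * 8 ^+ i * w (k + i)%N v ^+ 2)).
      by apply: ler_sum => v _; exact: wsum_sqr.
    rewrite exchange_big mulr_sumr /=; apply: ler_sum => i _; rewrite -mulr_sumr.
    apply: (@le_trans _ _ (2 * 8 ^+ i * (A * N / M (k + i)%N))).
      by rewrite ler_pM2l ?mulr_gt0 ?exprn_gt0.
    rewrite MD invfM.
    have e1 : (8 : R) ^+ i * (64 ^+ i)^-1 <= (1 / 4) ^+ i.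
      by rewrite -exprVn -exprMn lerXn2r ?nnegrE//; lra.
    have n0 : 0 <= 2 * (A * N / M k) by rewrite !mulr_ge0 ?invr_ge0// ltW.
    have := ler_wpM2l n0 e1.
    move: (8 ^+ i) ((64 ^+ i)^-1) ((1 / 4) ^+ i) ((M k)^-1) => p q t m'; lra.
  by rewrite ler_wpM2l ?geometric_quarter// !mulr_ge0 ?invr_ge0// ltW.
have H2 k : \sum_d wsum T w k (froot (phi \o al) d) ^+ 2 <= \sum_(i < T - k)
    2 * 8 ^+ i * (Xk k i * N +
      4 * #|[set d | (Kd * (k + i + k0) < order (phi \o al) d)%N]|%:R).
  apply: (@le_trans _ _ (\sum_d \sum_(i < T - k) 2 * 8 ^+ i *
      w (k + i)%N (froot (phi \o al) d) ^+ 2)).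
    by apply: ler_sum => v _; exact: wsum_sqr.
  rewrite exchange_big /=; apply: ler_sum => i _; rewrite -mulr_sumr.
  rewrite ler_pM2l ?mulr_gt0 ?exprn_gt0//.
  rewrite (bigID (fun e => order (phi \o al) e <= Kd * (k + i + k0))%N) /=; apply: lerD.
    apply: (le_trans (@sum_vertex_le D (phi \o al) (fun v => w (k + i)%N v ^+ 2) _ sgi _)).
      by move=> v; exact: sqr_ge0.
    apply: (@le_trans _ _ ((Kd * (k + i + k0))%:R * (A * N / M (k + i)%N))).
      by rewrite ler_wpM2l.
    by rewrite /Xk natrM; lra.
  apply: (@le_trans _ _ (\sum_(e | ~~ (order (phi \o al) e <= Kd * (k + i + k0))%N) 4)).
    apply: ler_sum => e _; have /andP[h1 h2] := w_pos (k + i)%N (froot (phi \o al) e).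
    by rewrite (_ : 4 = 2 ^+ 2 :> R) ?lerXn2r ?nnegrE ?(ltW h1)//; rewrite expr2; lra.
  rewrite sumr_const -[4 *+ _]mulr_natr ler_pM2l// ler_nat; apply: subset_leq_card.
  by apply/subsetP => e he; rewrite inE ltnNge; exact: he.
rewrite mulr_suml -big_split /=.
have -> : 4 / (eps * S ^+ 2) * (1024 * \sum_(k < T) a k ^+ 2 * (64 ^ (k + k0))%:R *
    \sum_d wsum T w k (froot (phi \o al) d) ^+ 2) =
    \sum_(k < T) 4096 * Q * a k ^+ 2 * M k * \sum_d wsum T w k (froot (phi \o al) d) ^+ 2.
  rewrite mulrA mulr_sumr; apply: eq_bigr => k _; rewrite Mn /Q.
  move: (M k) (\sum_d _) ((eps * S ^+ 2)^-1) => m x q; ring.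
apply: ler_sum => k _; rewrite mulr_suml -big_split /=.
apply: (@le_trans _ _ (4096 * Q * a k ^+ 2 * M k * \sum_(i < T - k)
    2 * 8 ^+ i * (Xk k i * N +
      4 * #|[set d | (Kd * (k + i + k0) < order (phi \o al) d)%N]|%:R))).
  by rewrite ler_wpM2l// !mulr_ge0 ?exprn_ge0// ltW.
rewrite mulr_sumr; apply: ler_sum => i _; rewrite /scale_coef.
by move: (Xk k i) (M k) (8 ^+ i) (#|_|%:R) => *; lra.
Qed.

End scales.

(* On average at most a proportion [64 ^- j] of the darts has degree more than
   [Kd * j]: averaging the last sum turns it into the one bounded by [5 * delta]. *)
Lemma bad_vertex_bound (Kd : nat) (delta eps : R) : 0 < delta -> delta <= 1 -> 0 < eps ->
  exists (r : nat) (c0 : R) (s : seq (nat * R)),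
  [/\ all (fun p => 0 <= p.2) s, c0 + \sum_(p <- s) p.2 / 64 ^+ p.1 <= 5 * delta &
   forall (D : finType) (phi al : D -> D), planar phi al ->
    #|[set v | ~~ `[< flat_vertex phi al r eps v >]]|%:R <=
    c0 * #|D|%:R + \sum_(p <- s) p.2 * #|[set d | (Kd * p.1 < order (phi \o al) d)%N]|%:R].
Proof.
move=> del0 del1 eps0; have [d hd] := dense_constant.
pose Lam : R := 512 * d%:R ^+ 2 / delta ^+ 2 + 1 / delta.
have Lam0 : 0 < Lam by rewrite ltr_wpDl ?divr_gt0// divr_ge0 ?mulr_ge0 ?exprn_ge0// ltW.
pose A := 1 + 3 * Lam * delta.
have A0 : 0 < A by rewrite ltr_pwDl// !mulr_ge0// ltW.
pose X := Lam + 4 * d%:R / delta + 48 * A / delta.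
have X1 : 0 <= 4 * d%:R / delta by rewrite divr_ge0 ?mulr_ge0// ltW.
have X2 : 0 <= 48 * A / delta by rewrite divr_ge0 ?mulr_ge0// ltW.
(* [k0] skips the first scales, so that the conditions on [8 ^+ (k + k0)] hold from [k = 0] on and
   [48 * A / M k] is at most [delta]. *)
have [k0 hk0] : exists k0, X <= 2 ^+ k0.
  by exists (Num.bound X); exact: ltW (upper_nthrootP _).
have XB b k : 2 <= b -> X <= b ^+ (k + k0).
  move=> b2; apply: (le_trans hk0); apply: (@le_trans _ _ (b ^+ k0)).
    by rewrite lerXn2r ?nnegrE//; lra.
  by rewrite ler_weXn2l ?leq_addl//; lra.
pose M k : R := 64 ^+ (k + k0); have M0 k : 0 < M k by rewrite exprn_gt0.
have MD k i : M (k + i)%N = M k * 64 ^+ i by rewrite /M addnAC exprD.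
pose a k : R := (k + k0 + 1)%:R^-1.
pose A' := A * Kd%:R + 4.
have A'0 : 0 < A' by rewrite ltr_wpDl// mulr_ge0// ltW.
(* The energy terms will add up to at most [12288 * A' / (eps * S)], where [12288 = 3 * 4096]; this
   choice makes them at most [delta]. *)
have [T hT] := harmonic_unbounded k0 (12288 * A' / (eps * delta)).
pose S := \sum_(k < T) a k.
have S0 : 0 < S by apply: lt_le_trans hT; rewrite divr_gt0 ?mulr_gt0.
have ap k : 0 < a k by rewrite invr_gt0 ltr0n addn1.
pose Q := (eps * S ^+ 2)^-1.
have Q0 : 0 < Q by rewrite invr_gt0 mulr_gt0 ?exprn_gt0.
pose C := scale_coef k0 T eps a.
have CE k i : C k i = 4096 * Q * a k ^+ 2 * M k * (2 * 8 ^+ i) by [].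
have C0 k i : 0 <= C k i by rewrite CE !mulr_ge0 ?exprn_ge0// ltW.
pose Xk k i := A * Kd%:R * (k + i + k0)%:R / M (k + i)%N.
pose c1 := 2 / S * \sum_(k < T) a k * (delta + 48 * A / M k).
pose c0 := flat_c0 Kd k0 T delta eps Lam a.
have c0E : c0 = c1 + \sum_(k < T) \sum_(i < T - k) C k i * Xk k i by [].
pose s := [seq ((k + i + k0)%N, 4 * C k i) | k <- iota 0 T, i <- iota 0 (T - k)].
have sE (f : nat * R -> R) : \sum_(p <- s) f p =
    \sum_(k < T) \sum_(i < T - k) f ((k + i + k0)%N, 4 * C k i).
  rewrite /s big_allpairs_dep -[RHS](big_mkord xpredT
    (fun k => \sum_(i < T - k) f ((k + i + k0)%N, 4 * C k i))) /index_iota subn0.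
  apply: eq_bigr => k _; rewrite -[RHS](big_mkord xpredT
    (fun i => f ((k + i + k0)%N, 4 * C k i))) /index_iota subn0//.
exists (64 ^ (T + k0)).+1%N, c0, s; split.
- by apply/allP => _ /allpairsPdep[k [i [_ _ ->]]] /=; rewrite mulr_ge0.
- rewrite sE c0E -addrA -big_split /=.
  have h1 : c1 <= 4 * delta.
    apply: (@le_trans _ _ (2 / S * \sum_(k < T) a k * (2 * delta))).
      rewrite ler_pM2l ?divr_gt0//; apply: ler_sum => k _; rewrite ler_pM2l//.
      suff : 48 * A / M k <= delta by lra.
      have XM : X <= M k by apply: XB; rewrite ler_nat.
      have : 48 * A / delta <= M k by move: XM; rewrite /X; lra.
      by rewrite !ler_pdivrMr// [M k * _]mulrC.
    by rewrite -mulr_suml -/S; rewrite [leLHS]mulrA divfK ?gt_eqF//; lra.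
  suff h2 : \sum_(k < T) (\sum_(i < T - k) C k i * Xk k i +
      \sum_(i < T - k) 4 * C k i / 64 ^+ (k + i + k0)) <= delta by lra.
  apply: (@le_trans _ _ (\sum_(k < T) 4096 * Q * A' * 3 * a k)).
    apply: ler_sum => k _; rewrite -big_split /=.
    have kp : 0 < (k + k0 + 1)%:R :> R by rewrite ltr0n addn1.
    have kE : a k * (k + k0 + 1)%:R = 1 by rewrite /a mulVf// gt_eqF.
    apply: (@le_trans _ _ (\sum_(i < T - k) 4096 * Q * A' * a k * (2 * (1 / 4) ^+ i))).
      apply: ler_sum => i _; rewrite -/(M (k + i)%N) /Xk MD.
      have e1 : (8 : R) ^+ i * (64 ^+ i)^-1 * 2 ^+ i = (1 / 4) ^+ i.
        by rewrite -exprVn -!exprMn; congr (_ ^+ _); lra.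
      (* The degree cutoff grows linearly in [i]; [i < 2 ^ i] absorbs it, and [8 * 2 / 64 = 1 / 4]
         still leaves a convergent series. *)
      have le1 : A * Kd%:R * (k + i + k0)%:R + 4 <= A' * ((k + k0 + 1)%:R * 2 ^+ i).
        apply: (@le_trans _ _ (A' * (k + i + k0 + 1)%:R)).
          have h3 : 0 <= A * Kd%:R by rewrite mulr_ge0// ltW.
          rewrite /A' addn1 -[(k + i + k0).+1%:R]natr1; move: h3 (ler0n R (k + i + k0)).
          by move: (A * Kd%:R) ((k + i + k0)%:R : R) => x y; lra.
        rewrite ler_pM2l// -natrX -natrM ler_nat.
        have : (i < 2 ^ i)%N by exact: ltn_expl.
        by clear; nia.
      have -> : C k i * (A * Kd%:R * (k + i + k0)%:R / (M k * 64 ^+ i)) +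
          4 * C k i / (M k * 64 ^+ i) =
          4096 * Q * a k ^+ 2 * 2 * (8 ^+ i * (64 ^+ i)^-1) *
            (A * Kd%:R * (k + i + k0)%:R + 4).
        have mk := M0 k; rewrite CE.
        have -> : (M k * 64 ^+ i)^-1 = (M k)^-1 * (64 ^+ i)^-1 by rewrite invfM.
        have : M k * (M k)^-1 = 1 by rewrite mulfV// gt_eqF.
        move: (M k) ((M k)^-1) (8 ^+ i) ((64 ^+ i)^-1) (a k) => m m' p q b mm.
        transitivity (4096 * Q * b ^+ 2 * (m * m') * 2 * (p * q) *
          (A * Kd%:R * (k + i + k0)%:R + 4)); first by ring.
        by rewrite mm mulr1.
      apply: (@le_trans _ _ (4096 * Q * a k ^+ 2 * 2 * (8 ^+ i * (64 ^+ i)^-1) *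
          (A' * ((k + k0 + 1)%:R * 2 ^+ i)))).
        have q0 := ltW Q0; have a0 := ltW (ap k).
        by apply: ler_wpM2l le1; do ?apply: mulr_ge0 => //; rewrite ?invr_ge0 exprn_ge0.
      rewrite -e1; move: kE.
      move: ((k + k0 + 1)%:R : R) (8 ^+ i) ((64 ^+ i)^-1) (2 ^+ i) (a k) => b p q t ak kE.
      suff -> : 4096 * Q * ak ^+ 2 * 2 * (p * q) * (A' * (b * t)) =
         (ak * b) * (4096 * Q * A' * ak * (2 * (p * q * t))) by rewrite kE mul1r.
      by ring.
    rewrite -mulr_sumr [leLHS]mulrAC ler_pM2r// ler_pM2l ?mulr_gt0//.
    exact: geometric_quarter.
  rewrite -mulr_sumr -/S.
  have -> : 4096 * Q * A' * 3 * S = 12288 * A' / (eps * S).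
    by rewrite /Q expr2; field; rewrite ?gt_eqF.
  rewrite ler_pdivrMr ?mulr_gt0//; move: hT; rewrite -/S ler_pdivrMr ?mulr_gt0//; lra.
- have X8 k : X <= 8 ^+ (k + k0) by apply: XB; rewrite ler_nat.
  have L8 k : Lam <= 8 ^+ (k + k0) by apply: (le_trans _ (X8 k)); rewrite /X; lra.
  have d8 k : 4 * d%:R / delta <= 8 ^+ (k + k0).
    by apply: (le_trans _ (X8 k)); rewrite /X; lra.
  have am k l : (k <= l)%N -> a l <= a k.
    by move=> kl; rewrite lef_pV2 ?posrE ?ltr0n ?addn1// ler_nat ltnS leq_add2r.
  move=> D phi al pl; rewrite sE.
  exact: (@multiscale_bound Kd d k0 T delta eps Lam a del0 eps0 hd erefl L8 d8 ap am S0 D phi al pl).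
Qed.

(** A dart whose origin is not flat either has degree above [K = Kd * m], counted by the extra entry
    [(m, 1)], or is one of at most [K] darts at a vertex that is not flat. Here
    [64 ^- m <= eta / 2], and [delta] is chosen with [5 * K * delta <= eta / 2]. *)
Lemma bad_dart_bound (Kd : nat) (eta eps : R) : 0 < eta -> 0 < eps ->
  exists (r : nat) (c0 : R) (s : seq (nat * R)),
  [/\ all (fun p => 0 <= p.2) s, c0 + \sum_(p <- s) p.2 / 64 ^+ p.1 <= eta &
   forall (D : finType) (phi al : D -> D), planar phi al ->
    #|[set e | ~~ `[< flat_vertex phi al r eps (froot (phi \o al) e) >]]|%:R <=
    c0 * #|D|%:R + \sum_(p <- s) p.2 * #|[set d | (Kd * p.1 < order (phi \o al) d)%N]|%:R].
Proof.
move=> eta0 eps0.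
have [m hm] : exists m, 2 / eta <= 2 ^+ m.
  by exists (Num.bound (2 / eta)); exact: ltW (upper_nthrootP _).
pose K := (Kd * m)%N.
pose delta := Num.min 1 (eta / (10 * K.+1%:R)).
have del0 : 0 < delta by rewrite lt_min ltr01 divr_gt0 ?mulr_gt0.
have del1 : delta <= 1 by rewrite ge_min lexx.
have [r [c0 [s [s0 sc h]]]] := bad_vertex_bound Kd del0 del1 eps0.
exists r, (K%:R * c0), ((m, 1) :: [seq (p.1, K%:R * p.2) | p <- s]); split.
- by rewrite /= ler01 /= all_map; apply/allP => p /(allP s0) /= p0; rewrite mulr_ge0.
- rewrite big_cons big_map /= mul1r addrCA.
  have -> : \sum_(p <- s) K%:R * p.2 / 64 ^+ p.1 = K%:R * \sum_(p <- s) p.2 / 64 ^+ p.1.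
    by rewrite mulr_sumr; apply: eq_bigr => p _; rewrite mulrA.
  rewrite -mulrDr; have h1 : (64 ^+ m)^-1 <= eta / 2.
    rewrite -[eta / 2]invf_div lef_pV2 ?posrE ?exprn_gt0 ?divr_gt0//.
    by apply: (le_trans hm); rewrite lerXn2r ?nnegrE//; lra.
  have h2 : K%:R * (5 * delta) <= eta / 2.
    have : delta <= eta / (10 * K.+1%:R) by rewrite ge_min lexx orbT.
    rewrite ler_pdivlMr ?mulr_gt0// -natr1 => h2.
    have := mulr_ge0 (ltW del0) (ler0n R K); lra.
  have := ler_wpM2l (ler0n R K) sc; lra.
- move=> D phi al pl; have [[ip ia na _] _] := pl.
  have sgi : injective (phi \o al) by apply: inj_comp => //; exact: inv_inj.
  pose bad v : R := (~~ `[< flat_vertex phi al r eps v >])%:R.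
  have cardE (P : pred D) : #|[set v | P v]|%:R = \sum_v (P v)%:R :> R.
    rewrite -sum1_card natr_sum big_mkcond /=; apply: eq_bigr => v _.
    by rewrite inE; case: (P v).
  rewrite cardE (bigID (fun e => order (phi \o al) e <= K)%N) /= big_cons big_map /= mul1r.
  rewrite addrCA addrC; apply: lerD.
    rewrite cardE big_mkcond /=; apply: ler_sum => e _; rewrite -ltnNge -/K.
    by case: ifP => // _; case: (~~ _).
  apply: (le_trans (@sum_vertex_le D (phi \o al) bad K sgi _)).
    by move=> v; rewrite /bad; case: (~~ _).
  rewrite /bad -(cardE (fun v => ~~ `[< flat_vertex phi al r eps v >])).
  have -> : K%:R * c0 * #|D|%:R + \sum_(j <- s) K%:R * j.2 *
      #|[set d | (Kd * j.1 < order (phi \o al) d)%N]|%:R = K%:R * (c0 * #|D|%:R +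
      \sum_(p <- s) p.2 * #|[set d | (Kd * p.1 < order (phi \o al) d)%N]|%:R).
    by rewrite mulrDr mulr_sumr mulrA; congr (_ + _); apply: eq_bigr => p _; rewrite mulrA.
  by rewrite ler_wpM2l//; exact: h.
Qed.

End mean_flatness.

From mathcomp Require Import finmap all_classical all_analysis.
Require Import Defs.
Import numFieldNormedType.Exports.
Local Open Scope classical_set_scope.

(** * Rotation systems and maps *)

Lemma card_of_uniq (T : choiceType) (s : seq T) : uniq s -> card_of [set` s] = size s.
Proof.
move=> us; rewrite /card_of; have -> : fset_set [set` s] = seq_fset tt s.
  by apply/fsetP => x; rewrite seq_fsetE in_fset_set//= mem_setE.
by rewrite size_seq_fset undup_id.
Qed.

Lemma card_of_orbits (D : finType) (f : D -> D) (a : {pred D}) (T : choiceType) (g : D -> T) :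
  injective f -> fclosed f a -> (forall d e, g d = g e <-> fconnect f d e) ->
  card_of (g @` [set d | d \in a]) = fcard f a.
Proof.
move=> fi fa gE; pose s := [seq g d | d <- enum [predI froots f & a]].
have us : uniq s.
  rewrite map_inj_in_uniq ?enum_uniq// => d e; rewrite !mem_enum !inE.
  move=> /andP[/eqP rd _] /andP[/eqP re _] /gE; rewrite -froot_eq//.
  by rewrite rd re => /eqP.
have -> : g @` [set d | d \in a] = [set` s].
  apply/seteqP; split => [_ [d /= da <-]|x /= /mapP[d]]; last first.
    by rewrite mem_enum !inE => /andP[_ da] ->; exists d.
  apply/mapP; exists (froot f d); last by apply/gE; exact: connect_root.
  rewrite mem_enum !inE roots_root; last exact: fconnect_sym.
  by rewrite -(closed_connect fa (connect_root _ d)).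
by rewrite card_of_uniq// size_map -cardE.
Qed.

(** Bridge between maps whose darts are natural numbers and rotation systems on finite types. As
    [phi] turns along faces, the rotation [nxt] corresponds to [phi \o al]. *)
Definition presents (m : smap) (D : finType) (phi al : D -> D) (sp : D -> bool) (r : D)
    (io : D -> nat) : Prop :=
  [/\ injective io, range io = darts m, io r = root m,
      forall d, io (al d) = opp m (io d) &
      (forall d, io (phi (al d)) = nxt m (io d)) /\ (forall d, spin m (io d) = sp d)].

Section presentation.
Variables (m : smap) (D : finType) (phi al : D -> D) (sp : D -> bool) (r : D) (io : D -> nat).
Hypothesis pm : presents m phi al sp r io.

Let ioi : injective io. Proof. by case: pm. Qed.
Let ioR : range io = darts m. Proof. by case: pm. Qed.
Let ior : io r = root m. Proof. by case: pm. Qed.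
Let ioa d : io (al d) = opp m (io d). Proof. by case: pm. Qed.
Let ion d : io (phi (al d)) = nxt m (io d). Proof. by case: pm => _ _ _ _ []. Qed.
Let ios d : spin m (io d) = sp d. Proof. by case: pm => _ _ _ _ []. Qed.

Lemma presents_dart d : darts m (io d). Proof. by rewrite -ioR; exists d. Qed.

Lemma presents_dartP x : darts m x -> exists d, x = io d.
Proof. by rewrite -ioR => -[d _ <-]; exists d. Qed.

Lemma image_presented (T : Type) (g : nat -> T) :
  g @` darts m = (fun d => g (io d)) @` [set d | d \in predT].
Proof.
apply/seteqP; split => [_ [x /presents_dartP[d ->] <-]|_ [d _ <-]]; first by exists d.
by exists (io d) => //; exact: presents_dart.
Qed.

Lemma forbit_io (f : D -> D) (f' : nat -> nat) d e :
  (forall d, io (f d) = f' (io d)) -> forbit f' (io d) (io e) <-> fconnect f d e.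
Proof.
move=> ff; have it k : iter k f' (io d) = io (iter k f d) by elim: k => //= k ->; rewrite ff.
split => [[k _]|/iter_findex <-]; first by rewrite it => /ioi <-; exact: fconnect_iter.
by exists (findex f d e); rewrite // it.
Qed.

Lemma forbit_ioE (f : D -> D) (f' : nat -> nat) d :
  (forall d, io (f d) = f' (io d)) -> forbit f' (io d) = io @` [set e | fconnect f d e].
Proof.
move=> ff; apply/seteqP; split => [x [k _ <-]|_ [e /= de <-]]; last exact/forbit_io.
have it : iter k f' (io d) = io (iter k f d) by elim: k => //= k ->; rewrite ff.
by exists (iter k f d); rewrite ?it//= fconnect_iter.
Qed.

Lemma forbit_io_eq (f : D -> D) (f' : nat -> nat) d e : injective f ->
  (forall d, io (f d) = f' (io d)) ->
  forbit f' (io d) = forbit f' (io e) <-> fconnect f d e.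
Proof.
move=> fi ff; split => [E|de].
  by apply/(forbit_io _ _ ff); rewrite E; exists 0%N.
rewrite !(forbit_ioE _ ff); congr (io @` _); apply/funext => x /=; apply/propext.
by rewrite (same_connect (fconnect_sym fi) de).
Qed.

Lemma card_forbit_io (f : D -> D) (f' : nat -> nat) d :
  (forall d, io (f d) = f' (io d)) -> card_of (forbit f' (io d)) = order f d.
Proof.
move=> ff; rewrite (forbit_ioE _ ff).
have us : uniq [seq io e | e <- orbit f d] by rewrite map_inj_uniq// orbit_uniq.
rewrite (_ : io @` _ = [set` [seq io e | e <- orbit f d]]).
  by rewrite card_of_uniq// size_map size_orbit.
apply/seteqP; split => [_ [e /= de <-]|x /= /mapP[e]].
  by apply: map_f; rewrite -fconnect_orbit.
by rewrite -fconnect_orbit => de ->; exists e.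
Qed.

Hypothesis cm : cmap phi al.
Let ia : involutive al. Proof. by case: cm. Qed.
Let ip : injective phi. Proof. by case: cm. Qed.
Let na d : al d != d. Proof. by case: cm. Qed.
Let is_ : injective (phi \o al). Proof. by apply: inj_comp => //; exact: inv_inj. Qed.
Let iof d : io (phi d) = (nxt m \o opp m) (io d).
Proof. by rewrite /= -ioa -ion ia. Qed.

Lemma presents_vertices : card_of (vertices m) = fcard (phi \o al) D.
Proof.
rewrite -(@card_of_orbits D (phi \o al) predT _ (fun d => vertex m (io d))) //.
  by rewrite /vertices image_presented.
by move=> d e; exact: forbit_io_eq.
Qed.

Lemma presents_faces : card_of (faces m) = fcard phi D.
Proof.
rewrite -(@card_of_orbits D phi predT _ (fun d => face m (io d))) //.
  by rewrite /faces image_presented.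
by move=> d e; exact: forbit_io_eq.
Qed.

Lemma edge_io_eq d e : edge m (io d) = edge m (io e) <-> fconnect al d e.
Proof.
rewrite al_orbit// /edge -!ioa; split => [E|/orP[]/eqP->//]; last first.
  by rewrite ia setUC.
have : [set io d; io (al d)] (io e) by rewrite E; left.
by case=> /ioi ->; rewrite eqxx ?orbT.
Qed.

Lemma presents_edges : card_of (edges m) = fcard al D.
Proof.
rewrite -(@card_of_orbits D al predT _ (fun d => edge m (io d)))//.
- by rewrite /edges image_presented.
- exact: inv_inj.
- exact: edge_io_eq.
Qed.

Lemma presents_darts : (#|D| = card_of (edges m) * 2)%N.
Proof. by rewrite presents_edges fcard_al. Qed.

Lemma presents_mono : (card_of (mono_edges m) * 2 = #|[pred d | sp d == sp (al d)]|)%N.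
Proof.
pose a := [pred d | sp d == sp (al d)].
have ac : fclosed al a by move=> d _ /eqP <-; rewrite !inE ia eq_sym.
have -> : card_of (mono_edges m) = fcard al a.
  rewrite -(@card_of_orbits D al a _ (fun d => edge m (io d)))//.
  - congr card_of; apply/seteqP; split => [_ [x [/presents_dartP[d ->]] + <-]|].
      by rewrite -ioa !ios => /eqP da; exists d.
    move=> _ [d /= da <-]; exists (io d) => //; split; first exact: presents_dart.
    by rewrite -ioa !ios; exact/eqP.
  - exact: inv_inj.
  - exact: edge_io_eq.
rewrite (@fcard_order_set _ al (inv_inj ia) 2)//.
apply/fintype.subsetP => d _; rewrite inE /order.
rewrite (eq_card (B := pred2 d (al d))); last by move=> e; rewrite !inE -al_orbit.
by rewrite card2 (eq_sym d) na.
Qed.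

Lemma presents_degree d : card_of (vertex m (io d)) = order (phi \o al) d.
Proof. exact: card_forbit_io. Qed.

Lemma presents_face_size d : card_of (face m (io d)) = order phi d.
Proof. exact: card_forbit_io. Qed.

End presentation.

Lemma order3 (D : finType) (phi : D -> D) d : injective phi ->
  (order phi d = 3%N) <-> (phi (phi (phi d)) = d /\ phi d != d).
Proof.
move=> ip; split => [E3|[p3 pn]].
  have := iter_order ip d; rewrite E3 => E; split => //; apply/eqP => E1.
  have := @findex_iter _ phi d 1; rewrite E3 => /(_ isT); rewrite /= E1 => h.
  by have := @findex_iter _ phi d 0; rewrite E3 /= h => /(_ isT).
have p2n : phi (phi d) != d.
  by apply: contra pn => /eqP E; rewrite -[X in _ == X]p3 E.
have oE : orbit phi d =i [:: d; phi d; phi (phi d)].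
  move=> e; rewrite -fconnect_orbit; apply/idP/idP.
    move=> /iter_findex <-; elim: (findex _ _ _) => [|k IH]; first by rewrite inE eqxx.
    rewrite !inE /= in IH *; case/or3P: IH => /eqP ->; rewrite ?eqxx ?orbT// p3 eqxx//.
  rewrite !inE => /or3P[]/eqP ->; first exact: connect0.
    exact: fconnect1.
  by apply: connect_trans (fconnect1 _ _) (fconnect1 _ _).
rewrite -size_orbit -(undup_id (orbit_uniq phi d)).
rewrite (perm_size (uniq_perm _ _ _ : perm_eq _ [:: d; phi d; phi (phi d)])) ?undup_uniq//=.
  rewrite !inE !negb_or eq_sym pn eq_sym p2n /= andbT eq_sym (inj_eq ip) pn//.
by move=> e; rewrite mem_undup.
Qed.

Lemma within_nxt m k x : within m k x -> within m k (nxt m x).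
Proof.
elim: k x => [|k IH] x /=; first by move=> [j _ <-]; exists j.+1.
move=> [/IH ?|[z hz [j _ <-]]]; first by left.
by right; exists z => //; exists j.+1.
Qed.

Lemma within_opp m k x : within m k x -> within m k.+1 (opp m x).
Proof. by move=> wx; right; exists x => //; exists 0%N. Qed.

Lemma within_le m k l x : (k <= l)%N -> within m k x -> within m l x.
Proof. by move=> /subnKC <-; elim: (l - k)%N => [|j IH]; rewrite ?addn0// addnS => /IH; left. Qed.

Lemma present_exists m : is_map m -> finite_set (darts m) ->
  exists (D : finType) (phi al : D -> D) (sp : D -> bool) (r : D) (io : D -> nat),
  [/\ presents m phi al sp r io, cmap phi al & forall d, sp (phi (al d)) = sp d].
Proof.
move=> [dr [nm ni ns] om vm wm] fin; pose F := fset_set (darts m).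
have inF x : (x \in F) = `[< darts m x >] by rewrite in_fset_set//; apply/idP/asboolP; rewrite inE.
have FP x : x \in F -> darts m x by rewrite inF => /asboolP.
have PF x : darts m x -> x \in F by rewrite inF => /asboolP.
pose D : finType := F.
have oF (d : D) : opp m (val d) \in F by apply: PF; have [] := om _ (FP _ (valP d)).
have nF (d : D) : nxt m (val d) \in F by apply: PF; apply: nm; exact: (FP _ (valP d)).
pose al (d : D) : D := [` oF d]%fset.
pose phi (d : D) : D := [` nF (al d)]%fset.
exists D, phi, al, (fun d => spin m (val d)), ([` PF _ dr]%fset : D), (val : D -> nat).
have ia : involutive al by move=> d; apply: val_inj => /=; have [] := om _ (FP _ (valP d)).
have ion (d : D) : val (phi (al d)) = nxt m (val d).
  by rewrite /=; have [_ -> _] := om _ (FP _ (valP d)).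
have pm : presents m phi al (fun d => spin m (val d)) ([` PF _ dr]%fset : D) (val : D -> nat).
  split => //.
  - by apply/seteqP; split => [x [d _ <-]|x /PF xF]; [exact: (FP _ (valP d))|exists [` xF]%fset].
split => //; last first.
  by move=> d; rewrite ion; have [] := vm _ (FP _ (valP d)).
split => //.
- move=> d e /(congr1 val) /= E; apply: (inv_inj ia); apply: val_inj.
  by apply: ni; rewrite ?inE//; apply: FP; exact: oF.
- move=> d; apply/eqP => /(congr1 val) /= E.
  by have [_ _] := om _ (FP _ (valP d)).
- move=> X Xp Xa.
  have Xs d : X (phi (al d)) = X d by rewrite Xp Xa.
  have XV (d e : D) : vertex m (val d) (val e) -> X e = X d.
    move=> /(forbit_io pm (f := phi \o al)) h.
    by apply: (fconnect_invariant (f := phi \o al)) => //; exact: h.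
  suff h k (d : D) : within m k (val d) -> X d = X ([` PF _ dr]%fset : D).
    move=> d e; have [k kd] := wm _ (FP _ (valP d)); have [l le_] := wm _ (FP _ (valP e)).
    by rewrite (h _ _ kd) (h _ _ le_).
  have wD k' x : within m k' x -> darts m x.
    have nD x' j : darts m x' -> darts m (iter j (nxt m) x').
      by move=> x'D; elim: j => //= j; exact: nm.
    elim: k' x => [|k' IH] x /= => [[j _ <-]|[/IH//|[z /IH/om[oz _ _] [j _ <-]]]]; exact: nD.
  elim: k d => [|k IH] d /=; first by move=> wd; exact: XV.
  move=> [/IH//|[z wz vz]]; have zF := PF _ (wD _ _ wz).
  have := IH [` zF]%fset wz => <-; rewrite -[RHS]Xa.
  exact: XV.
Qed.

Lemma presents_finite_triangulation m (D : finType) (phi al : D -> D) sp r io :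
  presents m phi al sp r io -> tri_map_axioms phi al sp -> finite_triangulation m.
Proof.
move=> pm [[cm eu] p3 pn ps]; have [ip ia na co] := cm.
have is_ : injective (phi \o al) by apply: inj_comp => //; exact: inv_inj.
have [ioi ioR ior ioa [ion ios]] := pm.
have dartP := presents_dartP pm; have dart := presents_dart pm.
have fin : finite_set (darts m) by rewrite -ioR; exact: finite_image.
split; split.
- split.
  + by rewrite -ior.
  + split.
    * by move=> _ /dartP[d ->]; rewrite -ion.
    * move=> x y; rewrite !inE => /dartP[d ->] /dartP[e ->]; rewrite -!ion => /ioi E.
      by congr io; exact: is_.
    * move=> _ /dartP[d ->]; have [g gK Kg] := injF_bij is_.
      by exists (io (g d)); [exact: dart|rewrite -ion; congr io; exact: Kg].
  + move=> _ /dartP[d ->]; rewrite -!ioa ia; split => //.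
    by move/ioi/eqP; rewrite (negbTE (na d)).
  + move=> _ /dartP[d ->]; split; last by rewrite -ion !ios.
    by rewrite /vertex (forbit_ioE pm (f := phi \o al))//; exact: finite_image.
  + pose X d := `[< exists k, within m k (io d) >].
    have Xs d : X d -> X (phi (al d)).
      by move=> /asboolP[k wk]; apply/asboolP; exists k; rewrite ion; exact: within_nxt.
    have Xs' d : X (phi (al d)) = X d.
      apply/idP/idP; last exact: Xs.
      have : fconnect (phi \o al) (phi (al d)) d.
        by rewrite fconnect_sym//; exact: (fconnect1 (phi \o al)).
      move=> /iter_findex {2}<-; elim: (findex _ _ _) => //= k IH h.
      by apply: Xs; exact: IH.
    have Xa d : X d -> X (al d).
      by move=> /asboolP[k wk]; apply/asboolP; exists k.+1; rewrite ioa; exact: within_opp.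
    have Xa' d : X (al d) = X d by apply/idP/idP => [/Xa|/Xa//]; rewrite ia.
    have Xp d : X (phi d) = X d by rewrite -{1}(ia d) Xs' Xa'.
    move=> _ /dartP[d ->]; apply/asboolP; rewrite -[X in is_true X]/(X d) (co X Xp Xa' d r).
    by apply/asboolP; exists 0%N; rewrite ior; exists 0%N.
- by move=> _ /dartP[d ->]; rewrite (presents_face_size pm)//; apply/(order3 d ip).
- exact: fin.
- by rewrite (presents_vertices pm)// (presents_faces pm)// (presents_edges pm).
Qed.

Lemma finite_triangulation_presents m : finite_triangulation m ->
  exists (D : finType) (phi al : D -> D) (sp : D -> bool) (r : D) (io : D -> nat),
  presents m phi al sp r io /\ tri_map_axioms phi al sp.
Proof.
move=> [[mm fm] [fin eu]].
have [D [phi [al [sp [r [io [pm cm ps]]]]]]] := present_exists mm fin.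
exists D, phi, al, sp, r, io; split => //; have [ip ia na co] := cm.
have p3 d : phi (phi (phi d)) = d /\ phi d != d.
  apply/(order3 d ip); rewrite -(presents_face_size pm)//; apply: fm.
  exact: presents_dart pm d.
split => // [|d|d]; [split => //|by have [] := p3 d|by have [] := p3 d].
by rewrite -(presents_vertices pm)// -(presents_faces pm)// -(presents_edges pm).
Qed.

Definition smap_of (D : finType) (phi al : D -> D) (sp : D -> bool) (r : D) : smap :=
  let lift T (f : D -> T) (t0 : T) x :=
    if insub x is Some i then f (enum_val (i : 'I_#|D|)) else t0 in
  SMap (range (fun d : D => nat_of_ord (enum_rank d))) (enum_rank r)
    (lift nat (fun d => nat_of_ord (enum_rank (al d))) 0%N)
    (lift nat (fun d => nat_of_ord (enum_rank (phi (al d)))) 0%N) (lift bool sp false).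

Lemma smap_of_presents (D : finType) (phi al : D -> D) (sp : D -> bool) (r : D) :
  presents (smap_of phi al sp r) phi al sp r (fun d => nat_of_ord (enum_rank d)).
Proof.
have ins (d : D) : insub (nat_of_ord (enum_rank d)) = Some (enum_rank d).
  exact: (valK (enum_rank d)).
split => //; [by move=> d e /ord_inj/enum_rank_inj|..].
- by move=> d; rewrite /= ins enum_rankK.
- by split => d; rewrite /= ins enum_rankK.
Qed.

Lemma rooted_iso_map_iso m m' (D D' : finType) (phi al : D -> D) sp r io
    (phi' al' : D' -> D') sp' r' io' :
  presents m phi al sp r io -> presents m' phi' al' sp' r' io' -> involutive al ->
  involutive al' ->
  rooted_iso phi al sp r phi' al' sp' r' <-> map_iso m m'.
Proof.
move=> pm pm' ia ia'; have [ioi ioR ior ioa [ion ios]] := pm.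
have [ioi' ioR' ior' ioa' [ion' ios']] := pm'.
have dartP := presents_dartP pm; have dart := presents_dart pm.
have dartP' := presents_dartP pm'; have dart' := presents_dart pm'.
split => [[f [[g fg gf] fr fp fa fs]]|[f [[ff fi fsu] fr fE]]].
  pose F x := if [pick d | io d == x] is Some d then io' (f d) else 0%N.
  have FE d : F (io d) = io' (f d).
    rewrite /F; case: pickP => [e /eqP/ioi->//|/(_ d)]; by rewrite eqxx.
  exists F; split.
  - split.
    + by move=> _ /dartP[d ->]; rewrite FE.
    + move=> x y; rewrite !inE => /dartP[d ->] /dartP[e ->]; rewrite !FE => /ioi'.
      by move=> /(can_inj fg) ->.
    + move=> _ /dartP'[d ->]; exists (io (g d)); first exact: dart.
      by rewrite FE gf.
  - by rewrite -ior FE fr.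
  - move=> _ /dartP[d ->]; rewrite -ioa -ion !FE fa fp fa -ioa' -ion'; split => //.
    by rewrite ios' ios fs.
have ex d : exists d', io' d' == f (io d).
  by have [d' ->] := dartP' _ (ff _ (dart d)); exists d'.
pose F d := xchoose (ex d).
have FE d : io' (F d) = f (io d) by apply/eqP; exact: xchooseP (ex d).
have Fi : injective F.
  move=> d e E; apply: ioi; apply: fi; rewrite ?inE; [exact: dart..|].
  by rewrite -!FE E.
have ex' d' : exists d, F d == d'.
  have [x /dartP[d ->] xE] := fsu _ (dart' d'); exists d; apply/eqP/ioi'.
  by rewrite FE xE.
have Fa d : F (al d) = al' (F d).
  by apply: ioi'; rewrite FE ioa' FE ioa; have [] := fE _ (dart d).
exists F; split.
- exists (fun d' => xchoose (ex' d')) => d; last exact/eqP/(xchooseP (ex' d)).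
  by apply: Fi; apply/eqP; exact: (xchooseP (ex' (F d))).
- by apply: ioi'; rewrite FE ior fr ior'.
- move=> d; apply: ioi'; rewrite FE -{1}(ia d) ion -{1}(ia' (F d)) ion' -Fa FE.
  by have [_ ->] := fE _ (dart (al d)).
- exact: Fa.
- by move=> d; rewrite -ios' FE -ios; have [_ _ ->] := fE _ (dart d).
Qed.

(** * Recurrence of flat maps *)

(** The energy, over both orientations of each edge, is bounded through its finite partial sums, so
    that the definition covers infinite maps. *)
Definition flat (R : realType) (m : smap) (r : nat) (eps : R) : Prop :=
  exists g : nat -> R,
    [/\ forall d, darts m d -> g (nxt m d) = g d, g (root m) = 1,
        forall d, darts m d -> ~ within m r d -> g d = 0 &
        forall s : seq nat, uniq s -> (forall d, d \in s -> darts m d) ->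
          \sum_(d <- s) (g d - g (opp m d)) ^+ 2 <= eps].

(** * Avoidance probabilities and harmonicity *)

Section infinite_map.
Variables (R : realType) (m : smap).
Hypothesis mm : is_map m.

Let dr : darts m (root m). Proof. by case: mm. Qed.
Let nD d : darts m d -> darts m (nxt m d).
Proof. by case: mm => _ [+ _ _] _ _ _; exact. Qed.
Let nI d e : darts m d -> darts m e -> nxt m d = nxt m e -> d = e.
Proof. by case: mm => _ [_ + _] _ _ _ dd de; apply; rewrite inE. Qed.
Let oD d : darts m d -> darts m (opp m d).
Proof. by case: mm => _ _ + _ _ => /[apply] -[]. Qed.
Let oK d : darts m d -> opp m (opp m d) = d.
Proof. by case: mm => _ _ + _ _ => /[apply] -[]. Qed.
Let vfin d : darts m d -> finite_set (vertex m d).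
Proof. by case: mm => _ _ _ + _ => /[apply] -[]. Qed.
Let con d : darts m d -> exists k, within m k d.
Proof. by case: mm => _ _ _ _; exact. Qed.

Let itD k d : darts m d -> darts m (iter k (nxt m) d).
Proof. by move=> dd; elim: k => //= k; exact: nD. Qed.

Lemma vertex_refl d : vertex m d d. Proof. by exists 0%N. Qed.

Lemma vertex_dart d e : darts m d -> vertex m d e -> darts m e.
Proof. by move=> dd [k _ <-]; exact: itD. Qed.

Lemma vertex_period d : darts m d -> exists2 p, (0 < p)%N & iter p (nxt m) d = d.
Proof.
move=> dd; pose F := fset_set (vertex m d).
have inF x : (x \in F) <-> vertex m d x.
  by rewrite in_fset_set ?inE//; exact: vfin.
have nF (x : F) : nxt m (val x) \in F.
  by apply/inF; have /inF[k _ <-] := valP x; exists k.+1.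
pose f (x : F) : F := [` nF x]%fset.
have fi : injective f.
  move=> x y /(congr1 val) /= E; apply: val_inj; apply: nI E.
    by have /inF/(vertex_dart dd) := valP x.
  by have /inF/(vertex_dart dd) := valP y.
have dF : d \in F by apply/inF; exact: vertex_refl.
exists (order f [` dF]%fset); first exact: order_gt0.
have it k (x : F) : val (iter k f x) = iter k (nxt m) (val x) by elim: k => //= k ->.
by rewrite -[d in LHS]/(val [` dF]%fset) -it iter_order.
Qed.

Lemma vertex_sym d e : darts m d -> vertex m d e -> vertex m e d.
Proof.
move=> dd [k _ <-]; have [p p0 pE] := vertex_period dd.
exists (k * p - k)%N => //; rewrite -iterD subnK ?leq_pmulr//.
by elim: k => //= k IH; rewrite mulSn iterD IH.
Qed.

Lemma vertex_trans d e f : vertex m d e -> vertex m e f -> vertex m d f.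
Proof. by move=> [k _ <-] [l _ <-]; exists (l + k)%N => //; rewrite iterD. Qed.

Lemma vertex_eq d e : darts m d -> vertex m d e -> vertex m e = vertex m d.
Proof.
move=> dd de; have ed := vertex_sym dd de; apply/seteqP; split => f.
  exact: vertex_trans.
exact: vertex_trans.
Qed.

Lemma vertex_invariant (T : Type) (h : nat -> T) d e :
  (forall d, darts m d -> h (nxt m d) = h d) -> darts m d -> vertex m d e -> h e = h d.
Proof. by move=> hn dd [k _ <-]; elim: k => //= k IH; rewrite hn//; exact: itD. Qed.

Lemma within_dart k d : within m k d -> darts m d.
Proof.
elim: k d => [|k IH] d /=; first exact: vertex_dart.
by move=> [/IH//|[e /IH ed]]; apply: vertex_dart; exact: oD.
Qed.

Lemma within_finite k : finite_set (within m k).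
Proof.
elim: k => [|k IH] /=; first exact: vfin.
rewrite finite_setU; split => //.
have -> : [set d | exists2 e, within m k e & vertex m (opp m e) d] =
    \bigcup_(e in within m k) vertex m (opp m e).
  by apply/seteqP; split => [d [e]|d [e]]; exists e.
apply: bigcup_finite => // e we; apply: vfin; apply: oD; exact: within_dart we.
Qed.

Let vs d := fset_set (vertex m d).
Let in_vs d e : darts m d -> (e \in vs d) <-> vertex m d e.
Proof. by move=> dd; rewrite in_fset_set ?inE//; exact: vfin. Qed.

Let vs_gt0 d : darts m d -> 0 < (#|` vs d|)%:R :> R.
Proof.
move=> dd; rewrite ltr0n cardfs_gt0; apply/fset0Pn; exists d.
by apply/in_vs => //; exact: vertex_refl.
Qed.

Definition vavg (h : nat -> R) d : R := (\sum_(e <- vs d) h e) / (#|` vs d|)%:R.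

Let vavg_eq h d e : darts m d -> vertex m d e -> vavg h e = vavg h d.
Proof. by move=> dd de; rewrite /vavg /vs (vertex_eq dd de). Qed.

Let vavg_le h h' d : darts m d -> (forall e, vertex m d e -> h e <= h' e) ->
  vavg h d <= vavg h' d.
Proof.
move=> dd hh; rewrite /vavg ler_pM2r ?invr_gt0 ?vs_gt0//.
rewrite big_seq [leRHS]big_seq; apply: ler_sum => e /in_vs he; apply: hh; exact: he.
Qed.

Let vavg_const c d : darts m d -> vavg (fun=> c) d = c.
Proof.
move=> dd; rewrite /vavg big_const_seq count_predT iter_addr_0 -[c *+ _]mulr_natr.
by rewrite mulfK// gt_eqF// vs_gt0.
Qed.

Variable d0 : nat.
Hypothesis dd0 : darts m d0.
Notation v := (vertex m d0).

(* Probability that the walk from (the origin of) [d] avoids [v] up to time [n]. *)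
Fixpoint avoid n d : R := if `[< v d >] then 0 else
  if n is n'.+1 then vavg (fun e => avoid n' (opp m e)) d else 1.

Let v_eq d e : darts m d -> vertex m d e -> `[< v e >] = `[< v d >].
Proof.
move=> dd de; apply/asboolP/asboolP => h; last exact: vertex_trans de.
by apply: vertex_trans h _; exact: vertex_sym.
Qed.

Let avoid_eq n d e : darts m d -> vertex m d e -> avoid n e = avoid n d.
Proof.
by move=> dd de; case: n => [|n] /=; rewrite (v_eq dd de)// (vavg_eq _ dd de).
Qed.

Let avoid_bounds n d : darts m d -> 0 <= avoid n d <= 1.
Proof.
elim: n d => [|n IH] d dd /=; case: ifP => _; rewrite ?lexx ?ler01//.
apply/andP; split.
  rewrite -(vavg_const 0 dd); apply: vavg_le => // e de.
  by have /andP[] := IH _ (oD (vertex_dart dd de)).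
rewrite -[leRHS](vavg_const 1 dd); apply: vavg_le => // e de.
by have /andP[] := IH _ (oD (vertex_dart dd de)).
Qed.

Let avoid_decr n d : darts m d -> avoid n.+1 d <= avoid n d.
Proof.
elim: n d => [|n IH] d dd.
  by have /andP[_] := avoid_bounds 1 dd; rewrite /=; case: ifP.
rewrite [avoid n.+1 d]/=; rewrite [avoid n.+2 d]/=; case: ifP => // _.
by apply: vavg_le => // e de; exact: IH (oD (vertex_dart dd de)).
Qed.

(** Probability of never being at [v], as the limit of a decreasing sequence; it is harmonic off
    [v]. *)
Let u d : R := inf (range (fun n => avoid n d)).

Let avoid_cvg d : darts m d -> (fun n => avoid n d) @ \oo --> u d.
Proof.
move=> dd; apply: nonincreasing_cvgn.
  by apply/nonincreasing_seqP => n; exact: avoid_decr.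
by exists 0 => _ [n _ <-]; have /andP[] := avoid_bounds n dd.
Qed.

Let u_bounds d : darts m d -> 0 <= u d <= 1.
Proof.
move=> dd; apply/andP; split.
  apply: (cvgr_to_ge (avoid_cvg dd)); apply: nearW => n.
  by have /andP[] := avoid_bounds n dd.
apply: (cvgr_to_le (avoid_cvg dd)); apply: nearW => n.
by have /andP[] := avoid_bounds n dd.
Qed.

Let u_eq d e : darts m d -> vertex m d e -> u e = u d.
Proof.
move=> dd de; rewrite /u; have -> // : (fun n => avoid n e) = (fun n => avoid n d).
by apply/funext => n; exact: avoid_eq.
Qed.

Let cvg_sum_seq (s : seq nat) (f : nat -> nat -> R) (l : nat -> R) :
  (forall e, e \in s -> f e @ \oo --> l e) ->
  (fun n => \sum_(e <- s) f e n) @ \oo --> \sum_(e <- s) l e.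
Proof.
elim: s => [|e s IH] h.
  by rewrite big_nil; under eq_fun do rewrite big_nil; exact: cvg_cst.
rewrite big_cons; under eq_fun do rewrite big_cons.
apply: cvgD; first by apply: h; rewrite inE eqxx.
by apply: IH => x xs; apply: h; rewrite inE xs orbT.
Qed.

Let vavg_cvg d : darts m d ->
  (fun n => vavg (fun e => avoid n (opp m e)) d) @ \oo --> vavg (fun e => u (opp m e)) d.
Proof.
move=> dd; apply: cvgMl; apply: cvg_sum_seq => e /(in_vs _ dd) de.
exact: avoid_cvg (oD (vertex_dart dd de)).
Qed.

Let u_harmonic d : darts m d -> ~ v d -> u d = vavg (fun e => u (opp m e)) d.
Proof.
move=> dd nv.
have h1 : (fun n => avoid n.+1 d) @ \oo --> u d.
  by rewrite (cvg_shiftS (fun n => avoid n d)); exact: avoid_cvg.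
have E : (fun n => avoid n.+1 d) = (fun n => vavg (fun e => avoid n (opp m e)) d).
  by apply/funext => n /=; rewrite asboolF.
by rewrite E in h1; exact: (cvg_unique _ h1 (vavg_cvg dd)).
Qed.

Let u_v d : v d -> u d = 0.
Proof.
move=> vd; have E : range (fun n => avoid n d) = [set 0].
  apply/seteqP; split => [_ [n _ <-]|_ ->] /=; first by case: n => [|n] /=; rewrite asboolT.
  by exists 0%N => //=; rewrite asboolT.
by rewrite /u E inf1.
Qed.

Section caccioppoli.
Variables (r : nat) (eps : R) (g : nat -> R).
Hypothesis g_nxt : forall d, darts m d -> g (nxt m d) = g d.
Hypothesis g_supp : forall d, darts m d -> ~ within m r d -> g d = 0.
Hypothesis g_energy : forall s : seq nat, uniq s -> (forall d, d \in s -> darts m d) ->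
          \sum_(d <- s) (g d - g (opp m d)) ^+ 2 <= eps.

Let A := fset_set (within m r).
Let inA d : (d \in A) <-> within m r d.
Proof. by rewrite in_fset_set ?inE//; exact: within_finite. Qed.
Let S := (A `|` [fset opp m e | e in A])%fset.
Let SD d : d \in S -> darts m d.
Proof.
rewrite inE => /orP[/inA/within_dart//|/imfsetP[e /= /inA/within_dart ed ->]].
exact: oD.
Qed.
Let S_opp d : d \in S -> opp m d \in S.
Proof.
rewrite !inE => /orP[dA|/imfsetP[e /= eA ->]].
  by apply/orP; right; apply/imfsetP; exists d.
by rewrite oK ?eA//; apply: within_dart; exact/inA.
Qed.
Let A_vertex d e : d \in A -> vertex m d e -> e \in S.
Proof.
move=> /inA wd [k _ <-]; rewrite inE; apply/orP; left; apply/inA.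
by elim: k => //= k; exact: within_nxt.
Qed.

Let sum_opp (h : nat -> R) : \sum_(e <- S) h (opp m e) = \sum_(e <- S) h e.
Proof.
rewrite -(big_map (opp m) xpredT h); apply: perm_big; apply: uniq_perm.
- rewrite map_inj_in_uniq ?fset_uniq// => x y xS yS E.
  by rewrite -(oK (SD xS)) E oK//; exact: SD.
- exact: fset_uniq.
- move=> x; apply/mapP/idP => [[y yS ->]|xS]; first exact: S_opp.
  by exists (opp m x); [exact: S_opp|rewrite oK//; exact: SD].
Qed.

(** The test function of the Caccioppoli argument. As [u] vanishes on [v], it is supported where [u]
    is harmonic, inside the ball that carries [g]. *)
Let c e := u e * g e ^+ 2.

Let c_eq d e : darts m d -> vertex m d e -> c e = c d.
Proof. by move=> dd de; rewrite /c (u_eq dd de) (vertex_invariant g_nxt dd de). Qed.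

Let c_nz e : e \in S -> c e != 0 -> e \in A /\ ~ v e.
Proof.
move=> eS ce; split.
  apply/inA; apply: contrapT => h; move: ce.
  by rewrite /c (g_supp (SD eS) h) expr2 !mulr0 eqxx.
by move=> ve; move: ce; rewrite /c u_v// mul0r eqxx.
Qed.

Let vs_S e (h : nat -> R) : e \in S -> c e != 0 ->
  \sum_(f <- vs e) h f = \sum_(f <- S | f \in vs e) h f.
Proof.
move=> eS ce; rewrite -[RHS]big_filter; apply: perm_big; apply: uniq_perm.
- exact: fset_uniq.
- by rewrite filter_uniq// fset_uniq.
- move=> f; rewrite mem_filter; apply/idP/andP => [fe|[]//]; split => //.
  have [eA _] := c_nz eS ce; apply: A_vertex eA _; exact/(in_vs _ (SD eS)).
Qed.

(** Harmonicity tested against [c]: replace [u e] by the average of [u (opp m f)] over the darts [f]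
    at the same vertex and exchange the sums; [c] being constant around vertices,
    [c f * u (opp m f)] comes back. *)
Let orth : \sum_(e <- S) c e * (u e - u (opp m e)) = 0.
Proof.
under eq_bigr do rewrite mulrBr.
rewrite sumrB; apply/eqP; rewrite subr_eq0; apply/eqP.
pose k e : R := (#|` vs e|)%:R.
transitivity (\sum_(e <- S) \sum_(f <- S | f \in vs e) c e / k e * u (opp m f)).
  rewrite big_seq [RHS]big_seq; apply: eq_bigr => e eS.
  have [c0|ce] := eqVneq (c e) 0; first by rewrite c0 mul0r big1// => f _; rewrite !mul0r.
  have [eA nv] := c_nz eS ce; rewrite (u_harmonic (SD eS) nv) /vavg -mulr_sumr -vs_S//.
  by rewrite -/(k e); ring.
rewrite (exchange_big_dep xpredT) //= big_seq [RHS]big_seq; apply: eq_bigr => f fS.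
have df := SD fS; rewrite big_mkcond /=.
rewrite (eq_big_seq (fun e => if e \in vs f then c f / k f * u (opp m f) else 0)); last first.
  move=> e eS; have de := SD eS; have -> : (f \in vs e) = (e \in vs f).
    by apply/idP/idP => [/(in_vs _ de)/(vertex_sym de)|/(in_vs _ df)/(vertex_sym df)] h;
      apply/in_vs.
  case: ifP => // /(in_vs _ df) h; congr (_ / _ * _); first exact: c_eq.
  by rewrite /k /vs (vertex_eq df h).
have [c0|cf] := eqVneq (c f) 0.
  by rewrite c0 [RHS]mul0r big1// => e _; rewrite !mul0r if_same.
rewrite -big_mkcond /= -vs_S// big_const_seq count_predT iter_addr_0 -[_ *+ _]mulr_natr.
by rewrite mulrAC -/(k f) divfK// gt_eqF// vs_gt0.
Qed.

(** Testing with [u * g ^ 2] bounds all the terms [(u e - u (opp m e)) ^ 2] weighted by [g ^ 2] by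
    the energy of [g]; a single one is kept. The bounds [0 <= u <= 1] make the constant independent
    of the support of [g]. *)
Lemma caccioppoli x : darts m x ->
  (u x - u (opp m x)) ^+ 2 * (g x ^+ 2 + g (opp m x) ^+ 2) <= 8 * eps.
Proof.
move=> dx; have eps0 : 0 <= eps.
  by apply: le_trans (g_energy (s := [::]) _ _) => //; rewrite big_nil.
have [xS|xS] := boolP (x \in S); last first.
  have gx y : darts m y -> y \notin S -> g y = 0.
    move=> dy yS; apply: g_supp => // wy; case/negP: yS.
    by rewrite inE; apply/orP; left; exact/inA.
  have oxS : opp m x \notin S by apply: contra xS => /S_opp; rewrite oK.
  by rewrite !gx ?expr2 ?mulr0 ?addr0 ?mulr0 ?mulr_ge0//; exact: oD.
pose Y e := (u e - u (opp m e)) ^+ 2 * (g e ^+ 2 + g (opp m e) ^+ 2).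
have Y0 e : 0 <= Y e by rewrite mulr_ge0 ?addr_ge0 ?sqr_ge0.
apply: (@le_trans _ _ (\sum_(e <- S) Y e)).
  by rewrite (bigD1_seq x) ?fset_uniq//= lerDl sumr_ge0.
have pt e : e \in S -> Y e <= 4 * ((u e - u (opp m e)) * (c e - c (opp m e))) +
    8 * (g e - g (opp m e)) ^+ 2.
  move=> eS; rewrite /Y /c.
  have := u_bounds (SD eS); have := u_bounds (oD (SD eS)).
  move: (u e) (u (opp m e)) (g e) (g (opp m e)) => a b p q /andP[b0 b1] /andP[a0 a1].
  have h1 : 0 <= ((a - b) * (p + q) / 2 + (a + b) * (p - q)) ^+ 2 by exact: sqr_ge0.
  have h2 : 0 <= (a - b) ^+ 2 * (p - q) ^+ 2 by rewrite mulr_ge0 ?sqr_ge0.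
  have h3 : 0 <= (4 - (a + b) ^+ 2) * (p - q) ^+ 2.
    rewrite mulr_ge0 ?sqr_ge0// subr_ge0 (_ : 4 = 2 ^+ 2); last by ring.
    by rewrite lerXn2r ?nnegrE//; lra.
  rewrite -subr_ge0.
  (* Completing squares: the difference of the two sides is a combination of squares, nonnegative
     because [a + b] lies between 0 and 2. *)
  have -> : 4 * ((a - b) * (a * p ^+ 2 - b * q ^+ 2)) + 8 * (p - q) ^+ 2 -
      (a - b) ^+ 2 * (p ^+ 2 + q ^+ 2) =
    2 * ((a - b) * (p + q) / 2 + (a + b) * (p - q)) ^+ 2 +
    (a - b) ^+ 2 * (p - q) ^+ 2 / 2 + 2 * ((4 - (a + b) ^+ 2) * (p - q) ^+ 2) by field.
  by lra.
apply: (@le_trans _ _ (\sum_(e <- S) (4 * ((u e - u (opp m e)) * (c e - c (opp m e))) +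
    8 * (g e - g (opp m e)) ^+ 2))).
  by rewrite big_seq [leRHS]big_seq; apply: ler_sum => e eS; exact: pt.
rewrite big_split /= -!mulr_sumr (_ : \sum_(e <- S) _ * _ = 0) ?mulr0 ?add0r.
  by rewrite ler_wpM2l//; apply: g_energy; [exact: fset_uniq|exact: SD].
transitivity (\sum_(e <- S) c e * (u e - u (opp m e)) +
    \sum_(e <- S) c (opp m e) * (u (opp m e) - u (opp m (opp m e)))).
  rewrite -big_split /= big_seq [RHS]big_seq; apply: eq_bigr => e eS.
  by rewrite (oK (SD eS)); ring.
by rewrite (sum_opp (fun e => c e * (u e - u (opp m e)))) orth addr0.
Qed.

End caccioppoli.

(** A function of small energy loses little at each step from the root, so near a given edge it is
    close to one and [caccioppoli] forces the increment of [u] to vanish there. Thus [u] is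
    constant, and it is zero at [v]. *)
Lemma avoid_limit_zero : (forall eps : R, 0 < eps -> exists r, flat m r eps) ->
  forall d, darts m d -> u d = 0.
Proof.
move=> fl.
have near1 (delta : R) (g : nat -> R) : 0 < delta -> (forall d, darts m d -> g (nxt m d) = g d) ->
    g (root m) = 1 ->
    (forall s : seq nat, uniq s -> (forall d, d \in s -> darts m d) ->
          \sum_(d <- s) (g d - g (opp m d)) ^+ 2 <= delta ^+ 2) ->
    forall k d, within m k d -> `|1 - g d| <= k%:R * delta :> R.
  move=> del0 gn gr ge_ k; elim: k => [|k IH] d /=.
    by move=> wd; rewrite (vertex_invariant gn dr wd) gr subrr normr0 mul0r.
  move=> [/IH h|[e we ve]].
    by apply: (le_trans h); rewrite ler_pM2r// ler_nat.
  have de := within_dart we; rewrite (vertex_invariant gn (oD de) ve).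
  have := ge_ [:: e] isT; rewrite big_seq1 => /(_ _) h.
  have {}h : `|g e - g (opp m e)| <= delta.
    rewrite -(@ler_pXn2r _ 2) ?nnegrE ?(ltW del0)// real_normK ?num_real//; apply: h.
    by move=> x; rewrite inE => /eqP ->.
  have -> : 1 - g (opp m e) = (1 - g e) + (g e - g (opp m e)) by ring.
  apply: (le_trans (ler_normD _ _)); rewrite -natr1 mulrDl mul1r lerD//; exact: IH.
have step d : darts m d -> u d = u (opp m d).
  move=> dd; have [k wk] := con dd; apply/eqP; rewrite -subr_eq0 -normr_eq0.
  apply: contraT => nz; have pos : 0 < `|u d - u (opp m d)| by rewrite lt0r nz normr_ge0.
  set z := `|_| in pos.
  (* The second bound keeps [g d >= 1 / 2]; then [z ^ 2 / 4 <= 8 * delta ^ 2], which contradicts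
     [delta <= z / 7]. *)
  pose delta := Num.min (z / 7) ((2 * k.+1%:R)^-1).
  have del0 : 0 < delta by rewrite lt_min divr_gt0//= invr_gt0 mulr_gt0.
  have del1 : delta <= z / 7 by rewrite ge_min lexx.
  have del2 : delta <= (2 * k.+1%:R)^-1 by rewrite ge_min lexx orbT.
  have [r [g [gn gr gs ge_]]] := fl (delta ^+ 2) (exprn_gt0 _ del0).
  have := near1 delta g del0 gn gr ge_ k d wk.
  have kd : k%:R * delta <= 1 / 2.
    apply: (@le_trans _ _ (k.+1%:R * (2 * k.+1%:R)^-1)).
      by rewrite ler_pM// ?(ltW del0)// ler_nat.
    by rewrite invfM mulrCA mulfV ?mulr1 ?mul1r// pnatr_eq0.
  move=> /le_trans/(_ kd); rewrite ler_norml => /andP[_ g1].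
  have := caccioppoli gn gs ge_ dd; rewrite -real_normK ?num_real// -/z.
  have : (1 / 2) ^+ 2 <= g d ^+ 2 by rewrite lerXn2r ?nnegrE//; lra.
  have : delta ^+ 2 <= (z / 7) ^+ 2 by rewrite lerXn2r ?nnegrE ?(ltW del0)// divr_ge0// ltW.
  have := sqr_ge0 (g (opp m d)); have z2 : 0 < z ^+ 2 by rewrite exprn_gt0.
  move=> h1 h2 h3 h4.
  have : z ^+ 2 * (1 / 4) <= z ^+ 2 * (g d ^+ 2 + g (opp m d) ^+ 2).
    by rewrite ler_pM2l//; move: h3; rewrite expr2; lra.
  move: h2; rewrite expr_div_n; lra.
have ur k d : within m k d -> u d = u (root m).
  elim: k d => [|k IH] d /=; first by move=> /(u_eq dr).
  move=> [/IH//|[e we /(u_eq (oD (within_dart we))) ->]].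
  by rewrite -step; [exact: IH|exact: within_dart we].
have u0 : u d0 = 0 by apply: u_v; exact: vertex_refl.
have [k0 w0] := con dd0; move=> d /con[k wk].
by rewrite (ur _ _ wk) -(ur _ _ w0).
Qed.

(** * From avoidance probabilities to the random walk *)

Section walk.
Variables (disp : measure_display) (Omega : measurableType disp) (Pr : probability Omega R).
Variable X : nat -> Omega -> set nat.
Hypothesis X_srw : is_srw m v Pr X.
Hypothesis u0 : forall d, darts m d -> u d = 0.

Let Xm n y : measurable [set w | X n w = y]. Proof. by case: X_srw. Qed.
Let p E : R := fine (Pr E).
Let pE E : measurable E -> Pr E = (p E)%:E.
Proof. by move=> mE; rewrite /p fineK//; exact: fin_num_measure. Qed.
Let p_ge0 E : measurable E -> 0 <= p E.
Proof. by move=> mE; rewrite -lee_fin -pE. Qed.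
Let p_mono E F : measurable E -> measurable F -> E `<=` F -> p E <= p F.
Proof. by move=> mE mF EF; rewrite -lee_fin -!pE// le_measure ?inE. Qed.

Let meas_all (P : nat -> Prop) (F : nat -> set Omega) : (forall i, measurable (F i)) ->
  measurable [set w | forall i, P i -> F i w].
Proof.
move=> mF; have -> : [set w | forall i, P i -> F i w] = \bigcap_i [set w | P i -> F i w].
  by apply/seteqP; split => [w h i _|w h i]; [exact: h|exact: h i I].
apply: bigcapT_measurable => i; have [Pi|nPi] := pselect (P i).
  by rewrite (_ : [set w | _] = F i)//; apply/seteqP; split => w /=; auto.
by rewrite (_ : [set w | _] = setT)//; apply/seteqP; split => w //=.
Qed.

Let prefix x n := [set w | forall i, (i <= n)%N -> X i w = x i].
Let avoids n := [set w | forall i, (n < i)%N -> X i w <> v].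
Let avoids_to n k := [set w | forall i, (n < i <= n + k)%N -> X i w <> v].
Let prefix_meas x n : measurable (prefix x n). 
Proof. by apply: (@meas_all _ (fun i => [set w | X i w = x i])). Qed.
Let avoids_meas n : measurable (avoids n).
Proof. by apply: (@meas_all _ (fun i => ~` [set w | X i w = v])) => i; exact: measurableC. Qed.
Let avoids_to_meas n k : measurable (avoids_to n k).
Proof. by apply: (@meas_all _ (fun i => ~` [set w | X i w = v])) => i; exact: measurableC. Qed.
Let outside j (ys : seq (set nat)) := [set w | X j w \notin ys].
Let outside_meas j ys : measurable (outside j ys).
Proof.
elim: ys => [|y ys IH].
  by rewrite (_ : outside j [::] = setT)//; apply/seteqP.
rewrite (_ : outside j (y :: ys) = outside j ys `&` ~` [set w | X j w = y]).
  by apply: measurableI => //; exact: measurableC.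
apply/seteqP; split => w; rewrite /outside /= inE negb_or.
  by move=> /andP[/eqP ? ?]; split.
by move=> [-> /eqP ->].
Qed.

(** Positions range over all sets of darts, so a decomposition over finitely many of them keeps a
    remainder. When [ys] lists the neighbours of the current position, the remainder is null by
    [prefix_nbrs]. *)
Let p_split j ys E : uniq ys -> measurable E ->
  p E = \sum_(y <- ys) p (E `&` [set w | X j w = y]) + p (E `&` outside j ys).
Proof.
move=> + mE; elim: ys => [|y ys IH] /= => [_|/andP[yys us]].
  rewrite big_nil add0r; congr p; apply/seteqP; split => [w Ew|w []//].
  by split.
rewrite big_cons IH//; rewrite -addrA addrCA; congr +%R.
have mO : measurable (E `&` outside j ys) by exact: measurableI.
apply: EFin_inj; rewrite EFinD -!pE//; last 2 first.
- by apply: measurableI.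
- by apply: measurableI.
rewrite (measureDI _ mO (Xm j y)) addeC; congr (Pr _ + Pr _)%E.
  apply/seteqP; split => w; rewrite /outside /= inE negb_or.
    by move=> [[Ew ->] /eqP ->].
  by move=> [Ew /andP[/eqP ? ->]].
apply/seteqP; split => w; first by move=> [[]].
by move=> [Ew /= Xy]; rewrite /outside /= Xy.
Qed.

Let nbrs d := undup [seq vertex m (opp m e) | e <- vs d].

Let step_count d y : darts m d ->
  srw_step R m (vertex m d) y =
  (count_mem y [seq vertex m (opp m e) | e <- vs d])%:R / (#|` vs d|)%:R.
Proof.
move=> dd; rewrite /srw_step; congr (_%:R / _).
rewrite count_map -size_filter -card_of_uniq; last by rewrite filter_uniq// fset_uniq.
congr card_of; apply/seteqP; split => e /=.
  by move=> [/(in_vs _ dd) h1 h2]; rewrite mem_filter /= h2 eqxx h1.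
by rewrite mem_filter /= => /andP[/eqP -> /(in_vs _ dd)].
Qed.

Let step_sum (h : set nat -> R) d : darts m d ->
  \sum_(y <- nbrs d) srw_step R m (vertex m d) y * h y =
  vavg (fun e => h (vertex m (opp m e))) d.
Proof.
move=> dd; rewrite /vavg -(big_map (fun e => vertex m (opp m e)) xpredT h).
rewrite -[in RHS]big_undup_iterop_count mulr_suml; apply: eq_bigr => y _.
rewrite step_count// Monoid.iteropE iter_addr_0 -[h y *+ _]mulr_natr.
by rewrite mulrAC [h y * _]mulrC.
Qed.

Let ext (x : nat -> set nat) n y := fun i => if (i <= n)%N then x i else y.

Let prefix_ext x n y : prefix (ext x n y) n.+1 = prefix x n `&` [set w | X n.+1 w = y].
Proof.
apply/seteqP; split => w /=.
  move=> h; split => [i ni|]; first by rewrite h ?leqW// /ext ni.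
  by rewrite h// /ext ltnn.
by move=> [h1 h2] i; rewrite leq_eqVlt /ext => /predU1P[->|]; rewrite ?ltnn// ltnS => ni; rewrite ni h1.
Qed.

Let p_ext x n y :
  p (prefix (ext x n y) n.+1) = p (prefix x n) * srw_step R m (x n) y.
Proof.
apply: EFin_inj; rewrite EFinM -!pE//; case: X_srw => _ h.
rewrite /prefix !h -EFinM big_ord_recr /= mulrA; congr (_ * _ * _)%:E; last first.
  by rewrite /ext leqnn ltnn.
by apply: eq_bigr => i _; rewrite /ext /= ltnW ?ltn_ord.
Qed.

(** The transition probabilities to the neighbours already add up to one. *)
Let prefix_nbrs x n d : darts m d -> x n = vertex m d ->
  p (prefix x n `&` outside n.+1 (nbrs d)) = 0.
Proof.
move=> dd xn; have := p_split n.+1 (undup_uniq _ : uniq (nbrs d)) (prefix_meas x n).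
under eq_bigr do rewrite -prefix_ext p_ext xn -[_ * srw_step _ _ _ _]mulr1 -mulrA.
rewrite -mulr_sumr (step_sum (fun=> 1) dd) vavg_const// mulr1.
by rewrite -[LHS]addr0 => /addrI.
Qed.

Let nbrs_dart d y : darts m d -> y \in nbrs d ->
  exists e, darts m e /\ y = vertex m e.
Proof.
move=> dd; rewrite mem_undup => /mapP[e /(in_vs _ dd) de ->].
by exists (opp m e); split => //; exact: oD (vertex_dart dd de).
Qed.

(* The Markov property: the walk is decomposed according to its position at time [n.+1]. *)
Let p_avoids_to k n x d : darts m d -> x n = vertex m d ->
  p (prefix x n `&` avoids_to n k) <=
  p (prefix x n) * (if k is k'.+1 then vavg (fun e => avoid k' (opp m e)) d else 1).
Proof.
elim: k n x d => [|k IH] n x d dd xn.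
  by rewrite mulr1; apply: p_mono => //; exact: measurableI.
have mE : measurable (prefix x n `&` avoids_to n k.+1) by exact: measurableI.
pose H (y : set nat) := avoid k (xget 0%N y).
have HE e : darts m e -> H (vertex m e) = avoid k e.
  move=> de; rewrite /H; case: xgetP => [z _ /(avoid_eq k de)//|/(_ e)[]].
  exact: vertex_refl.
have -> : vavg (fun e => avoid k (opp m e)) d = vavg (fun e => H (vertex m (opp m e))) d.
  rewrite /vavg; congr (_ / _); rewrite big_seq [RHS]big_seq; apply: eq_bigr => e.
  by move=> /(in_vs _ dd) de; rewrite HE//; exact: oD (vertex_dart dd de).
rewrite (p_split n.+1 (undup_uniq _ : uniq (nbrs d)) mE).
rewrite [X in _ + X](_ : _ = 0) ?addr0; last first.
  apply/eqP; rewrite eq_le p_ge0 ?andbT; last exact: measurableI.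
  rewrite -(prefix_nbrs dd xn); apply: p_mono; [exact: measurableI|exact: measurableI|].
  by move=> w [[? _] ?].
rewrite -(step_sum H dd) mulr_sumr big_seq [leRHS]big_seq; apply: ler_sum => y yn.
have [e [de ye]] := nbrs_dart dd yn.
rewrite mulrA -xn -p_ext ye HE//.
have [ve|nve] := pselect (v e).
  rewrite (_ : _ `&` _ = set0); last first.
    apply/seteqP; split => w // [[_ /(_ n.+1)] /= h] /= Xn; apply: h.
      by rewrite ltnS leqnn addnS ltnS leq_addr.
    by rewrite Xn; exact: vertex_eq.
  rewrite /p measure0; apply: mulr_ge0; first exact: p_ge0.
  by have /andP[] := avoid_bounds k de.
have -> : avoid k e = if k is k'.+1 then vavg (fun f => avoid k' (opp m f)) e else 1.
  by case: (k) => [|k'] /=; rewrite asboolF.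
apply: le_trans (IH n.+1 (ext x n (vertex m e)) e de _); last by rewrite /ext ltnn.
apply: p_mono; [exact: measurableI|exact: measurableI|].
rewrite prefix_ext => w [[pw aw] Xw]; split => //.
by move=> i /andP[h1 h2]; apply: aw; rewrite (ltn_trans _ h1)//= addnS -addSn.
Qed.

Let p_avoids n x d : darts m d -> x n = vertex m d -> p (prefix x n `&` avoids n) = 0.
Proof.
move=> dd xn; have mE : measurable (prefix x n `&` avoids n) by exact: measurableI.
apply/eqP; rewrite eq_le p_ge0// andbT.
have c := vavg_cvg dd.
have E : vavg (fun e => u (opp m e)) d = 0.
  rewrite -[RHS](vavg_const 0 dd) /vavg; congr (_ / _); rewrite big_seq [RHS]big_seq.
  by apply: eq_bigr => e /(in_vs _ dd) de; apply: u0; exact: oD (vertex_dart dd de).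
rewrite E in c; have {}c : (fun k => p (prefix x n) * vavg (fun e => avoid k (opp m e)) d) @ \oo --> (0 : R).
  by rewrite -(mulr0 (p (prefix x n))); apply: cvgMl_tmp c.
apply: (cvgr_to_ge c); apply: nearW => k.
apply: le_trans (p_avoids_to k.+1 dd xn); apply: p_mono => //; first exact: measurableI.
by move=> w [pw aw]; split => // i /andP[ni _]; exact: aw.
Qed.

(** [p_avoids] treats avoidance from the end of the prefix on; here the prefix is lengthened one
    step at a time up to [n + j]. *)
Let p_avoids_after j n x d : darts m d -> x n = vertex m d ->
  p (prefix x n `&` avoids (n + j)) = 0.
Proof.
elim: j n x d => [|j IH] n x d dd xn; first by rewrite addn0; exact: p_avoids xn.
have mE : measurable (prefix x n `&` avoids (n + j.+1)) by exact: measurableI.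
rewrite (p_split n.+1 (undup_uniq _ : uniq (nbrs d)) mE).
rewrite [X in _ + X](_ : _ = 0) ?addr0; last first.
  apply/eqP; rewrite eq_le p_ge0 ?andbT; last exact: measurableI.
  rewrite -(prefix_nbrs dd xn); apply: p_mono; [exact: measurableI|exact: measurableI|].
  by move=> w [[? _] ?].
rewrite big_seq big1// => y yn; have [e [de ye]] := nbrs_dart dd yn.
rewrite setIAC -prefix_ext addnS -addSn; apply: IH de _.
by rewrite /ext ltnn.
Qed.

Let avoids_zero N : Pr (avoids N) = 0%E.
Proof.
have p0 : p (prefix (fun=> v) 0) = 1.
  by rewrite /p; case: X_srw => _ h; rewrite /prefix h big_ord0 asboolT//= mulr1.
rewrite pE// (_ : p _ = p (avoids N `&` prefix (fun=> v) 0) +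
    p (avoids N `\` prefix (fun=> v) 0)); last first.
  apply: EFin_inj; rewrite EFinD -!pE//; [|exact: measurableD|exact: measurableI].
  by rewrite (measureDI _ (avoids_meas N) (prefix_meas (fun=> v) 0)) addeC.
rewrite setIC -[N]add0n (p_avoids_after N dd0)// add0r; congr EFin.
(* The walk starts at [v] almost surely, because the path of length zero at [v] has probability one;
   the rest of the event is null. *)
have mD : measurable (avoids (0 + N) `\` prefix (fun=> v) 0) by exact: measurableD.
apply/eqP; rewrite eq_le p_ge0// andbT.
have -> : 0 = p (~` prefix (fun=> v) 0).
  apply: EFin_inj; rewrite -pE; last exact: measurableC.
  by rewrite probability_setC// pE// p0 subee.
by apply: p_mono => //; exact: measurableC.
Qed.

Lemma walk_returns : {ae Pr, forall w, forall N, exists2 n, (N <= n)%N & X n w = v}.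
Proof.
apply: (@negligibleS _ _ _ _ (\bigcup_N avoids N)); last first.
  by apply: negligible_bigcup => N; exists (avoids N); split; [exact: avoids_meas|exact: avoids_zero|].
move=> w /= /existsNP[N h]; exists N => // i Ni E; apply: h; exists i => //.
exact: ltnW.
Qed.

End walk.
End infinite_map.

Lemma flat_recurrent (R : realType) (m : smap) : is_map m ->
  (forall eps : R, 0 < eps -> exists r, flat m r eps) -> srw_recurrent R m.
Proof.
move=> mm fl _ [d0 dd0 <-] disp Omega Pr X sX; apply: (walk_returns mm dd0 sX).
exact: avoid_limit_zero.
Qed.

(** * Local topology *)

Definition iso_by (f : nat -> nat) (m m' : smap) : Prop :=
  [/\ set_bij (darts m) (darts m') f, f (root m) = root m'
    & forall d, darts m d ->
        [/\ f (opp m d) = opp m' (f d), f (nxt m d) = nxt m' (f d)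
          & spin m' (f d) = spin m d]].

Lemma iso_by_comp f g m1 m2 m3 : iso_by f m1 m2 -> iso_by g m2 m3 -> iso_by (g \o f) m1 m3.
Proof.
move=> [bf rf fE] [bg rg gE]; split; first exact: set_bij_comp bf bg.
  by rewrite /= rf rg.
move=> d dd /=; have [f1 f2 f3] := fE _ dd.
have dfd : darts m2 (f d) by case: bf => h _ _; exact: h.
have [g1 g2 g3] := gE _ dfd.
by rewrite f1 f2 g1 g2 g3 f3.
Qed.

Lemma iso_by_inv f m m' : darts m (root m) ->
  (forall d, darts m d -> darts m (opp m d) /\ darts m (nxt m d)) -> iso_by f m m' ->
  exists g, [/\ iso_by g m' m, forall d, darts m d -> g (f d) = d &
                forall e, darts m' e -> f (g e) = e].
Proof.
move=> dr cl [[fun_f inj_f surj_f] rf fE].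
pose g e := xget 0%N [set d | darts m d /\ f d = e].
have gP e : darts m' e -> darts m (g e) /\ f (g e) = e.
  move=> /surj_f[d dd fd].
  by rewrite /g; case: xgetP => [x _ //|/(_ d)[]].
have fK d : darts m d -> g (f d) = d.
  move=> dd; have [h1 h2] := gP _ (fun_f _ dd).
  by apply: inj_f; rewrite ?inE.
exists g; split => // [|e /gP[]//]; split.
- split.
  + by move=> e /gP[].
  + move=> x y; rewrite !inE => /gP[_ {2}<-] /gP[_ {2}<-] -> //.
  + by move=> d dd; exists (f d); [exact: fun_f|exact: fK].
- by rewrite -rf fK.
- move=> e /gP[dg fg]; have [h1 h2 h3] := fE _ dg; have [h4 h5] := cl _ dg; split.
  + by rewrite -[in LHS]fg -h1 fK.
  + by rewrite -[in LHS]fg -h2 fK.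
  + by rewrite -h3 fg.
Qed.

Lemma map_iso_sym m m' : darts m (root m) ->
  (forall d, darts m d -> darts m (opp m d) /\ darts m (nxt m d)) ->
  map_iso m m' -> map_iso m' m.
Proof. by move=> dr cl [f /(iso_by_inv dr cl)[g [gi _ _]]]; exists g. Qed.

Section ball.
Variable m : smap.
Hypothesis mm : is_map m.
Variable r : nat.

Lemma within_ball k d : (k < r)%N -> within m k d -> darts (mball m r) d.
Proof.
move=> kr wd; split; first exact: within_dart mm _ _ wd.
by left; exists k, d; split => //; exists 0%N.
Qed.

(** All darts at a vertex at distance less than [r] belong to the ball, so [next_in] skips none of
    them there. *)
Lemma ball_nxt k d : (k < r)%N -> within m k d -> nxt (mball m r) d = nxt m d.
Proof.
move=> kr wd; rewrite /= /next_in; case: xgetP => [x _ [[|[|j]] []]//|/(_ (nxt m d))[]].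
  move=> _ _ _ /(_ 1%N isT)[]; exact: (within_ball kr (within_nxt wd)).
by exists 1%N; split => // [|[]//]; exact: (within_ball kr (within_nxt wd)).
Qed.

Lemma ball_closed d : darts (mball m r) d ->
  darts (mball m r) (opp m d) /\ darts (mball m r) (nxt (mball m r) d).
Proof.
have [_ _ om _ _] := mm => dd; split.
  by case: dd => dd [h|h]; have [od oK _] := om _ dd; split => //; [right; rewrite oK|left].
by rewrite /= /next_in; case: xgetP => [x _ [k []]//|_].
Qed.

Lemma within_nxtE k d : darts m d -> within m k (nxt m d) -> within m k d.
Proof.
move=> dd wn; have [j _ <-] : vertex m (nxt m d) d.
  by apply: vertex_sym => //; exists 1%N.
by elim: j => //= j; exact: within_nxt.
Qed.

End ball.

Section ball_iso.
Variables (m m' : smap) (r : nat) (f : nat -> nat).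
Hypotheses (mm : is_map m) (mm' : is_map m').
Hypothesis fi : iso_by f (mball m r) (mball m' r).

Let fo k d : (k < r)%N -> within m k d -> f (opp m d) = opp m' (f d).
Proof. by move=> kr /(within_ball mm kr); case: fi => _ _ fE /fE[]. Qed.

Let fn k d : (k < r)%N -> within m k d -> within m' k (f d) -> f (nxt m d) = nxt m' (f d).
Proof.
move=> kr wd wf; case: fi => _ _ fE; have [_ + _] := fE _ (within_ball mm kr wd).
by rewrite (ball_nxt mm kr wd) (ball_nxt mm' kr wf).
Qed.

Let fiter k d j : (k < r)%N -> within m k d -> within m' k (f d) ->
  [/\ f (iter j (nxt m) d) = iter j (nxt m') (f d), within m k (iter j (nxt m) d) &
      within m' k (iter j (nxt m') (f d))].
Proof.
move=> kr wd wf; elim: j => //= j [e h1 h2].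
split; [|exact: within_nxt|exact: within_nxt].
by rewrite (fn kr h1) ?e.
Qed.

Lemma ball_iso_within k d : (k < r)%N -> within m k d -> within m' k (f d).
Proof.
have fr : f (root m) = root m' by case: fi.
elim: k d => [|k IH] d kr.
  move=> [j _ <-]; have w0 : within m 0 (root m) by exists 0%N.
  have w0' : within m' 0 (f (root m)) by rewrite fr; exists 0%N.
  by have [-> _ h] := fiter j kr w0 w0'.
move=> [/(IH _ (ltnW kr)) h|[e we [j _ <-]]]; first by left.
have h := IH _ (ltnW kr) we.
have oe := fo (ltnW kr) we.
have w' : within m' k.+1 (f (opp m e)) by rewrite oe; exact: within_opp.
by have [-> _ h1] := fiter j kr (within_opp we) w'.
Qed.

Lemma ball_iso_nxt k d : (k < r)%N -> within m k d -> f (nxt m d) = nxt m' (f d).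
Proof. by move=> kr wd; apply: fn (kr) (wd) _; exact: ball_iso_within. Qed.

End ball_iso.

(** The witness is carried over by the isomorphism of balls and extended by zero. The margin
    [r.+1 < r'] is there because an edge leaving the support ends at distance [r + 1], where the
    rotation of the ball must still be that of the map. *)
Lemma flat_local (R : realType) m m' r r' (eps : R) : is_map m -> is_map m' ->
  map_iso (mball m r') (mball m' r') -> (r.+1 < r')%N -> flat m' r eps -> flat m r eps.
Proof.
move=> mm mm' [f fi] rr' [g [gn gr gs ge_]].
have rr : (r < r')%N by exact: ltnW.
have cl d : darts (mball m r') d ->
    darts (mball m r') (opp (mball m r') d) /\ darts (mball m r') (nxt (mball m r') d).
  exact: ball_closed.
have [h [hi hf fh]] : exists h, [/\ iso_by h (mball m' r') (mball m r'),
    forall d, darts (mball m r') d -> h (f d) = d &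
    forall e, darts (mball m' r') e -> f (h e) = e].
  apply: iso_by_inv cl fi; apply: (@within_ball m mm r' 0 (root m)) => //.
    exact: leq_ltn_trans rr.
  by exists 0%N.
have fw k d : (k < r')%N -> within m k d -> within m' k (f d).
  by move=> kr; exact: (ball_iso_within mm mm' fi).
have hw k d : (k < r')%N -> within m' k d -> within m k (h d).
  by move=> kr; exact: (ball_iso_within mm' mm hi).
have [fb fr fE] := fi; have [fun_f inj_f _] := fb.
pose G d := if `[< within m r d >] then g (f d) else 0.
have GE d : within m r.+1 d -> G d = g (f d).
  move=> wd; rewrite /G; case: asboolP => // nw; rewrite gs//.
    by apply: (within_dart mm' (k := r.+1)); exact: fw.
  move=> wf; apply: nw; rewrite -(hf d); first exact: hw.
  exact: (within_ball mm rr' wd).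
exists G; split.
- move=> d dd; rewrite /G; have [wd|nd] := pselect (within m r d).
    rewrite !asboolT//; last exact: within_nxt.
    rewrite (ball_iso_nxt mm mm' fi rr wd) gn//.
    by apply: (within_dart mm' (k := r)); exact: fw.
  by rewrite !asboolF// => /(within_nxtE mm dd).
- rewrite GE ?fr//; apply: (@within_le m 0) => //; by exists 0%N.
- by move=> d dd nw; rewrite /G asboolF.
- move=> s us sd; pose s' := [seq d <- s | `[< within m r.+1 d >]].
  have -> : \sum_(d <- s) (G d - G (opp m d)) ^+ 2 =
      \sum_(d <- s') (G d - G (opp m d)) ^+ 2.
    rewrite big_filter [RHS]big_mkcond big_seq [RHS]big_seq; apply: eq_bigr => d ds.
    case: asboolP => // nw; rewrite /G !asboolF ?subrr ?expr2 ?mul0r//.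
      move=> /within_opp wo; apply: nw; have [_ _ om _ _] := mm.
      by have [_ <- _] := om _ (sd _ ds).
    by move=> /(within_le (leqnSn r)).
  have s'w d : d \in s' -> within m r.+1 d by rewrite mem_filter => /andP[/asboolP].
  have s'b d : d \in s' -> darts (mball m r') d by move=> /s'w; exact: within_ball.
  have wo d : d \in s' -> G (opp m d) = g (opp m' (f d)).
    move=> ds; have [<- _ _] := fE _ (s'b _ ds); have wd := s'w _ ds.
    have [wod|nwod] := pselect (within m r.+1 (opp m d)); first exact: GE.
    rewrite /G asboolF; last by move=> /(within_le (leqnSn r)).
    have ob : darts (mball m r') (opp m d) by have [] := ball_closed mm (s'b _ ds).
    have dfo : darts m' (f (opp m d)) by have [] := fun_f _ ob.
    rewrite gs// => wf; apply: nwod; rewrite -(hf _ ob); apply: within_le (leqnSn r) _.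
    exact: hw.
  rewrite (eq_big_seq (fun d => (g (f d) - g (opp m' (f d))) ^+ 2)); last first.
    by move=> d ds; rewrite GE ?wo//; exact: s'w.
  rewrite -(big_map f xpredT (fun d => (g d - g (opp m' d)) ^+ 2)); apply: ge_.
    rewrite map_inj_in_uniq; first by rewrite filter_uniq.
    by move=> x y xs ys; apply: inj_f; rewrite inE; exact: s'b.
  by move=> _ /mapP[d ds ->]; have [] := fun_f _ (s'b _ ds).
Qed.

Lemma rep_is_map t : is_map (rep t).
Proof. exact: tri_is_map. Qed.

Section flat_event.
Variable R : realType.

Lemma d_loc_ball (t t' : ising_tri) (k : nat) : d_loc R t t' < (1 + k%:R)^-1 ->
  exists2 r, (k < r)%N & map_iso (mball (rep t) r) (mball (rep t') r).
Proof.
move=> lt; apply: contrapT => h.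
set S := [set r : nat | map_iso (mball (rep t) r) (mball (rep t') r)].
have Sk r : S r -> (r <= k)%N by move=> Sr; rewrite leqNgt; apply/negP => kr; apply: h; exists r.
have e0 m d : darts (mball m 0) d -> False.
  by move=> [_ [[? [? []]]|[? [? []]]]].
(* The ball of radius 0 has no dart, so 0 is always an admissible radius and the supremum is not
   [-oo]. *)
have S0 : S 0%N.
  exists (fun=> root (rep t')); split => //; last by move=> d /e0.
  by split => [d /e0//|x y|d /e0//]; rewrite inE => /e0.
pose s := ereal_sup [set (r%:R : R)%:E | r in S].
have sk : (s <= k%:R%:E)%E.
  by apply: ge_ereal_sup => _ [r /Sk rk <-]; rewrite lee_fin ler_nat.
have s0 : (0 <= s)%E by apply: ereal_sup_ubound; exists 0%N.
have sf : s \is a fin_num.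
  by rewrite ge0_fin_numE//; apply: le_lt_trans sk _; exact: ltry.
move: lt; rewrite /d_loc -/S -/s -(fineK sf) -EFinD /= inver.
have f0 : 0 <= fine s by rewrite fine_ge0.
have fk : fine s <= k%:R by rewrite -lee_fin fineK.
have p1 : 0 < 1 + fine s by rewrite ltr_pwDl.
rewrite gt_eqF// /=; apply/negP; rewrite -leNgt lef_pV2 ?posrE ?lerD2l//.
Qed.

Lemma flat_open r (eps : R) : open ([set t | flat (rep t) r eps] : set (local_space R)).
Proof.
move=> t ft; exists (1 + r.+1%:R)^-1; first by rewrite invr_gt0 ltr_pwDl.
move=> t' /d_loc_ball[r' rr' h]; apply: flat_local ft; [exact: rep_is_map..| |exact: rr'].
apply: map_iso_sym h.
  apply: (@within_ball _ (rep_is_map t) r' 0) => //; last by exists 0%N.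
  exact: leq_ltn_trans rr'.
by move=> d; apply: ball_closed; exact: rep_is_map.
Qed.

Lemma not_flat_open r (eps : R) :
  open ([set t | ~ flat (rep t) r eps] : set (local_space R)).
Proof.
move=> t ft; exists (1 + r.+1%:R)^-1; first by rewrite invr_gt0 ltr_pwDl.
move=> t' /d_loc_ball[r' rr' h] ft'; apply: ft.
exact: (flat_local (rep_is_map t) (rep_is_map t') h rr' ft').
Qed.

Lemma not_flat_measurable r (eps : R) :
  measurable ([set t | ~ flat (rep t) r eps] : set (borel_space R)).
Proof. by apply: sub_sigma_algebra; exact: not_flat_open. Qed.

Lemma not_flat_cvg (nu : {posnum R}) (P : probability (borel_space R) R) r (eps : R) :
  IIPT_law nu P ->
  (fun n => ising_law nu n [set t | ~ flat (rep t) r eps]) @ \oo -->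
  P [set t | ~ flat (rep t) r eps].
Proof.
set U := [set t | _] => /(_ (\1_U)) h.
have c : continuous (\1_U : local_space R -> R).
  apply/continuousP => A _; rewrite preimage_indic.
  case: ifP => _; case: ifP => _.
  - exact: openT.
  - exact: not_flat_open.
  - have -> : ~` U = [set t | flat (rep t) r eps].
      by apply/seteqP; split => t /=; rewrite /U /= notK.
    exact: flat_open.
  - exact: open0.
have {}h := h c _.
have E (Q : probability (borel_space R) R) : (\int[Q]_t (\1_U t)%:E)%E = Q U.
  by rewrite integral_indic ?setIT//; exact: not_flat_measurable.
have -> : (fun n => ising_law nu n U) = (fun n => \int[ising_law nu n]_t (\1_U t)%:E)%E.
  by apply/funext => n; rewrite E.
rewrite -E; apply: h.
exists 1 => t; rewrite indicE; case: (t \in U); by rewrite /= ?normr1 ?normr0.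
Qed.

End flat_event.

(** * Ising weights *)

Lemma rep_inj t t' : map_iso (rep t) (rep t') -> t = t'.
Proof.
move=> h; rewrite -[t]reprK -[t']reprK; apply/eqmodP; exact/asboolP.
Qed.

Lemma presents_iso m m' (D : finType) (phi al : D -> D) sp r io :
  presents m phi al sp r io -> map_iso m m' ->
  exists io', presents m' phi al sp r io'.
Proof.
move=> [ioi ioR ior ioa [ion ios]] [f [[ff fi fs] fr fE]].
have dio d : darts m (io d) by rewrite -ioR; exists d.
exists (f \o io); split => /=.
- by move=> d e /= /fi h; apply: ioi; apply: h; rewrite inE.
- apply/seteqP; split => [_ [d _ <-]|x /fs[y + <-]]; first exact: ff.
  by rewrite -ioR => -[d _ <-]; exists d.
- by rewrite ior.
- by move=> d; rewrite ioa; have [-> _ _] := fE _ (dio d).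
- by split => d; have [_ h1 h2] := fE _ (dio d); rewrite ?h2 ?ion ?h1 ?ios.
Qed.

Lemma class_of_map m : finite_triangulation m -> exists t, map_iso m (rep t).
Proof.
move=> fm; pose T := Triangulation (or_introl fm); exists (tri_class T).
have : (\pi_({eq_quot tri_iso_equiv}) (repr (tri_class T : {eq_quot tri_iso_equiv})) =
  \pi_({eq_quot tri_iso_equiv}) T)%qT by rewrite reprK.
by move=> /eqmodP; rewrite /= tri_iso_sym => /asboolP.
Qed.

Lemma size_tri_presents n t : size_tri n t ->
  exists (D : finType) (phi al : D -> D) (sp : D -> bool) (r : D) (io : D -> nat),
  [/\ presents (rep t) phi al sp r io, tri_map_axioms phi al sp & #|D| = (6 * n)%N].
Proof.
move=> [/finite_triangulation_presents[D [phi [al [sp [r [io [pm tm]]]]]]] eE].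
exists D, phi, al, sp, r, io; split => //; have [[cm _] _ _ _] := tm.
by rewrite (presents_darts pm cm) eE; clear; lia.
Qed.

Lemma presents_size_tri n t (D : finType) (phi al : D -> D) sp r io :
  presents (rep t) phi al sp r io -> tri_map_axioms phi al sp -> #|D| = (6 * n)%N ->
  size_tri n t.
Proof.
move=> pm tm Dn; split; first exact: presents_finite_triangulation pm tm.
have [[cm _] _ _ _] := tm; have := presents_darts pm cm; rewrite Dn.
by move: (card_of _) => c; clear; lia.
Qed.

Lemma class_presents (D : finType) (phi al : D -> D) sp r : tri_map_axioms phi al sp ->
  exists t io, presents (rep t) phi al sp r io.
Proof.
move=> tm; have pm := smap_of_presents phi al sp r.
have [t it] := class_of_map (presents_finite_triangulation pm tm).
by have [io pt] := presents_iso pm it; exists t, io.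
Qed.

Section size_tri_finite.
Variable n : nat.

Let code_exists t : exists w : (6 * n).-tuple (bool * bool * bool), size_tri n t ->
  exists (D : finType) (phi al : D -> D) (sp : D -> bool) (r : D) (io : D -> nat),
  [/\ presents (rep t) phi al sp r io, tri_map_axioms phi al sp & codes phi al r sp w].
Proof.
have [st|] := pselect (size_tri n t); last by exists [tuple of nseq _ (true, true, true)].
have [D [phi [al [sp [r [io [pm tm Dn]]]]]]] := size_tri_presents st.
have [pl _ _ _] := tm; have [w cw] := codes_exist r sp pl.
have sw : size w == (6 * n)%N by case: cw => T [_ _ _ ->]; rewrite size_mkseq Dn.
by exists (Tuple sw) => _; exists D, phi, al, sp, r, io.
Qed.

Lemma size_tri_code : exists code : ising_tri -> (6 * n).-tuple (bool * bool * bool),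
  {in size_tri n &, injective code}.
Proof.
have [code h] := choice code_exists; exists code => t t'; rewrite !inE => st st' E.
have [D [phi [al [sp [r [io [pm tm cw]]]]]]] := h _ st.
have [D' [phi' [al' [sp' [r' [io' [pm' tm' cw']]]]]]] := h _ st'.
apply: rep_inj; have [pl _ _ _] := tm; have [pl' _ _ _] := tm'.
have [[_ ia _ _] _] := pl; have [[_ ia' _ _] _] := pl'.
apply/(rooted_iso_map_iso pm pm' ia ia'); rewrite E in cw; exact: codes_iso cw cw'.
Qed.

Lemma size_tri_finite : finite_set (size_tri n).
Proof.
have [code ci] := size_tri_code.
by rewrite -(eq_finite_set (inj_card_eq ci)); exact: finite_finset.
Qed.

End size_tri_finite.

Definition tris n : seq ising_tri := fset_set (size_tri n).

Lemma tris_uniq n : uniq (tris n). Proof. exact: fset_uniq. Qed.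

Lemma in_tris n t : t \in tris n <-> size_tri n t.
Proof. by rewrite /tris in_fset_set ?inE//; exact: size_tri_finite. Qed.

Lemma size_tris n : (size (tris n) <= 8 ^ (6 * n))%N.
Proof.
have [code ci] := size_tri_code n.
rewrite -(size_map code).
have u : uniq (map code (tris n)).
  by rewrite map_inj_in_uniq ?tris_uniq// => x y /in_tris hx /in_tris hy; apply: ci; rewrite inE.
rewrite -(card_uniqP u); apply: leq_trans (max_card _) _.
by rewrite card_tuple !card_prod card_bool.
Qed.

Definition root_degree t : nat := card_of (vertex (rep t) (root (rep t))).

Lemma presents_root_degree t (D : finType) (phi al : D -> D) sp r io :
  presents (rep t) phi al sp r io -> root_degree t = order (phi \o al) r.
Proof.
move=> pm; rewrite -(presents_degree pm) /root_degree.
by have [_ _ -> _ _] := pm.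
Qed.

Section weights.
Variables (R : realType) (nu : {posnum R}).
Hypothesis nu1 : 1 <= nu%:num.

Definition tri_weight t : R := nu%:num ^+ card_of (mono_edges (rep t)).

Lemma tri_weight_gt0 t : 0 < tri_weight t. Proof. exact: exprn_gt0. Qed.

Lemma presents_weight_le t t' (D D' : finType) (phi al : D -> D) sp r io
    (phi' al' : D' -> D') sp' r' io' :
  presents (rep t) phi al sp r io -> cmap phi al ->
  presents (rep t') phi' al' sp' r' io' -> cmap phi' al' ->
  (#|[pred d | sp d == sp (al d)]| <= #|[pred d | sp' d == sp' (al' d)]|)%N ->
  tri_weight t <= tri_weight t'.
Proof.
move=> pm cm pm' cm'; rewrite -(presents_mono pm cm) -(presents_mono pm' cm').
by rewrite leq_pmul2r// => h; rewrite /tri_weight ler_weXn2l.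
Qed.

(** Partition function of size [n] restricted to [A]. *)
Definition total n (A : pred ising_tri) : R := \sum_(t <- tris n | A t) tri_weight t.

Lemma total_ge0 n A : 0 <= total n A.
Proof. by rewrite sumr_ge0// => t _; exact: ltW (tri_weight_gt0 t). Qed.

Lemma total_le n (A B : pred ising_tri) : (forall t, t \in tris n -> A t -> B t) -> total n A <= total n B.
Proof.
move=> AB; rewrite /total [leLHS]big_mkcond [leRHS]big_mkcond /=.
rewrite big_seq [leRHS]big_seq; apply: ler_sum => t tn.
by case: ifP => [/(AB _ tn) ->//|_]; case: ifP => // _; exact: ltW (tri_weight_gt0 t).
Qed.

Lemma total_bound n : total n predT <= (8 ^+ 6 * nu%:num ^+ 3) ^+ n.
Proof.
apply: (@le_trans _ _ (\sum_(t <- tris n) nu%:num ^+ (3 * n))).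
  rewrite /total big_seq [leRHS]big_seq; apply: ler_sum => t /in_tris st.
  have [D [phi [al [sp [r [io [pm tm Dn]]]]]]] := size_tri_presents st.
  have [[cm _] _ _ _] := tm; rewrite /tri_weight ler_weXn2l//.
  have := presents_mono pm cm; have := max_card [pred d | sp d == sp (al d)].
  rewrite Dn => h1 h2; rewrite -h2 in h1; move: (card_of _) h1 => c; clear; lia.
rewrite big_const_seq count_predT iter_addr_0 -[leLHS]mulr_natl exprMn -!exprM.
by rewrite ler_pM2r ?exprn_gt0// -natrX ler_nat size_tris.
Qed.

Lemma ising_lawE n (A : set (borel_space R)) : 0 < total n predT ->
  ising_law nu n A = (total n (fun t => t \in A) / total n predT)%:E.
Proof.
have E (B : set (borel_space R)) : ising_weight nu n B = (total n (fun t => t \in B))%:E.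
  have fin : finite_set (B `&` size_tri n) by apply: finite_setIr; exact: size_tri_finite.
  rewrite /ising_weight esum_fset//.
  rewrite fsbig_finite// -sumEFin /total -[in RHS]big_filter.
  apply: perm_big; apply: uniq_perm; [exact: fset_uniq|by rewrite filter_uniq// tris_uniq|].
  move=> t; rewrite in_fset_set// mem_filter; apply/idP/andP.
    by rewrite inE => -[tB /in_tris tn]; rewrite inE.
  by rewrite !inE => -[tB /in_tris tn].
move=> Z0; have ET : ising_weight nu n setT = (total n predT)%:E.
  by rewrite E; congr EFin; apply: eq_bigl => t; rewrite inE; apply/asboolP.
transitivity (ising_weight nu n A * ((fine (ising_weight nu n setT))^-1)%:E)%E.
  rewrite /ising_law /= /mnormalize; case: ifP => // /orP[] /eqP h.
    have {}h : ising_weight nu n setT = 0%E := h.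
    by move: h Z0; rewrite ET => -[->]; rewrite ltxx.
  by have {}h : ising_weight nu n setT = +oo%E := h; rewrite ET in h.
by rewrite ET E -EFinM.
Qed.

End weights.

Lemma ler_sum_subset (R : numDomainType) (I : eqType) (s s' : seq I) (f : I -> R) :
  uniq s -> uniq s' -> {subset s <= s'} -> (forall i, 0 <= f i) ->
  \sum_(i <- s) f i <= \sum_(i <- s') f i.
Proof.
move=> us us' ss f0; rewrite [leRHS](bigID (mem s)) /= -[leLHS]addr0.
apply: lerD; last by rewrite sumr_ge0.
rewrite -[leRHS]big_filter (perm_big [seq i <- s' | i \in s])//.
apply: uniq_perm => //; first by rewrite filter_uniq.
by move=> i; rewrite mem_filter; case: (boolP (i \in s)) => //= /ss ->.
Qed.

(** * Weighted injections by vertex splitting *)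

Section splitting.
Variables (R : realType) (nu : {posnum R}).
Hypothesis nu1 : 1 <= nu%:num.
Local Notation total := (total nu).
Local Notation tri_weight := (tri_weight nu).

Let ok t i := iter i (nxt (rep t)) (root (rep t)) != opp (rep t) (root (rep t)).

Let iter_io m (D : finType) (phi al : D -> D) sp r io i :
  presents m phi al sp r io -> iter i (nxt m) (root m) = io (iter i (phi \o al) r).
Proof. by move=> [_ _ ior _ [ion _]]; elim: i => [|i /= ->]; rewrite ?ior//= ion. Qed.

Let okE t (D : finType) (phi al : D -> D) sp r io i : presents (rep t) phi al sp r io ->
  ok t i = (iter i (phi \o al) r != al r).
Proof.
move=> pm; rewrite /ok (iter_io i pm); have [ioi _ ior ioa _] := pm.
by rewrite -ior -ioa (inj_eq ioi).
Qed.

(** A relation and not a function, because the surgery acts on presentations whereas triangulations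
    are isomorphism classes. *)
Definition splits (t : ising_tri) (i : nat) (t' : ising_tri) : Prop :=
  exists (D : finType) (phi al : D -> D) (sp : D -> bool) (r : D) (io : D -> nat) io',
  [/\ presents (rep t) phi al sp r io, tri_map_axioms phi al sp,
      (0 < i < order (phi \o al) r)%N, iter i (phi \o al) r != al r &
      presents (rep t') (split_phi phi) (split_al phi al r i) (split_sp phi al sp r i)
        (split_root D) io'].

Let splits_exists n t i : size_tri n t -> (0 < i < root_degree t)%N -> ok t i ->
  exists t', splits t i t'.
Proof.
move=> st; have [D [phi [al [sp [r [io [pm tm Dn]]]]]]] := size_tri_presents st.
rewrite (presents_root_degree pm) (okE i pm) => /andP[i0 ir] oi.
have [t' [io' pt']] := class_presents (split_root D) (split_tri tm i0 ir oi).
by exists t', D, phi, al, sp, r, io, io'; rewrite i0.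
Qed.

Let splits_size n t i t' : size_tri n t -> splits t i t' -> size_tri n.+1 t'.
Proof.
move=> [_ eE] [D [phi [al [sp [r [io [io' [pm tm /andP[i0 ir] oi pm']]]]]]]].
apply: (presents_size_tri pm' (split_tri tm i0 ir oi)); rewrite split_card.
have [[cm _] _ _ _] := tm; rewrite (presents_darts pm cm) eE; clear; lia.
Qed.

Let splits_weight t i t' : splits t i t' -> tri_weight t <= tri_weight t'.
Proof.
move=> [D [phi [al [sp [r [io [io' [pm tm /andP[i0 ir] oi pm']]]]]]]].
have [[cm _] _ _ _] := tm; have [[cm' _] _ _ _] := split_tri tm i0 ir oi.
apply: (presents_weight_le nu1 pm cm pm' cm'); have := split_mono r i tm.
by rewrite !cardsE.
Qed.

Let splits_degree t i t' : splits t i t' -> (root_degree t <= root_degree t' + i)%N.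
Proof.
move=> [D [phi [al [sp [r [io [io' [pm tm /andP[i0 ir] oi pm']]]]]]]].
by rewrite (presents_root_degree pm) (presents_root_degree pm'); exact: split_degree tm i0 ir oi.
Qed.

Let splits_inj t1 i1 t2 i2 t' : splits t1 i1 t' -> splits t2 i2 t' -> t1 = t2 /\ i1 = i2.
Proof.
move=> [D [phi [al [sp [r [io [io1 [pm tm h o pm1]]]]]]]].
move=> [D' [phi' [al' [sp' [r' [io' [io2 [pm' tm' h' o' pm2]]]]]]]].
have /andP[i0 ir] := h; have /andP[i0' ir'] := h'.
have [[[_ sa _ _] _] _ _ _] := split_tri tm i0 ir o.
have [[[_ sa' _ _] _] _ _ _] := split_tri tm' i0' ir' o'.
have [[[_ ia _ _] _] _ _ _] := tm; have [[[_ ia' _ _] _] _ _ _] := tm'.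
have [|ri ->] := split_injective tm tm' h o h' o'.
  apply/(rooted_iso_map_iso pm1 pm2 sa sa').
  by exists id; split => //; split => // x xd; exists x.
by split => //; apply: rep_inj; apply/(rooted_iso_map_iso pm pm' ia ia').
Qed.

(** Only the [i] whose dart is the reversed root is excluded; there is at most one, present when the
    root edge is a loop. *)
Let ok_count n t L : size_tri n t -> (L.+1 < root_degree t)%N ->
  (L <= count (ok t) (iota 1 L.+1))%N.
Proof.
move=> st; have [D [phi [al [sp [r [io [pm tm Dn]]]]]]] := size_tri_presents st.
rewrite (presents_root_degree pm) => Lr.
have := count_predC (ok t) (iota 1 L.+1); rewrite size_iota.
suff : (count (predC (ok t)) (iota 1 L.+1) <= 1)%N by clear; lia.
rewrite -size_filter; pose s := [seq i <- iota 1 L.+1 | predC (ok t) i]; rewrite -/s.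
have us : uniq s by rewrite filter_uniq// iota_uniq.
have sP i : i \in s -> (i < order (phi \o al) r)%N /\ iter i (phi \o al) r = al r.
  rewrite mem_filter mem_iota /= (okE i pm) negbK => /andP[/eqP h1 h2]; split => //.
  by apply: leq_ltn_trans Lr; move: h2; clear; lia.
case: s us sP => [|i [|j s]]// /and3P[ij _ _] sP.
have [ri ei] : (i < order (phi \o al) r)%N /\ iter i (phi \o al) r = al r.
  by apply: sP; rewrite inE eqxx.
have [rj ej] : (j < order (phi \o al) r)%N /\ iter j (phi \o al) r = al r.
  by apply: sP; rewrite !inE eqxx orbT.
have := findex_iter ri; have := findex_iter rj; rewrite ei ej => -> E.
by rewrite E inE eqxx in ij.
Qed.

(** Each triangulation on the left has at least [L] splittings with [i <= L.+1]. None lowers the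
    weight, the root keeps degree at least [j], and [splits_inj] makes the results distinct. *)
Lemma split_total n j L : (0 < j)%N ->
  L%:R * total n (fun t => (j + L.+1 <= root_degree t)%N) <=
  total n.+1 (fun t => (j <= root_degree t)%N).
Proof.
move=> j0; pose s := [seq t <- tris n | (j + L.+1 <= root_degree t)%N].
pose P := [seq (t, i) | t <- s, i <- [seq i <- iota 1 L.+1 | ok t i]].
have us : uniq s by rewrite filter_uniq// tris_uniq.
have uP : uniq P.
  apply: allpairs_uniq_dep => //; first by move=> t _; rewrite filter_uniq// iota_uniq.
  by move=> [t i] [t' i'] _ _ /= [-> ->].
have PP t i : (t, i) \in P ->
    [/\ size_tri n t, (j + L.+1 <= root_degree t)%N, (0 < i <= L.+1)%N & ok t i].
  move=> /allpairsPdep[t' [i' [ts' + [-> ->]]]].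
  rewrite mem_filter mem_iota => /andP[oi ii]; move: ts'; rewrite mem_filter => /andP[h1 /in_tris h2].
  by split => //; move: ii; rewrite ltnS.
have /choice[F hF] : forall p : ising_tri * nat, exists t', p \in P -> splits p.1 p.2 t'.
  move=> [t i]; case: (boolP ((t, i) \in P)) => [/PP[st jt /andP[i0 iL] oi]|]; last by exists t.
  have [|t' h] := splits_exists st _ oi; last by exists t'.
  by rewrite i0 /=; apply: leq_ltn_trans iL _; apply: leq_trans jt; move: j0; clear; lia.
have Fi : {in P &, injective F}.
  move=> [t i] [t' i'] p1 p2 E; have := hF _ p1; have := hF _ p2; rewrite E => h1 h2.
  by have [/= -> ->] := splits_inj h2 h1.
apply: (@le_trans _ _ (\sum_(p <- P) tri_weight p.1)).
  rewrite /total mulr_sumr -big_filter -/s /P big_allpairs_dep.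
  rewrite big_seq [leRHS]big_seq; apply: ler_sum => t; rewrite mem_filter => /andP[jt /in_tris tn].
  rewrite (eq_bigr (fun=> tri_weight t))// big_const_seq count_predT iter_addr_0.
  rewrite -[leRHS]mulr_natl size_filter.
  rewrite ler_pM2r ?tri_weight_gt0// ler_nat; apply: ok_count tn _.
  by apply: leq_trans jt; move: j0; clear; lia.
apply: (@le_trans _ _ (\sum_(p <- P) tri_weight (F p))).
  rewrite big_seq [leRHS]big_seq; apply: ler_sum => p pP; exact: splits_weight (hF _ pP).
rewrite -(big_map F xpredT tri_weight) /total -[leRHS]big_filter.
apply: ler_sum_subset.
- by rewrite map_inj_in_uniq.
- by rewrite filter_uniq// tris_uniq.
- move=> _ /mapP[[t i] tP ->]; have h := hF _ tP; have [st jt /andP[_ iL] _] := PP _ _ tP.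
  rewrite mem_filter; apply/andP; split; last by apply/in_tris; exact: splits_size st h.
  have := splits_degree h; move: jt iL => /=; clear.
  by move: (root_degree t) (root_degree _) => x y; lia.
- by move=> t; exact: ltW (tri_weight_gt0 nu t).
Qed.

Lemma tail_total n j L m : (0 < j)%N ->
  L%:R ^+ m * total n (fun t => (j + m * L.+1 <= root_degree t)%N) <=
  total (n + m) (fun t => (j <= root_degree t)%N).
Proof.
elim: m n j => [|m IH] n j j0.
  by rewrite expr0 mul1r addn0; apply: total_le => t _; rewrite mul0n addn0.
rewrite exprSr -mulrA addnS -addSn; apply: le_trans (IH _ _ j0).
rewrite ler_wpM2l ?exprn_ge0//.
have -> : (fun t => (j + m.+1 * L.+1 <= root_degree t)%N) =
    (fun t => (j + m * L.+1 + L.+1 <= root_degree t)%N).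
  by apply/funext => t; congr (_ <= _)%N; clear; lia.
by apply: split_total; rewrite addn_gt0 j0.
Qed.

(** The triangle is split repeatedly at a root of degree at least two. Such a root exists, since
    otherwise [phi] would equal [al], whose cube is not the identity. *)
Lemma tris_nonempty n : exists t, t \in tris n.+1.
Proof.
elim: n => [|n [t /in_tris tn]].
  have [D [phi [al [sp [r [io [pm tm]]]]]]] := finite_triangulation_presents triangleP.
  have D6 : #|D| = 6%N.
    have [ioi ioR _ _ _] := pm.
    have := card_of_uniq (_ : uniq (map io (enum D))); rewrite size_map -cardE => <-.
      rewrite (_ : [set` _] = [set` iota 0 6]) ?card_of_uniq//.
      transitivity (range io).
        apply/seteqP; split => x /=; first by move=> /mapP[d _ ->]; exists d.
        by move=> [d _ <-]; apply: map_f; rewrite mem_enum.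
      by rewrite ioR; apply/seteqP; split => x; move: x => [|[|[|[|[|[|x]]]]]].
    by rewrite map_inj_uniq// enum_uniq.
  have [t [io' pt]] := class_presents r tm; exists t; apply/in_tris.
  by apply: (presents_size_tri pt tm); rewrite D6.
have [D [phi [al [sp [r [io [pm tm Dn]]]]]]] := size_tri_presents tn.
have [[cm _] p3 pn _] := tm; have [ip ia na _] := cm.
have sgi : injective (phi \o al) by apply: inj_comp => //; exact: inv_inj.
have [r' nr'] : exists r', phi (al r') != r'.
  apply/existsP; apply: contraT => /existsPn h.
  have e d : phi (al d) = d by apply/eqP; rewrite -[_ == _]negbK; exact: h.
  have e' d : phi d = al d by rewrite -{1}[d]ia e.
  by have := pn r; rewrite -[X in _ != X]p3 !e' ia eqxx.
have [t1 [io1 pt1]] := class_presents r' tm.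
have st1 : size_tri n.+1 t1 by exact: presents_size_tri pt1 tm Dn.
have [||t' h] := @splits_exists n.+1 t1 1 st1.
- rewrite (presents_root_degree pt1) /= [(1 < _)%N]ltn_neqAle order_gt0 andbT; apply/eqP => o1.
  by have := iter_order sgi r'; rewrite -o1 /= => /eqP; rewrite (negPf nr').
- by rewrite (okE 1 pt1) /= pn.
by exists t'; apply/in_tris; exact: splits_size st1 h.
Qed.

Lemma total_gt0 n : 0 < total n.+1 predT.
Proof.
have [t tn] := tris_nonempty n; rewrite /total (bigD1_seq t) ?tris_uniq//=.
by rewrite ltr_pwDl ?tri_weight_gt0// sumr_ge0// => i _; exact: ltW (tri_weight_gt0 nu i).
Qed.

End splitting.

(** A maximum over a long enough window starting at [N] is a record: beyond the window the bound
    [2^-1 ^+ n] is already below [z N]. *)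
Lemma record_exists (R : realType) (z : nat -> R) N : (forall n, (N <= n)%N -> 0 < z n) ->
  (forall n, z n <= 2^-1 ^+ n) ->
  exists2 n, (N <= n)%N & forall m, z (n + m)%N <= z n.
Proof.
move=> z0 z2; have zN := z0 N (leqnn _).
have [M hM] : exists M, (z N)^-1 <= 2 ^+ M.
  by exists (Num.bound (z N)^-1); exact: ltW (upper_nthrootP _).
have [i _ hi] := @arg_maxP _ _ 'I_M.+1 ord0 xpredT (fun i => z (N + i)%N) isT.
exists (N + i)%N; first exact: leq_addr.
move=> m; have [le|gt] := leqP (i + m) M.
  by rewrite -addnA; exact: (hi (Ordinal (le : (i + m < M.+1)%N))).
apply: (le_trans (z2 _)); apply: (@le_trans _ _ (z N)); last first.
  by have := hi ord0 isT; rewrite /= addn0.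
rewrite exprVn -[z N]invrK lef_pV2 ?posrE ?invr_gt0 ?exprn_gt0//.
by apply: (le_trans hM); rewrite ler_weXn2l ?ler1n//; move: gt; clear; lia.
Qed.

(** [C] is the growth rate in [total_bound]. Division by [(2 * C) ^+ n] gives a sequence tending to
    zero, hence records, at which size [n + m] has at most [(2 * C) ^ m] times the total weight of
    size [n]. With [L >= 64 * (2 * C)], [tail_total] then leaves a factor [64 ^- m]. *)
Lemma degree_tail (R : realType) (nu : {posnum R}) : 1 <= nu%:num ->
  exists K : nat, forall N, exists2 n, (N < n)%N &
  forall m, total nu n (fun t => (m * K < root_degree t)%N) <= total nu n predT / 64 ^+ m.
Proof.
move=> nu1; pose C : R := 8 ^+ 6 * nu%:num ^+ 3.
have C0 : 0 < C by rewrite mulr_gt0 ?exprn_gt0.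
pose L := Num.bound (64 * (2 * C)); have hL : 64 * (2 * C) <= L%:R.
  by apply/ltW/archi_boundP; rewrite !mulr_ge0// ltW.
have L0 : 0 < L%:R :> R by apply: lt_le_trans hL; rewrite !mulr_gt0.
exists L.+1 => N; pose z n := total nu n predT / (2 * C) ^+ n.
have C2 n : 0 < (2 * C) ^+ n by rewrite exprn_gt0// mulr_gt0.
have [||n Nn rec] := @record_exists R z N.+1.
- by case=> // n _; rewrite divr_gt0//; exact: total_gt0.
- move=> n; rewrite ler_pdivrMr// exprMn mulrA -exprMn mulVf// expr1n mul1r.
  exact: total_bound.
exists n => // m; have := rec m; rewrite /z ler_pdivrMr// exprD mulrA divfK ?gt_eqF// => rm.
have := tail_total nu1 n L m (leqnn 1); rewrite add1n => tm.
have pl : total nu (n + m) (fun t => (0 < root_degree t)%N) <= total nu (n + m) predT.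
  exact: total_le.
have {}tm := le_trans tm (le_trans pl rm).
have h : L%:R ^+ m * total nu n (fun t => (m * L.+1 < root_degree t)%N) <=
    L%:R ^+ m * (total nu n predT / 64 ^+ m).
  apply: (le_trans tm); rewrite [leRHS]mulrCA ler_wpM2l ?total_ge0//.
  by rewrite ler_pdivlMr ?exprn_gt0// -exprMn lerXn2r ?nnegrE ?mulr_ge0 ?(ltW L0)// ?(ltW C0)// mulrC.
by move: h; rewrite ler_pM2l// exprn_gt0.
Qed.

(** * Rerooting *)

Definition reroot (m : smap) (d : nat) : smap := SMap (darts m) d (opp m) (nxt m) (spin m).

Lemma reroot_presents m (D : finType) (phi al : D -> D) sp r io e :
  presents m phi al sp r io -> presents (reroot m (io e)) phi al sp e io.
Proof. by move=> [ioi ioR _ ioa [ion ios]]. Qed.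

Lemma map_closed m : is_map m ->
  forall d, darts m d -> darts m (opp m d) /\ darts m (nxt m d).
Proof.
move=> [_ [nD _ _] om _ _] d dd; have [oD _ _] := om _ dd; split => //; exact: nD.
Qed.

(** The root is fixed, hence so is everything reached from it by [nxt] and [opp], which is the whole
    map by connectedness. *)
Lemma iso_rigid m h : is_map m -> iso_by h m m -> forall d, darts m d -> h d = d.
Proof.
move=> mm [_ hr hE] d dd; have [_ _ _ _ con] := mm; have [k] := con _ dd.
have vh x y : darts m x -> h x = x -> vertex m x y -> h y = y.
  move=> dx hx [j _ <-]; elim: j => //= j IH.
  have [_ -> _] := hE (iter j (nxt m) x) (vertex_dart mm dx (imageT _ j)).
  by rewrite IH.
elim: k d {dd} => [|k IH] d; first by apply: vh hr; case: mm.
move=> [/IH//|[e we]]; apply: vh; first by have [] := map_closed mm (within_dart mm we).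
by have [-> _ _] := hE _ (within_dart mm we); rewrite IH.
Qed.

Section rerooting.
Variables (R : realType) (nu : {posnum R}).
Local Notation wt := (tri_weight nu).

Let dart_seq t : seq nat := fset_set (darts (rep t)).

Lemma sum_darts t (D : finType) (phi al : D -> D) sp r io (f : nat -> R) :
  presents (rep t) phi al sp r io -> \sum_(d <- dart_seq t) f d = \sum_e f (io e).
Proof.
move=> [ioi ioR _ _ _]; rewrite -(big_map io xpredT f) /=; apply: perm_big.
have fin : finite_set (darts (rep t)) by rewrite -ioR; exact: finite_image.
apply: uniq_perm; [exact: fset_uniq|by rewrite map_inj_uniq// index_enum_uniq|].
move=> x; rewrite in_fset_set//; apply/idP/mapP.
  by rewrite inE -ioR => -[e _ <-]; exists e; rewrite // mem_index_enum.
by move=> [e _ ->]; rewrite inE -ioR; exists e.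
Qed.

Let in_dart_seq n t d : size_tri n t -> d \in dart_seq t <-> darts (rep t) d.
Proof. by move=> [[_ [fin _]] _]; rewrite in_fset_set// inE. Qed.

(** Exchanging the root with a marked dart permutes the pairs of a triangulation and a dart, and the
    weight does not depend on the root. The factor [6 * n] is the number of darts. *)
Lemma reroot_total n : exists Th : ising_tri -> nat -> ising_tri,
  (forall t d, size_tri n t -> darts (rep t) d -> map_iso (reroot (rep t) d) (rep (Th t d))) /\
  forall G : ising_tri -> R,
    \sum_(t <- tris n) wt t * \sum_(d <- dart_seq t) G (Th t d) =
    (6 * n)%:R * \sum_(t <- tris n) wt t * G t.
Proof.
have /choice[H hH] : forall p : ising_tri * nat, exists tf : ising_tri * (nat -> nat),
    size_tri n p.1 -> darts (rep p.1) p.2 -> iso_by tf.2 (reroot (rep p.1) p.2) (rep tf.1).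
  move=> [t d]; have [[st dd]|h] := pselect (size_tri n t /\ darts (rep t) d); last first.
    by exists (t, id) => /= h1 h2; case: h.
  have [D [phi [al [sp [r [io [pm tm Dn]]]]]]] := size_tri_presents st.
  have [e de] := presents_dartP pm dd.
  have pr := reroot_presents e pm; rewrite -de in pr.
  have [t' [f fi]] := class_of_map (presents_finite_triangulation pr tm).
  by exists (t', f).
pose Th t d := (H (t, d)).1; pose f t d := (H (t, d)).2.
have fi t d : size_tri n t -> darts (rep t) d -> iso_by (f t d) (reroot (rep t) d) (rep (Th t d)).
  by move=> st dd; exact: (hH (t, d)).
have tp t d : size_tri n t -> darts (rep t) d ->
    exists (D : finType) (phi al : D -> D) sp r io e io',
    [/\ presents (rep t) phi al sp r io, tri_map_axioms phi al sp, #|D| = (6 * n)%N, d = io e &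
        presents (rep (Th t d)) phi al sp e io'].
  move=> st dd; have [D [phi [al [sp [r [io [pm tm Dn]]]]]]] := size_tri_presents st.
  have [e de] := presents_dartP pm dd.
  have pr := reroot_presents e pm; rewrite -de in pr.
  have [|io' pi] := presents_iso pr (_ : map_iso _ (rep (Th t d))).
    by exists (f t d); exact: fi.
  by exists D, phi, al, sp, r, io, e, io'.
exists Th; split => [t d st dd|G]; first by exists (f t d); exact: fi.
pose Q := [seq (t, d) | t <- tris n, d <- dart_seq t].
pose Theta (p : ising_tri * nat) := (Th p.1 p.2, f p.1 p.2 (root (rep p.1))).
have uQ : uniq Q.
  apply: allpairs_uniq_dep => //; first exact: tris_uniq.
    by move=> t _; exact: fset_uniq.
  by move=> [t d] [t' d'] _ _ /= [-> ->].
have QP t d : (t, d) \in Q <-> size_tri n t /\ darts (rep t) d.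
  split=> [/allpairsPdep[t' [d' [/in_tris h1 + [-> ->]]]]|[st dd]].
    by move=> /(in_dart_seq _ h1).
  by apply/allpairsPdep; exists t, d; split => //; [exact/in_tris|exact/(in_dart_seq _ st)].
have ThQ p : p \in Q -> Theta p \in Q.
  case: p => t d /QP[st dd]; apply/QP.
  have [D [phi [al [sp [r [io [e [io' [pm tm Dn _ pm']]]]]]]]] := tp _ _ st dd.
  split; first exact: presents_size_tri pm' tm Dn.
  by have [[h _ _] _ _] := fi _ _ st dd; apply: h; case: (rep_is_map t).
have Thi : {in Q &, injective Theta}.
  move=> [t1 d1] [t2 d2] /QP[st1 dd1] /QP[st2 dd2] [E1 E2].
  have f1 := fi _ _ st1 dd1; have f2 := fi _ _ st2 dd2; rewrite -E1 /= in f2.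
  have mm2 := rep_is_map t2.
  have [g [gi gf fg]] := iso_by_inv (m := reroot (rep t2) d2) dd2 (map_closed mm2) f2.
  (* [h] matches the old roots and the marked darts: the former makes the two classes equal, after
     which rigidity identifies the marked darts. *)
  have hi := iso_by_comp f1 gi; set h := g \o f t1 d1 in hi.
  have dr2 : darts (rep t2) (root (rep t2)) by case: mm2.
  have hr : h (root (rep t1)) = root (rep t2) by rewrite /h /= E2 gf.
  have [hb hd hE] := hi.
  have E : t1 = t2 by apply: rep_inj; exists h; split.
  subst t2; congr (_, _); move: hd => /= <-; apply/esym.
  by apply: (@iso_rigid (rep t1) h mm2 _ _ dd1); split.
have pQ : perm_eq (map Theta Q) Q.
  apply: uniq_perm => //; first by rewrite map_inj_in_uniq.
  have um : uniq (map Theta Q) by rewrite map_inj_in_uniq.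
  have sub : {subset map Theta Q <= Q} by move=> _ /mapP[p pQ ->]; exact: ThQ.
  by have [] := uniq_min_size um sub; rewrite ?size_map.
transitivity (\sum_(p <- Q) wt (Theta p).1 * G (Theta p).1).
  rewrite /Q big_allpairs_dep big_seq [RHS]big_seq; apply: eq_bigr => t /in_tris st.
  rewrite mulr_sumr big_seq [RHS]big_seq; apply: eq_bigr => d /(in_dart_seq _ st) dd /=.
  have [D [phi [al [sp [r [io [e [io' [pm [[cm _] _ _ _] _ _ pm']]]]]]]]] := tp _ _ st dd.
  congr (_ * _); rewrite /tri_weight; congr (_ ^+ _); apply/eqP.
  by rewrite -(@eqn_pmul2r 2)// (presents_mono pm cm) (presents_mono pm' cm).
rewrite -(big_map Theta xpredT (fun p => wt p.1 * G p.1)) (perm_big _ pQ) /=.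
rewrite /Q big_allpairs_dep mulr_sumr big_seq [RHS]big_seq; apply: eq_bigr => t /in_tris st.
have [D [phi [al [sp [r [io [pm tm Dn]]]]]]] := size_tri_presents st.
rewrite /= (@sum_darts _ _ _ _ _ _ _ (fun=> wt t * G t) pm) sumr_const Dn.
by rewrite mulr_natl.
Qed.

End rerooting.

(** The part of [S] reached within [k] steps grows strictly until it is all of [S], so [#|S|] steps
    suffice. *)
Lemma connected_within m (D : finType) (phi al : D -> D) sp r io (S : {set D}) x :
  presents m phi al sp r io -> cmap phi al -> connected_in (dart_adj phi al) S ->
  froot (phi \o al) r \in S -> x \in S -> within m #|S| (io x).
Proof.
move=> pm [ip ia na _] cS rS.
have sgi : injective (phi \o al) by apply: inj_comp => //; exact: inv_inj.
have [ioi ioR ior ioa [ion _]] := pm.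
have wE k d e : fconnect (phi \o al) d e -> within m k (io d) -> within m k (io e).
  move=> /iter_findex <- wd; elim: (findex _ _ _) => //= j.
  by rewrite ion; exact: within_nxt.
pose W k : {set D} := [set y in S | `[< within m k (io y) >]].
have inW k y : y \in W k <-> y \in S /\ within m k (io y).
  by rewrite !inE; split => [/andP[-> /asboolP]|[-> /asboolP]].
have W0 : froot (phi \o al) r \in W 0.
  apply/inW; split => //; apply: wE (connect_root _ r) _.
  by rewrite ior; exists 0%N.
have Wsub k : W k \subset W k.+1.
  by apply/fintype.subsetP => y /inW[yS wy]; apply/inW; split => //; left.
have step k : W k = S \/ (#|W k| < #|W k.+1|)%N.
  case: (eqVneq (W k) S) => [|ne]; [by left|right].
  apply: proper_card; rewrite finset.properEneq Wsub andbT; apply: contra ne => /eqP E.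
  rewrite finset.eqEsubset; apply/andP; split; first by apply/fintype.subsetP => y /inW[].
  apply/fintype.subsetP => y yS.
  have adjW a b : a \in S -> b \in S -> dart_adj phi al a b -> a \in W k -> b \in W k.
    move=> aS bS /existsP[d /andP[/eqP da /eqP db]] /inW[_ wa]; rewrite E.
    apply/inW; split => //.
    have wd : within m k (io d).
      by apply: wE wa; rewrite -da fconnect_sym//; exact: connect_root.
    by rewrite -db; apply: wE (connect_root _ _) _; rewrite ioa; exact: within_opp.
  have sym := dart_adj_sym phi ia.
  rewrite (cS (fun y => y \in W k) _ y (froot (phi \o al) r)) //.
    by elim: (k) => // j; exact: (fintype.subsetP (Wsub j)).
  move=> a b aS bS ab; apply/idP/idP; first exact: adjW.
  by apply: adjW => //; rewrite sym.
have grow k : (k < #|W k|)%N \/ W k = S.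
  elim: k => [|k [IH|IH]]; first by left; rewrite card_gt0; apply/finset.set0Pn; exists (froot (phi \o al) r).
    case: (step k) => [E|lt]; last by left; apply: leq_ltn_trans lt.
    right; apply/eqP; rewrite finset.eqEsubset; apply/andP; split.
      by apply/fintype.subsetP => y /inW[].
    by rewrite -{1}E.
  right; apply/eqP; rewrite finset.eqEsubset; apply/andP; split; first by apply/fintype.subsetP => y /inW[].
  by rewrite -{1}IH.
move=> xS; have [lt|E] := grow #|S|; last by move: xS; rewrite -{1}E => /inW[].
have : (#|W #|S| | <= #|S|)%N by apply: subset_leq_card; apply/fintype.subsetP => y /inW[].
by rewrite leqNgt lt.
Qed.

Lemma flat_vertex_flat (R : realType) m (D : finType) (phi al : D -> D) sp e io n (eps : R) :
  presents m phi al sp e io -> cmap phi al ->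
  flat_vertex phi al n eps (froot (phi \o al) e) -> flat m n eps.
Proof.
move=> pm cm [g [g1 ge_ gs]]; have [ip ia na _] := cm.
have sgi : injective (phi \o al) by apply: inj_comp => //; exact: inv_inj.
have [ioi ioR ior ioa [ion _]] := pm.
pose G x := if [pick d | io d == x] is Some d then g (froot (phi \o al) d) else 0.
have GE d : G (io d) = g (froot (phi \o al) d).
  by rewrite /G; case: pickP => [d' /eqP/ioi ->//|/(_ d)]; rewrite eqxx.
exists G; split.
- move=> _ /(presents_dartP pm)[d ->]; rewrite -ion !GE; congr g.
  exact: (froot_step sgi d).
- by rewrite -ior GE.
- move=> _ /(presents_dartP pm)[d ->] nw; rewrite GE; apply/eqP; apply: contraT => /gs.
  move=> [S [cS eS dS Sn]]; case: nw; apply: (within_le Sn).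
  have w0 := connected_within pm cm cS eS dS.
  have fc : fconnect (phi \o al) (froot (phi \o al) d) d.
    by rewrite fconnect_sym//; exact: connect_root.
  by rewrite -(iter_findex fc); elim: (findex _ _ _) => //= j; rewrite ion; exact: within_nxt.
- move=> s us sd.
  have [s' sE] : exists s', s = map io s'.
    elim: s {us} sd => [|x s IH] sd; first by exists [::].
    have [|s' ->] := IH; first by move=> d ds; apply: sd; rewrite inE ds orbT.
    have [d ->] := presents_dartP pm (sd x (mem_head _ _)).
    by exists (d :: s').
  rewrite sE big_map; apply: (le_trans _ ge_); rewrite /energy.
  rewrite (eq_bigr (fun d => (g (froot (phi \o al) d) - g (froot (phi \o al) (al d))) ^+ 2)).
    apply: ler_sum_subset.
    + by move: us; rewrite sE => /map_uniq.
    + exact: index_enum_uniq.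
    + by move=> d _; rewrite mem_index_enum.
    + by move=> d; exact: sqr_ge0.
  by move=> d _; rewrite -ioa !GE.
Qed.

(** * Probability that the root is not flat *)

Section not_flat_total.
Variables (R : realType) (nu : {posnum R}) (n K r : nat) (eps eta c0 : R) (s : seq (nat * R)).
Hypothesis n0 : (0 < n)%N.
Hypothesis s_ge0 : all (fun p => 0 <= p.2) s.
Hypothesis s_le : c0 + \sum_(p <- s) p.2 / 64 ^+ p.1 <= eta.
Hypothesis bad_le : forall (D : finType) (phi al : D -> D), planar phi al ->
  \sum_(e : D) (~~ `[< flat_vertex phi al r eps (froot (phi \o al) e) >])%:R <=
  c0 * #|D|%:R + \sum_(p <- s) p.2 * \sum_(e : D) (K * p.1 < order (phi \o al) e)%N%:R :> R.
Hypothesis tail : forall m,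
  total nu n (fun t => (m * K < root_degree t)%N) <= total nu n predT / 64 ^+ m.

Let totalE A : total nu n A = \sum_(t <- tris n) tri_weight nu t * (A t)%:R.
Proof.
by rewrite /total big_mkcond; apply: eq_bigr => t _; case: (A t); rewrite ?mulr1 ?mulr0.
Qed.

(** Rerooting is used in both directions: the weight of non-flat roots becomes a count of non-flat
    darts, bounded in each map by [bad_le]; the counts of darts of large degree in that bound become
    root degrees again, where [tail] applies. *)
Lemma not_flat_total :
  total nu n (fun t => ~~ `[< flat (rep t) r eps >]) <= eta * total nu n predT.
Proof.
have N0 : 0 < (6 * n)%:R :> R by rewrite ltr0n muln_gt0.
rewrite -(ler_pM2l N0) totalE.
have [Th [ThI ThE]] := reroot_total nu n.
rewrite -(ThE (fun t => (~~ `[< flat (rep t) r eps >])%:R)).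
pose X p t : R := \sum_(d <- fset_set (darts (rep t))) (p * K < root_degree (Th t d))%N%:R.
apply: (@le_trans _ _ (\sum_(t <- tris n) tri_weight nu t *
    (c0 * (6 * n)%:R + \sum_(p <- s) p.2 * X p.1 t))).
  rewrite big_seq [leRHS]big_seq; apply: ler_sum => t /in_tris st.
  rewrite ler_pM2l ?tri_weight_gt0//.
  have [D [phi [al [sp [r0 [io [pm tm Dn]]]]]]] := size_tri_presents st.
  have [pl _ _ _] := tm; have [cm _] := pl.
  have pt e : exists io', presents (rep (Th t (io e))) phi al sp e io'.
    apply: presents_iso (reroot_presents e pm) _; apply: ThI => //.
    exact: presents_dart pm e.
  rewrite (sum_darts _ pm) -Dn.
  apply: le_trans (le_trans _ (bad_le pl)) _.
    apply: ler_sum => e _; have [io' pe] := pt e; rewrite ler_nat.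
    case: (asboolP (flat_vertex _ _ _ _ _)) => [/(flat_vertex_flat pe cm) h|_] /=.
      by rewrite asboolT.
    by case: (~~ _).
  rewrite lerD2l big_seq [leRHS]big_seq; apply: ler_sum => p ps.
  rewrite ler_wpM2l//; first exact: (allP s_ge0).
  rewrite /X (sum_darts _ pm) le_eqVlt; apply/orP; left; apply/eqP; apply: eq_bigr => e _.
  by have [io' pe] := pt e; rewrite (presents_root_degree pe) mulnC.
rewrite (eq_bigr (fun t => tri_weight nu t * (c0 * (6 * n)%:R) +
    \sum_(p <- s) p.2 * (tri_weight nu t * X p.1 t))); last first.
  move=> t _; rewrite mulrDr mulr_sumr; congr (_ + _); apply: eq_bigr => p _.
  by rewrite mulrCA.
rewrite big_split /= exchange_big /= -mulr_suml.
apply: (@le_trans _ _ ((6 * n)%:R * total nu n predT *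
    (c0 + \sum_(p <- s) p.2 / 64 ^+ p.1))); last first.
  rewrite [_%:R * (_ * _)]mulrCA [leRHS]mulrC; apply: ler_wpM2l s_le.
  by rewrite mulr_ge0 ?total_ge0// ltW.
rewrite mulrDr; apply: lerD.
  by rewrite -/(total nu n predT) [leLHS]mulrC [leRHS]mulrC -mulrA.
rewrite mulr_sumr big_seq [leRHS]big_seq; apply: ler_sum => p ps.
rewrite -mulr_sumr (ThE (fun t => (p.1 * K < root_degree t)%N%:R)).
rewrite -(totalE (fun t => (p.1 * K < root_degree t)%N)).
rewrite [leRHS]mulrCA; apply: ler_wpM2l; first exact: (allP s_ge0).
by rewrite -mulrA ler_pM2l.
Qed.

End not_flat_total.

Theorem theorem1p2 (R : realType) (P : probability (borel_space R) R) :
  IIPT_law (nu_c R) P ->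
  {ae P, forall t, srw_recurrent R (rep t)}.
Proof.
move=> law; have nu1 : 1 <= (nu_c R)%:num by rewrite /= lerDl invr_ge0 sqrtr_ge0.
have [K tail] := degree_tail nu1.
pose bad r (eps : R) := [set t : borel_space R | ~ flat (rep t) r eps].
have small (eps eta : R) : 0 < eps -> 0 < eta -> exists r, (P (bad r eps) <= eta%:E)%E.
  move=> eps0 eta0; have [r [c0 [s [s0 sl h]]]] := bad_dart_bound K eta0 eps0.
  exists r; rewrite leNgt; apply/negP => lt.
  (* If the limit exceeded [eta], so would the laws at all large sizes, in particular at some record
     size, where [not_flat_total] gives at most [eta]. *)
  have := not_flat_cvg (r := r) (eps := eps) law.
  move=> /(_ [set y | (eta%:E < y)%E]).
  have /[swap]/[apply] : nbhs (P (bad r eps)) [set y | (eta%:E < y)%E].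
    by apply: open_nbhs_nbhs; split; [exact: open_ereal_gt_ereal|exact: lt].
  move=> [N _ hN]; have [n Nn tn] := tail N.
  have n0 : (0 < n)%N by exact: leq_ltn_trans Nn.
  have : (eta%:E < ising_law (nu_c R) n (bad r eps))%E := hN n (ltnW Nn).
  have Z0 : 0 < total (nu_c R) n predT by case: n n0 {Nn tn hN} => // n _; exact: total_gt0.
  rewrite ising_lawE// lte_fin ltr_pdivlMr//; apply/negP; rewrite -leNgt.
  have cardE (D : finType) (Q : pred D) : #|[set v | Q v]%SET|%:R = \sum_v (Q v)%:R :> R.
    rewrite -sum1_card natr_sum big_mkcond /=; apply: eq_bigr => v _.
    by rewrite inE; case: (Q v).
  have := @not_flat_total R (nu_c R) n K r eps eta c0 s n0 s0 sl _ tn.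
  move=> h2; apply: (le_trans _ (h2 _)).
    apply: total_le => t _; rewrite inE => /= nf; exact/asboolPn.
  move=> D phi al pl; have := h D phi al pl; rewrite cardE => /le_trans; apply.
  by rewrite lerD2l; apply: ler_sum => p _; rewrite cardE.
(* One radius is enough for flatness at a given precision, hence the intersection over [r]; the
   precisions [1 / (j + 1)] leave a countable union of null events. *)
have neg j : P.-negligible (\bigcap_r bad r (j.+1%:R^-1 : R)).
  have mb : measurable (\bigcap_r bad r (j.+1%:R^-1 : R)).
    by apply: bigcapT_measurable => r; exact: not_flat_measurable.
  exists (\bigcap_r bad r (j.+1%:R^-1 : R)); split => //.
  apply/eqP; rewrite eq_le measure_ge0 andbT; apply/lee_addgt0Pr => eta eta0.
  have j0 : 0 < j.+1%:R^-1 :> R by rewrite invr_gt0.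
  have [r hr] := small _ _ j0 eta0; rewrite add0e.
  apply: le_trans hr; apply: le_measure; rewrite ?inE//; first exact: not_flat_measurable.
  exact: bigcap_inf.
apply: negligibleS (negligible_bigcup neg) => t /= nr.
apply: contrapT => h; apply: nr; apply: flat_recurrent; first exact: rep_is_map.
move=> eps eps0; apply: contrapT => nf; apply: h.
have [j hj] : exists j, (j.+1%:R^-1 : R) <= eps.
  exists (Num.bound eps^-1); rewrite -[leRHS]invrK lef_pV2 ?posrE ?invr_gt0//.
  apply/ltW; apply: lt_trans (archi_boundP _) _; rewrite ?invr_ge0 ?(ltW eps0)//.
  by rewrite ltr_nat.
exists j => // r _ [g [g1 g2 g3 g4]]; apply: nf; exists r, g; split => // s0 u0 d0.
exact: le_trans (g4 _ u0 d0) hj.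
Qed.
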